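(* Let $n$ be a positive integer, $N=n^2-n+1$, and let $p_1$ be a prime not dividing $N$ such that $\mathcal{H}_n^{(p_1)}$ is maximal. Let $m_1=p_1\bmod N$ and $m_2=N-m_1$. If $p_2$ is a prime not dividing $N$ such that $\mathcal{H}_n^{(p_2)}$ is maximal and $p_2\equiv m_2\pmod N$, then $$a(\mathcal{H}_n^{(p_1)})+a(\mathcal{H}_n^{(p_2)})=g(\mathcal{H}_n^{(p_1)}).$$
   Context: For integers $a$ and $b\geq 1$, $a \bmod b$ denotes the residue of $a$ in $\{0,1,\dots,b-1\}$. For a positive integer $n$ and a prime $p$ not dividing $N=n^2-n+1$, $\mathcal{H}_n^{(p)}$ denotes the Hurwitz function field $K(S,T)$ with $S^nT+T^n+S=0$ over a base field $K$ of characteristic $p$ (either an algebraically closed field or a finite field $\mathbb{F}_{q^2}$ with $q$ a power of $p$; the genus and $a$-number do not depend on this choice). Its genus is $g(\mathcal{H}_n^{(p)})=\frac{n(n-1)}{2}$. ''$\mathcal{H}_n^{(p)}$ is maximal'' means that for some power $q=p^e$, $e\geq1$, it is $\mathbb{F}_{q^2}$-maximal when considered over $\mathbb{F}_{q^2}$ (i.e. it has $q^2+1+2gq$ places of degree one); equivalently (known fact) $N$ divides $q+1$. Cartier operator: let $F/K$ be a function field over a perfect field $K$ of characteristic $p>0$ and let $t$ be a separating element. Every differential $\omega$ of $F/K$ can be written uniquely as $\omega=(x_0^p+x_1^pt+\cdots+x_{p-1}^pt^{p-1})\,dt$ with $x_i\in F$, and $\mathcal{C}(\omega):=x_{p-1}\,dt$;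 this does not depend on $t$, and $\mathcal{C}$ maps holomorphic differentials to holomorphic differentials. The $a$-number $a(F)$ is the $K$-dimension of the kernel of $\mathcal{C}$ acting on the holomorphic differentials of $F$. *)

(* Defs.v *)
From HB Require Import structures.
From mathcomp Require Import all_boot all_order all_algebra all_field.
From mathcomp Require Import boolp classical_sets functions cardinality.

Set Implicit Arguments.
Unset Strict Implicit.
Unset Printing Implicit Defensive.

Import GRing.Theory.
Local Open Scope classical_set_scope.
Local Open Scope ring_scope.

(* An extension of fields F / K is given by its embedding iota : K -> F; an
   F-vector space is regarded as a K-vector space through iota. *)

Section Dimension.
Variables (K F : fieldType) (iota : {rmorphism K -> F}) (V : lmodType F).

(* For K-subspaces B of A: the classes of the e i form a K-basis of A / B. *)
Definition quotient_basis (A B : set V) (d : nat) (e : 'I_d -> V) : Prop :=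
  [/\ forall i, A (e i),
      forall v, A v -> exists c : 'I_d -> K, B (v - \sum_i iota (c i) *: e i)
    & forall c : 'I_d -> K,
        B (\sum_i iota (c i) *: e i) -> forall i, c i = 0].

(* dim_K (A / B), with the value 0 when this dimension is infinite. *)
Definition quotient_dim (A B : set V) : nat :=
  xget 0%N [set d | exists e : 'I_d -> V, quotient_basis A B e].

Definition dim (A : set V) : nat := quotient_dim A [set 0].

End Dimension.

Section FunctionField.
Variables (K F : fieldType) (iota : {rmorphism K -> F}).

Definition intermediate_field (L : set F) : Prop :=
  [/\ range iota `<=` L,
      forall x y, L x -> L y -> L (x - y)
    & forall x y, L x -> L y -> L (x / y)].

(* K(X), the smallest intermediate field containing X. *)
Definition adjoin (X : set F) : set F :=
  [set z | forall L, intermediate_field L -> X `<=` L -> L z].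

(* F / K(t) is separable algebraic. *)
Definition separating (t : F) : Prop :=
  forall x, exists f : {poly F},
    [/\ forall i, adjoin [set t] f`_i, separable_poly f & root f x].

(* Places are represented by their valuation rings. *)
Definition valuation_ring (O : set F) : Prop :=
  [/\ range iota `<` O, O `<` [set: F],
      forall x y, O x -> O y -> O (x - y) /\ O (x * y)
    & forall z, O z \/ O z^-1].

Definition maximal_ideal (O : set F) : set F :=
  [set x | O x /\ ~ exists2 y, O y & x * y = 1].

Definition place_degree (O : set F) : nat :=
  quotient_dim iota (O : set F^o) (maximal_ideal O).

Definition places_of_degree_one : set (set F) :=
  [set O | valuation_ring O /\ place_degree O = 1%N].

Definition uniformizer (O : set F) (x : F) : Prop :=
  maximal_ideal O = [set x * y | y in O].

Record derivation := Derivation {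
  der_fun :> F -> F;
  derD : forall x y, der_fun (x + y) = der_fun x + der_fun y;
  derM : forall x y, der_fun (x * y) = x * der_fun y + y * der_fun x;
  derK : forall c, der_fun (iota c) = 0 }.

(* When F / K is a function field over a perfect field, its differentials form
   the F-dual of the one-dimensional F-space of K-derivations of F, where
   d x is the evaluation of derivations at x; thus u dt = v dx means that
   u D(t) = v D(x) for every K-derivation D of F. *)
Definition differential := derivation -> F^o.

Definition d (x : F) : differential := fun D => D x.

Definition differentials : set differential :=
  [set w | exists u t, separating t /\ w = u *: d t].

(* The valuation at a place of w = u dx, for x a uniformizer at that place,
   is the valuation of u. *)
Definition holomorphic : set differential :=
  [set w | differentials w /\
    forall O, valuation_ring O ->
      exists x u, [/\ uniformizer O x, O u & w = u *: d x]].

Definition genus : nat := dim iota holomorphic.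

Variable p : nat.

Definition cartier_graph (w w' : differential) : Prop :=
  exists (t : F) (x : nat -> F),
    [/\ separating t,
        w = (\sum_(i < p) x i ^+ p * t ^+ i) *: d t
      & w' = x p.-1 *: d t].

Definition cartier (w : differential) : differential :=
  xget 0 [set w' | cartier_graph w w'].

Definition a_number : nat :=
  dim iota [set w | holomorphic w /\ cartier w = 0].

End FunctionField.

Definition has_card (K : Type) (m : nat) : Prop := ([set: K] #= `I_m)%card.

Definition base_field (p : nat) (K : fieldType) : Prop :=
  p \in [pchar K] /\
  (GRing.closed_field_axiom K \/
   exists2 e : nat, (0 < e)%N & has_card K ((p ^ e) ^ 2)).

(* F = K(S, T) with S^n T + T^n + S = 0, a function field over K: since T is
   algebraic over K(S), S has to be transcendental over K. *)
Definition hurwitz_function_field (n : nat) (K F : fieldType)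
    (iota : {rmorphism K -> F}) : Prop :=
  exists S T : F,
    [/\ S ^+ n * T + T ^+ n + S = 0,
        ~ algebraicOver iota S
      & adjoin iota [set S; T] = [set: F]].

Definition hurwitz_maximal (n p : nat) : Prop :=
  exists (e : nat) (K F : fieldType) (iota : {rmorphism K -> F}),
    let q := (p ^ e)%N in
    [/\ (0 < e)%N, has_card K (q ^ 2), hurwitz_function_field n iota
      & (places_of_degree_one iota #=
           `I_(q ^ 2 + 1 + 2 * genus iota * q))%card].

(* Main.v *)
(* Put N = n^2 - n + 1 and u = S^(n-1) T.  Then S^N = - u^n / (1 + u), so F is the
   direct sum of the K(u) S^j for j < N, and the three places over u = 0, -1, oo are
   totally ramified.  Valuations at these places separate the summands, and p does
   not divide N, hence at the other places the ring generated by S is integrally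
   closed; therefore the holomorphic differentials have the basis S^j u^(-e) du,
   where e is the ceiling of n j / N and j runs over a set A with the property that,
   for 0 < j < N, exactly one of j and N - j lies in A.  If p j' = j mod N, then
   S^j u^(-e(j)) is, up to sign, the product of (S^j' u^(-e(j')))^p and
   u^a (1 + u)^b with a, b < p; here a + b < p - 1 if j is in A and j' is not, and
   a + b >= p - 1 if both are.  The kernel of the Cartier operator, which consists of
   the exact differentials, is thus spanned by the basis elements with j in A and j'
   not in A.  Passing from p_1 to p_2 = - p_1 mod N replaces j' by N - j', so the two
   a-numbers count complementary subsets of A. *)

From HB Require Import structures.
Require Import Defs.
From mathcomp Require Import all_boot all_order all_algebra all_field.
From mathcomp Require Import boolp classical_sets functions cardinality.
From mathcomp Require Import ring zify.

Set Implicit Arguments.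
Unset Strict Implicit.
Unset Printing Implicit Defensive.

Import Order.TTheory GRing.Theory Num.Theory.
Local Open Scope classical_set_scope.
Local Open Scope ring_scope.

(** * Subrings and valuation rings *)

(** [holomorphic] quantifies over all valuation rings of F. Upper bounds on a holomorphic
    differential therefore need valuation rings to be produced, which a Zorn argument does
    ([chevalley]), and proving a monomial holomorphic needs all of them to be recognised
    ([valuation_cases]). No Riemann-Roch theorem or degree count enters: poles of the coefficients
    in K(u) are removed one irreducible factor at a time, and the place over u = oo then makes the
    coefficients constant. Summands are separated because S has valuation n, -1, 1 - n at the three
    places, all prime to N. The choice between j and N - j comes from the ceilings: n j / N is not
    an integer for 0 < j < N, so those of j and N - j add up to n + 1. In the Cartier step the
    coefficient of u^(p-1) in u^a (1 + u)^b is the binomial coefficient of b over p - 1 - a, zero if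
    a + b < p - 1 and otherwise nonzero modulo p since a, b < p. As j -> j' is a permutation,
    distinct basis elements have images that are multiples of distinct monomials, so nothing
    cancels. *)

Record subring_set (F : fieldType) := SubringSet {
  subring_carrier :> F -> Prop;
  subring_set1 : subring_carrier 1;
  subring_setB : forall x y, subring_carrier x -> subring_carrier y ->
    subring_carrier (x - y);
  subring_setM : forall x y, subring_carrier x -> subring_carrier y ->
    subring_carrier (x * y) }.

Section SubringSet.
Variables (F : fieldType) (B : subring_set F).

Lemma subring_set0 : B 0.
Proof. by rewrite -(subrr 1); apply/subring_setB/subring_set1/subring_set1. Qed.

Lemma subring_setN x : B x -> B (- x).
Proof. by rewrite -sub0r; apply/subring_setB/subring_set0. Qed.

Lemma subring_setD x y : B x -> B y -> B (x + y).
Proof. by move=> Bx /subring_setN; rewrite -{2}[y]opprK; apply: subring_setB. Qed.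

Lemma subring_setX x k : B x -> B (x ^+ k).
Proof.
by move=> Bx; elim: k => [|k IH]; rewrite ?exprS; [exact: subring_set1 | exact: subring_setM].
Qed.

Lemma subring_set_sum I (r : seq I) (P : pred I) (f : I -> F) :
  (forall i, P i -> B (f i)) -> B (\sum_(i <- r | P i) f i).
Proof. by move=> Bf; apply: big_ind => //; [exact: subring_set0 | exact: subring_setD]. Qed.

Lemma subring_set_nat k : B k%:R.
Proof. by elim: k => [|k IH]; rewrite ?mulrSr;
  [exact: subring_set0 | exact/subring_setD/subring_set1]. Qed.

End SubringSet.

(** Boolean form of a subring, so that [polyOver] and the [rpred] lemmas apply to it. *)
Definition subring_pred (F : fieldType) (B : subring_set F) : {pred F} :=
  fun x => `[< B x >].

Lemma subring_predE (F : fieldType) (B : subring_set F) x :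
  (x \in subring_pred B) = `[< B x >].
Proof. by []. Qed.

Fact subring_pred_closed (F : fieldType) (B : subring_set F) :
  subring_closed (subring_pred B).
Proof.
split=> [|x y|x y]; rewrite !subring_predE.
- exact/asboolP/subring_set1.
- by move=> /asboolP Bx /asboolP By; apply/asboolP/subring_setB.
- by move=> /asboolP Bx /asboolP By; apply/asboolP/subring_setM.
Qed.

HB.instance Definition _ (F : fieldType) (B : subring_set F) :=
  GRing.isSubringClosed.Build F (subring_pred B) (subring_pred_closed B).

(** * Existence of valuation rings *)

Section Chevalley.
Variable F : fieldType.
Implicit Types (B : subring_set F) (a x z : F).

(** The witness is B[z]. *)
Lemma subring_polyext B z : exists B', B `<=` B' /\ B' z /\
  forall x, B' x -> exists2 q, q \is a polyOver (subring_pred B) & x = q.[z].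
Proof.
pose C := [set x | exists2 q, q \is a polyOver (subring_pred B) & x = q.[z]].
have C1 : C 1 by exists 1; rewrite ?rpred1 ?hornerC.
have CB x y : C x -> C y -> C (x - y).
  by move=> [q Bq ->] [r Br ->]; exists (q - r); rewrite ?rpredB // !hornerE.
have CM x y : C x -> C y -> C (x * y).
  by move=> [q Bq ->] [r Br ->]; exists (q * r); rewrite ?rpredM // !hornerE.
exists (SubringSet C1 CB CM); split=> [x Bx|] /=; last split=> //.
- exists x%:P; rewrite ?hornerC // polyOverC subring_predE; exact/asboolP.
- by exists 'X; rewrite ?polyOverX ?hornerX.
Qed.

(** The witness is B[1/w]; for w = 0 it is B itself, since [0^-1 = 0]. *)
Lemma subring_invext B w : B w -> exists B', B `<=` B' /\ B' w^-1 /\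
  forall x, B' x -> exists k, B (x * w ^+ k).
Proof.
move=> Bw; have [-> | w0] := eqVneq w 0.
  by exists B; rewrite invr0; do !split=> //;
    [exact: subring_set0 | exists 0%N; rewrite mulr1].
have BX k : B (w ^+ k) by exact: subring_setX.
pose C := [set x | exists k, B (x * w ^+ k)].
have C1 : C 1 by exists 0%N; rewrite mulr1; exact: subring_set1.
have CB x y : C x -> C y -> C (x - y).
  move=> [k Bx] [l By]; exists (k + l)%N; rewrite mulrBl exprD mulrA.
  by rewrite [y * _]mulrCA [_ * (y * _)]mulrC; apply: subring_setB; apply: subring_setM.
have CM x y : C x -> C y -> C (x * y).
  by move=> [k Bx] [l By]; exists (k + l)%N; rewrite exprD mulrACA; apply: subring_setM.
exists (SubringSet C1 CB CM); split=> [x Bx|] /=; last split=> //.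
- by exists 0%N; rewrite mulr1.
- by exists 1%N; rewrite expr1 mulVf //; apply: subring_set1.
Qed.

Section Maximal.
Variables (B : subring_set F) (a : F).
Hypotheses (Ba : B a) (Bna : ~ B a^-1).
Hypothesis maxB : forall B', B `<=` B' -> ~ B' a^-1 -> B' `<=` B.

Let a0 : a != 0.
Proof.
apply/eqP=> a0; case: Bna; rewrite a0 invr0.
exact: subring_set0.
Qed.

(** So a lies in the Jacobson radical of B. If w = 1 - a r had no inverse in B, maximality would put
    a^-1 into B[1/w], hence a^-1 w^k into B; as w^k is 1 modulo a B, this would give a^-1 in B. *)
Lemma maximal_unit r : B r -> 1 - a * r != 0 /\ B (1 - a * r)^-1.
Proof.
move=> Br; set w := 1 - a * r.
have Bw : B w by apply/subring_setB/subring_setM => //; exact: subring_set1.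
have B0 := subring_set0 B.
have w0 : w != 0.
  apply/eqP=> /eqP; rewrite subr_eq0 => /eqP ar1; case: Bna.
  by rewrite (_ : a^-1 = r) // -[RHS](mulKf a0) -ar1 mulr1.
split=> //; apply: contrapT => Bw'.
have [B' [BB' [B'w B'P]]] := subring_invext Bw.
have B'a : B' a^-1 by apply: contrapT => B'a; apply/Bw'/(maxB BB').
have [k Bk] := B'P _ B'a.
have [y By wk] : exists2 y, B y & w ^+ k = 1 - a * y.
  elim: k {Bk} => [|k [y By IH]]; first by exists 0; rewrite ?mulr0 ?subr0.
  exists (y + r - a * y * r); last by rewrite exprS IH /w; ring.
  apply: subring_setB; last by do 2?apply: subring_setM.
  exact: subring_setD.
apply: Bna; rewrite (_ : a^-1 = a^-1 * w ^+ k + y); last first.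
  by rewrite wk mulrBr mulr1 mulKf // subrK.
exact: subring_setD.
Qed.

(** A relation of degree less than n over B witnessing that a is invertible in B[z]. *)
Let rep z n := exists q, [/\ q \is a polyOver (subring_pred B),
  (size q <= n)%N & 1 = a * q.[z]].

(** Multiplied by z^m, the relation for z^-1 reads (1 - a r_0) z^m = a (terms of degree below m).
    The factor on the left is a unit by [maximal_unit], so z^m equals a polynomial [rho] in z of
    size at most m, which eliminates the top term of the relation for z. *)
Let rep_descent z n m : z != 0 -> rep z n.+1 -> rep z^-1 m.+1 -> (m <= n)%N ->
  rep z n.
Proof.
move=> z0 [q [Bq sq eq]] [r [/polyOverP Br sr er]] mn.
have Br0 : B r`_0 by apply/asboolP/Br.
have [w0 /asboolP Bw] := maximal_unit Br0; set w := 1 - _ in w0 Bw.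
pose rho := a%:P * w^-1%:P * \sum_(i < m) r`_i.+1 *: 'X^(m - i.+1).
have Brho : rho \is a polyOver (subring_pred B).
  rewrite !rpredM ?polyOverC // ?rpred_sum // => [|i _].
    by rewrite subring_predE; apply/asboolP.
  by rewrite polyOverZ ?polyOverXn.
have srho : (size rho <= m)%N.
  rewrite /rho -mulrA !mul_polyC; do 2!apply: leq_trans (size_scale_leq _ _) _.
  apply: leq_trans (size_sum _ _ _) _; apply/bigmax_leqP => i _.
  apply: leq_trans (size_scale_leq _ _) _.
  by rewrite size_polyXn; have := ltn_ord i; lia.
have zm : z ^+ m = rho.[z].
  apply: (mulfI w0); rewrite /rho !hornerM !hornerC -mulrA [a * _]mulrCA mulVKf //.
  transitivity (a * (z ^+ m * r.[z^-1] - r`_0 * z ^+ m)).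
    by rewrite /w mulrBl mul1r mulrBr mulrCA -er mulr1 mulrA.
  rewrite horner_sum; congr (a * _).
  rewrite (horner_coef_wide _ sr) big_ord_recl expr0 mulr1 [_ * (_ + _)]mulrDr.
  rewrite mulrC addrAC subrr add0r mulr_sumr; apply: eq_bigr => i _.
  rewrite hornerZ hornerXn mulrCA exprVn; congr (_ * _).
  by rewrite lift0 -{1}(subnK (ltn_ord i)) exprD mulfK ?expf_neq0.
exists (take_poly n q + q`_n *: ('X^(n - m) * rho)); split.
- apply: rpredD; last first.
    by apply: polyOverZ; [exact: (polyOverP Bq) | apply: rpredM => //; exact: polyOverXn].
  by apply/polyOverP=> i; rewrite coef_take_poly; case: ifP => _; rewrite ?rpred0 // (polyOverP Bq).
- apply: leq_trans (size_polyD _ _) _; rewrite geq_max size_take_poly /=.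
  apply: leq_trans (size_scale_leq _ _) _.
  apply: leq_trans (size_polyMleq _ _) _; rewrite size_polyXn.
  by move: srho mn; set s := size _; lia.
- rewrite eq; congr (_ * _); rewrite hornerD hornerZ hornerM hornerXn -zm -exprD subnK //.
  rewrite (horner_coef_wide _ sq) big_ord_recr /=; congr (_ + _).
  by rewrite (horner_coef_wide _ (size_take_poly _ _)); apply: eq_bigr => i _;
    rewrite coef_take_poly ltn_ord.
Qed.

(** If neither z nor z^-1 is in B, maximality puts a^-1 into both B[z] and B[z^-1]. The resulting
    two relations shorten each other by [rep_descent] until one has size 0, which is absurd. *)
Lemma maximal_valuation z : B z \/ B z^-1.
Proof.
have B0 := subring_set0 B.
have [-> | z0] := eqVneq z 0; first by left.
have zV0 : z^-1 != 0 by rewrite invr_neq0.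
have repP x : ~ B x -> exists n, rep x n.
  have [B' [BB' [B'x B'P]]] := subring_polyext B x => Bx.
  have B'a : B' a^-1 by apply: contrapT => B'a; apply/Bx/(maxB BB').
  have [q Bq aq] := B'P _ B'a; exists (size q); exists q; split=> //.
  by rewrite -aq mulfV.
have rep0 x : ~ rep x 0.
  move=> [q [_ ]]; rewrite leqn0 size_poly_eq0 => /eqP-> /eqP.
  by rewrite horner0 mulr0 oner_eq0.
apply: contrapT => /not_orP[Bz Bz']; have [n rn] := repP _ Bz; have [m rm] := repP _ Bz'.
elim: {n m}(n + m)%N {1 3}n {1 3}m (leqnn (n + m)) rn rm => [|s IH] [|n] [|m] //=;
  try by [move=> _ /rep0 | move=> _ _ /rep0].
rewrite !addSn !addnS !ltnS => nms rn rm; have [mn | /ltnW nm] := leqP m n.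
  by apply: IH (rep_descent z0 rn rm mn) rm; rewrite addnS.
have rn' : rep z^-1^-1 n.+1 by rewrite invrK.
by apply: IH rn (rep_descent zV0 rm rn' nm); rewrite addSn.
Qed.

End Maximal.

(* A subring that is maximal among those not containing [a^-1] is a valuation
   ring. *)
Theorem chevalley (A : subring_set F) a : A a -> ~ A a^-1 ->
  exists B : subring_set F, [/\ A `<=` B, ~ B a^-1 & forall z, B z \/ B z^-1].
Proof.
move=> Aa Ana.
pose good (X : set F) := exists B : subring_set F, [/\ X = B, A `<=` B & ~ B a^-1].
pose P := [set X | X = set0 \/ good X].
have [|X [PX maxX]] := @Zorn_bigcup F P.
  move=> C CP Ctot; have [[X [CX gX]] | nC] := pselect (exists X, C X /\ good X); last first.
    left; apply/seteqP; split=> // x [X CX Xx]; case: (CP _ CX) => [X0|gX].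
      by rewrite X0 in Xx.
    by case: nC; exists X.
  right; set U := \bigcup_(_ in _) _.
  have common x y : U x -> U y -> exists2 B : subring_set F, C B & B x /\ B y.
    move=> [Y CY Yx] [Z CZ Zy].
    have [YZ | ZY] := Ctot _ _ CY CZ.
      case: (CP _ CZ) => [Z0|[B [ZB _ _]]]; first by rewrite Z0 in Zy.
      by exists B; rewrite -ZB //; split=> //; apply: YZ.
    case: (CP _ CY) => [Y0|[B [YB _ _]]]; first by rewrite Y0 in Yx.
    by exists B; rewrite -YB //; split=> //; apply: ZY.
  have UB (B : subring_set F) : C B -> B `<=` U by move=> CB x Bx; exists B.
  have AU : A `<=` U by case: gX CX => B [-> AB _] CB x Ax; exists B => //; apply: AB.
  have U1 : U 1 by apply/AU/subring_set1.
  have UsB x y : U x -> U y -> U (x - y).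
    by move=> Ux Uy; have [B CB [Bx By]] := common _ _ Ux Uy; apply/(UB B CB)/subring_setB.
  have UM x y : U x -> U y -> U (x * y).
    by move=> Ux Uy; have [B CB [Bx By]] := common _ _ Ux Uy; apply/(UB B CB)/subring_setM.
  exists (SubringSet U1 UsB UM); split=> // -[Y CY Ya].
  by case: (CP _ CY) => [Y0|[B [YB _ nB]]]; [rewrite Y0 in Ya | apply: nB; rewrite -YB].
have gA : good A by exists A; split.
case: PX => [X0|[B [XB AB nB]]].
  exfalso; apply: (maxX A); last by right.
  by rewrite X0; split; [exact: sub0set | move=> /(_ _ (subring_set1 A))].
exists B; split=> //; apply: (@maximal_valuation B a) => //; first exact: AB.
move=> B' BB' nB'; apply: contrapT => nBB'; apply: (maxX B').
  by rewrite XB; split.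
by right; exists B'; split=> //; apply: subset_trans BB'.
Qed.

End Chevalley.

(** * Valuation rings and discrete valuations *)

Section Valuation.
Variables (F : fieldType) (O : subring_set F).
Hypothesis Ototal : forall z, O z \/ O z^-1.
Implicit Types (x y z : F) (k l : int).

Definition val_unit z := [/\ z != 0, O z & O z^-1].

(** The guard [z != 0] keeps 0 in the ideal, as [0^-1 = 0] lies in O. *)
Definition val_ideal z := O z /\ (z != 0 -> ~ O z^-1).

Lemma maximal_idealE : maximal_ideal O = val_ideal.
Proof.
apply/seteqP; split=> z [Oz nz]; split=> //.
  by move=> z0 Oz'; apply: nz; exists z^-1; rewrite ?mulfV.
move=> [y Oy zy]; have z0 : z != 0.
  by apply/eqP=> z0; move/eqP: zy; rewrite z0 mul0r eq_sym oner_eq0.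
by apply: (nz z0); rewrite (_ : z^-1 = y) // -[RHS](mulKf z0) zy mulr1.
Qed.

Lemma val_unit1 : val_unit 1.
Proof. by split; rewrite ?oner_eq0 ?invr1 //; exact: subring_set1. Qed.

Lemma val_unitM y z : val_unit y -> val_unit z -> val_unit (y * z).
Proof.
by move=> [y0 Oy Oy'] [z0 Oz Oz']; split; rewrite ?mulf_neq0 ?invfM //; exact: subring_setM.
Qed.

Lemma val_unitV z : val_unit z -> val_unit z^-1.
Proof. by move=> [z0 Oz Oz']; split; rewrite ?invr_eq0 ?invrK. Qed.

Lemma val_unitN z : val_unit z -> val_unit (- z).
Proof.
by move=> [z0 Oz Oz']; split; rewrite ?oppr_eq0 ?invrN //; exact: subring_setN.
Qed.

Lemma val_unitX z (k : nat) : val_unit z -> val_unit (z ^+ k).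
Proof.
by move=> uz; elim: k => [|k IH]; rewrite ?exprS; [exact: val_unit1 | exact: val_unitM].
Qed.

Lemma val_unit_or_ideal z : O z -> val_unit z \/ val_ideal z.
Proof.
move=> Oz; have [[z0 Oz'] | nz] := pselect (z != 0 /\ O z^-1); first by left.
by right; split=> // z0 Oz'; apply: nz.
Qed.

Lemma val_unit_not_ideal z : val_unit z -> ~ val_ideal z.
Proof. by move=> [z0 _ Oz'] [_ /(_ z0)]. Qed.

Lemma val_ideal0 : val_ideal 0.
Proof. by split; rewrite ?eqxx //; exact: subring_set0. Qed.

Lemma val_idealM y z : O y -> val_ideal z -> val_ideal (y * z).
Proof.
move=> Oy [Oz nz]; split; first exact: subring_setM.
rewrite mulf_eq0 negb_or => /andP[y0 z0] Oyz; apply: (nz z0).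
rewrite (_ : z^-1 = y * (y * z)^-1); first exact: subring_setM.
by rewrite invfM mulVKf.
Qed.

Lemma val_idealD y z : val_ideal y -> val_ideal z -> val_ideal (y + z).
Proof.
move=> my mz; have [-> | y0] := eqVneq y 0; first by rewrite add0r.
have [-> | z0] := eqVneq z 0; first by rewrite addr0.
have [Ot | ] := Ototal (y / z).
  have -> : y + z = (y / z + 1) * z by rewrite mulrDl mul1r divfK.
  by apply: val_idealM mz; apply/subring_setD/subring_set1.
rewrite invfM invrK mulrC => Ot.
have -> : y + z = (1 + z / y) * y by rewrite mulrDl mul1r divfK.
by apply: val_idealM my; apply/subring_setD/Ot/subring_set1.
Qed.

Lemma val_idealN z : val_ideal z -> val_ideal (- z).
Proof.
move=> mz; rewrite -mulN1r; apply: val_idealM => //.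
exact/subring_setN/subring_set1.
Qed.

Lemma val_ideal_sum I (r : seq I) (P : pred I) (f : I -> F) :
  (forall i, P i -> val_ideal (f i)) -> val_ideal (\sum_(i <- r | P i) f i).
Proof. by move=> mf; apply: big_ind => //; [exact: val_ideal0 | exact: val_idealD]. Qed.

Lemma val_unitDideal y z : val_unit y -> val_ideal z -> val_unit (y + z).
Proof.
move=> uy mz; have Oyz : O (y + z).
  by case: uy mz => [_ Oy _] [Oz _]; apply: subring_setD.
have [//|myz] := val_unit_or_ideal Oyz; case: (val_unit_not_ideal uy).
by rewrite -(addrK z y); apply/val_idealD/val_idealN.
Qed.

Lemma val_idealVN z : ~ O z -> val_ideal z^-1.
Proof.
move=> nz; have [//|Oz] := Ototal z; split=> // _.
by rewrite invrK.
Qed.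

Section Discrete.
Variable x : F.
Hypotheses (x0 : x != 0) (mx : val_ideal x).

(** The valuation as a relation, normalised by x. O is not known to be discrete, so an element need
    not have a value; [val_param] states that each nonzero one does, i.e. that x is a local
    parameter. *)
Definition val_eq z k := val_unit (z / x ^ k).

Lemma val_eq_neq0 z k : val_eq z k -> z != 0.
Proof. by case=> + _ _; rewrite mulf_eq0 negb_or => /andP[]. Qed.

Lemma val_eqM y z k l : val_eq y k -> val_eq z l -> val_eq (y * z) (k + l).
Proof.
by rewrite /val_eq expfzDr // invfM mulrACA; exact: val_unitM.
Qed.

Lemma val_eqV z k : val_eq z k -> val_eq z^-1 (- k).
Proof. by rewrite /val_eq -invr_expz -invfM; exact: val_unitV. Qed.

Lemma val_eq_unit z : val_unit z -> val_eq z 0.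
Proof. by rewrite /val_eq expr0z divr1. Qed.

Lemma val_eqX z k (m : nat) : val_eq z k -> val_eq (z ^+ m) (k * m%:Z).
Proof.
move=> vz; elim: m => [|m IH]; first by rewrite mulr0; exact/val_eq_unit/val_unit1.
by rewrite exprS intS mulrDr mulr1; exact: val_eqM.
Qed.

Lemma val_eqx : val_eq x 1.
Proof. by rewrite /val_eq expr1z mulfV //; exact: val_unit1. Qed.

Lemma val_eqN z k : val_eq z k -> val_eq (- z) k.
Proof. by rewrite /val_eq mulNr; exact: val_unitN. Qed.

Lemma val_eq_pow k : val_eq (x ^ k) k.
Proof. by rewrite /val_eq mulfV ?expfz_neq0 //; exact: val_unit1. Qed.

Lemma val_pow_ideal k : 0 < k -> val_ideal (x ^ k).
Proof.
case: k => [[|k]|] // _; rewrite -exprnP exprSr; apply: val_idealM => //.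
by apply: subring_setX; case: mx.
Qed.

Lemma val_eq_ideal z k : val_eq z k -> 0 < k -> val_ideal z.
Proof.
move=> [_ Oz _] k0; rewrite -(divfK (expfz_neq0 k x0) z).
exact/val_idealM/val_pow_ideal.
Qed.

Lemma val_eqO z k : val_eq z k -> O z <-> 0 <= k.
Proof.
move=> vz; split=> [Oz|].
  case: (ltrP k 0) => // k0.
  have [_ nz] := val_eq_ideal (val_eqV vz) (etrans (oppr_gt0 _) k0).
  by case: nz; rewrite ?invrK // invr_eq0 (val_eq_neq0 vz).
rewrite le_eqVlt => /predU1P[k0 | /(val_eq_ideal vz)[]//].
by case: vz; rewrite -k0 expr0z divr1.
Qed.

(** Ultrametric equality: among pairwise distinct valuations the least one is attained once, and
    divided by that term the rest of the sum lies in the ideal. *)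
Lemma val_eq_sum (I : finType) (z : I -> F) (k : I -> int) i0 :
    (forall i, z i != 0 -> val_eq (z i) (k i)) ->
    (forall i j, z i != 0 -> z j != 0 -> k i = k j -> i = j) ->
  z i0 != 0 -> exists i, [/\ z i != 0, forall j, z j != 0 -> k i <= k j
    & val_eq (\sum_j z j) (k i)].
Proof.
move=> vz kI z0; case: (@arg_minP _ _ _ i0 (fun i => z i != 0) k z0) => i zi min_i.
exists i; split=> //; rewrite (bigD1 i) //= /val_eq mulrDl.
apply: val_unitDideal; first exact: vz.
rewrite mulr_suml; apply: val_ideal_sum => j ji.
have [-> | zj] := eqVneq (z j) 0; first by rewrite mul0r; exact: val_ideal0.
apply: (@val_eq_ideal _ (k j - k i)); first exact/val_eqM/val_eqV/val_eq_pow/vz.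
rewrite subr_gt0 lt_neqAle min_i // andbT; apply: contra_neq ji => /kI.
by move=> /(_ zi zj).
Qed.

Lemma val_sum_O (I : finType) (z : I -> F) (k : I -> int) :
    (forall i, z i != 0 -> val_eq (z i) (k i)) ->
    (forall i j, z i != 0 -> z j != 0 -> k i = k j -> i = j) ->
  O (\sum_j z j) -> forall i, O (z i).
Proof.
move=> vz kI Os i; have [-> | zi] := eqVneq (z i) 0; first exact: subring_set0.
have [j [zj min_j vs]] := val_eq_sum vz kI zi.
by apply/(val_eqO (vz i zi))/(le_trans _ (min_j i zi))/(val_eqO vs).
Qed.

Lemma val_sum0 (I : finType) (z : I -> F) (k : I -> int) :
    (forall i, z i != 0 -> val_eq (z i) (k i)) ->
    (forall i j, z i != 0 -> z j != 0 -> k i = k j -> i = j) ->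
  \sum_j z j = 0 -> forall i, z i = 0.
Proof.
move=> vz kI s0 i; apply/eqP/negPn/negP => zi.
have [j [_ _ /val_eq_neq0]] := val_eq_sum vz kI zi.
by rewrite s0 eqxx.
Qed.

Definition val_param := forall z, z != 0 -> exists k, val_eq z k.

Lemma val_param_uniformizer : val_param -> uniformizer O x.
Proof.
move=> px; rewrite /uniformizer maximal_idealE; apply/seteqP; split=> z.
  move=> mz; have [-> | z0] := eqVneq z 0.
    by exists 0; [exact: subring_set0 | rewrite mulr0].
  exists (z / x); last by rewrite mulrC divfK.
  have [k vz] := px z z0; apply/(val_eqO (val_eqM vz (val_eqV val_eqx))).
  have k0 : 0 < k.
    rewrite ltNge; apply/negP => k0; case: mz => _ /(_ z0); apply.
    by apply/(val_eqO (val_eqV vz)); rewrite oppr_ge0.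
  by lia.
by move=> [y Oy <-]; rewrite mulrC; exact: val_idealM.
Qed.

End Discrete.
End Valuation.

(** * Derivations and the Cartier operator *)

Section Derivations.
Variables (K F : fieldType) (iota : {rmorphism K -> F}).

Definition ev (t : F) : {poly K} -> F := horner_eval t \o map_poly iota.

HB.instance Definition _ t :=
  GRing.RMorphism.copy (ev t) (horner_eval t \o map_poly iota).

Lemma evE t a : ev t a = (map_poly iota a).[t]. Proof. by []. Qed.

Lemma evC t c : ev t c%:P = iota c.
Proof. by rewrite evE map_polyC hornerC. Qed.

Lemma evX t : ev t 'X = t. Proof. by rewrite evE map_polyX hornerX. Qed.

Variable D : derivation iota.

Lemma der1 : D 1 = 0. Proof. by rewrite -(rmorph1 iota) derK. Qed.

Lemma der0 : D 0 = 0. Proof. by have := derK D 0; rewrite rmorph0. Qed.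

Lemma derN x : D (- x) = - D x.
Proof. by apply/eqP; rewrite -addr_eq0 -derD addNr der0. Qed.

Lemma derX x n : D (x ^+ n) = x ^+ n.-1 * D x *+ n.
Proof.
elim: n => [|[|n] IH]; first by rewrite der1 mulr0n.
  by rewrite expr1 mul1r.
by rewrite exprS derM IH /= mulrnAr mulrA -exprS -mulrSr.
Qed.

Lemma derV x : D x^-1 = - (x ^- 2 * D x).
Proof.
have [-> | x0] := eqVneq x 0; first by rewrite invr0 der0 mulr0 oppr0.
have := derM D x x^-1; rewrite mulfV // der1 => /eqP.
rewrite eq_sym addr_eq0 => /eqP e; apply: (mulfI x0); rewrite e mulrN.
by congr (- _); rewrite expr2 invfM -mulrA mulVKf.
Qed.

Lemma der_sum I (r : seq I) (P : pred I) (f : I -> F) :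
  D (\sum_(i <- r | P i) f i) = \sum_(i <- r | P i) D (f i).
Proof. exact: (big_morph D (derD D) der0). Qed.

Lemma der_horner (q : {poly F}) t : (forall i, D q`_i = 0) ->
  D q.[t] = q^`().[t] * D t.
Proof.
elim/poly_ind: q => [|q c IH] Dq; first by rewrite deriv0 !horner0 mul0r der0.
have Dc : D c = 0.
  by have := Dq 0%N; rewrite coefD coefMX coefC eqxx add0r.
have {}IH : D q.[t] = q^`().[t] * D t.
  by apply: IH => i; have := Dq i.+1; rewrite coefD coefMX coefC addr0.
by rewrite derivMXaddC !hornerE derD derM Dc IH /= addr0; ring.
Qed.

Lemma der_ev t a : D (ev t a) = ev t a^`() * D t.
Proof.
by rewrite !evE -deriv_map; apply: der_horner => i; rewrite coef_map derK.
Qed.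

(** The kernel of D is an intermediate field. *)
Lemma der_adjoin t z : D t = 0 -> adjoin iota [set t] z -> D z = 0.
Proof.
move=> Dt /(_ [set x | D x = 0]); apply=> [|_ ->//]; split=> [_ [c _ <-]|x y Dx Dy|x y Dx Dy].
- exact: derK.
- by rewrite /= derD derN Dx Dy subrr.
- by rewrite /= derM derV Dx Dy !mulr0 oppr0 mulr0 addr0.
Qed.

End Derivations.

(** * Bases of F over its p-th powers, and derivations *)

Section PBasis.
Variables (K F : fieldType) (iota : {rmorphism K -> F}) (p : nat).
Hypothesis charF : p \in [pchar F].

Let pr_p : prime p := pcharf_prime charF.
Let p_gt0 : (0 < p)%N := prime_gt0 pr_p.

Local Notation Frob := (pFrobenius_aut charF).
Local Notation "q ^F" := (map_poly Frob q) (at level 2, format "q ^F").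

Lemma natr_p_neq0 m : ~~ (p %| m)%N -> m%:R != 0 :> F.
Proof. by rewrite (dvdn_pcharf charF). Qed.

Lemma natr_lt_p_neq0 m : (0 < m < p)%N -> m%:R != 0 :> F.
Proof. by move=> /andP[m0 mp]; apply: natr_p_neq0; rewrite gtnNdvd. Qed.

Lemma der_pexp (D : derivation iota) x : D (x ^+ p) = 0.
Proof. by rewrite derX -mulr_natr (pcharf0 charF) mulr0. Qed.

Lemma der_Frob (D : derivation iota) q t : D (q^F.[t]) = (q^`())^F.[t] * D t.
Proof.
by rewrite -deriv_map; apply: der_horner => i; rewrite coef_map /= der_pexp.
Qed.

(* [pspan] and [pindep] together say that 1, t, .., t^(p-1) is a basis of F over
   the subfield of p-th powers. *)
Definition pspan t := forall z, exists q : {poly F}, z = q^F.[t].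
Definition pindep t := forall q : {poly F}, (size q <= p)%N -> q^F.[t] = 0 -> q = 0.

Lemma Frob_binomial t : ('X^p - t%:P)^F = 'X^p - (t ^+ p)%:P.
Proof. by rewrite rmorphB /= map_polyXn map_polyC. Qed.

Lemma pmod t (q : {poly F}) : exists2 r : {poly F}, (size r <= p)%N & exists a, q = a * ('X^p -
    t%:P) + r.
Proof.
exists (q %% ('X^p - t%:P)).
  by rewrite -ltnS -(size_XnsubC t p_gt0) ltn_modp -size_poly_gt0 size_XnsubC.
by exists (q %/ ('X^p - t%:P)); exact: divp_eq.
Qed.

(** Frobenius on coefficients turns X^p - t into X^p - t^p, which vanishes at t. Polynomials may
    thus be reduced to size at most p. *)
Lemma Frob_horner_pmod t (a r : {poly F}) :
  (a * ('X^p - t%:P) + r)^F.[t] = r^F.[t].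
Proof. by rewrite rmorphD rmorphM /= Frob_binomial !hornerE subrr mulr0 add0r. Qed.

Lemma pspan_small t : pspan t ->
  forall z, exists2 q : {poly F}, (size q <= p)%N & z = q^F.[t].
Proof.
move=> st z; have [q ->] := st z; have [r sr [a ->]] := pmod t q.
by exists r; rewrite ?Frob_horner_pmod.
Qed.

(** This makes d/dt well defined: two polynomials representing the same element differ by a multiple
    of X^p - t, whose derivative is zero in characteristic p. *)
Lemma pindep_deriv t (q1 q2 : {poly F}) : pindep t -> q1^F.[t] = q2^F.[t] ->
  (q1^`())^F.[t] = (q2^`())^F.[t].
Proof.
move=> it /eqP; rewrite -subr_eq0 -hornerN -hornerD -rmorphB /= => /eqP q0.
apply/eqP; rewrite -subr_eq0 -hornerN -hornerD -rmorphB -derivB /=.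
move: (q1 - q2) q0 => q; have [r sr [a ->]] := pmod t q.
rewrite Frob_horner_pmod => /(it _ sr)->; rewrite addr0 derivM rmorphD !rmorphM /=.
rewrite derivB derivC derivXn subr0 -scaler_nat (pcharf0 charF) scale0r rmorph0.
by rewrite mulr0 addr0 Frob_binomial !hornerE subrr mulr0.
Qed.

(** D is formal differentiation of the representing polynomial. It kills K because, K being perfect,
    constants are p-th powers. *)
Lemma exists_der t : (forall c : K, exists k, c = k ^+ p) -> pspan t -> pindep t -> exists D :
    derivation iota, D t = 1.
Proof.
move=> perfK st it; have [f fE] := choice st.
pose g z := ((f z)^`())^F.[t].
have gE q : g q^F.[t] = (q^`())^F.[t] by apply: pindep_deriv => //; rewrite -fE.
have gD x y : g (x + y) = g x + g y.
  by rewrite {1}(fE x) {1}(fE y) -hornerD -rmorphD gE derivD rmorphD hornerD.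
have gM x y : g (x * y) = x * g y + y * g x.
  rewrite {1}(fE x) {1}(fE y) -hornerM -rmorphM gE derivM rmorphD !rmorphM /=.
  by rewrite hornerD !hornerM -!fE addrC [_ * y]mulrC.
have gt1 : g t = 1.
  by rewrite -[X in g X](hornerX t) -(map_polyX Frob) gE derivX rmorph1 hornerC.
have gK c : g (iota c) = 0.
  have [k ->] := perfK c; have -> : iota (k ^+ p) = (iota k)%:P^F.[t].
    by rewrite map_polyC hornerC rmorphXn.
  by rewrite gE derivC rmorph0 horner0.
by exists (Defs.Derivation gD gM gK).
Qed.

(** Applying D to a relation of size at most p differentiates it, hence shortens it; by induction
    the derivative is zero, and below degree p this leaves only a constant. *)
Lemma der_pindep (D : derivation iota) t : D t != 0 -> pindep t.
Proof.
move=> Dt q; suff H m (r : {poly F}) : (m <= p)%N -> (size r <= m)%N ->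
    r^F.[t] = 0 -> r = 0 by exact: H (leqnn p).
elim: m r => {q}[|m IH] q mp sq q0.
  by apply/eqP; rewrite -size_poly_eq0 -leqn0.
have dq : q^`() = 0.
  apply: IH (ltnW mp) _ _.
    have [-> | q_neq0] := eqVneq q 0; first by rewrite deriv0 size_poly0.
    by rewrite -ltnS (leq_trans (lt_size_deriv q_neq0)).
  by apply: (mulIf Dt); rewrite mul0r -der_Frob q0 der0.
have qC : q = (q`_0)%:P.
  apply/polyP=> -[|i]; rewrite coefC //=.
  have [im | mi] := ltnP i m; last by rewrite nth_default // (leq_trans sq).
  have /eqP := congr1 (fun r : {poly F} => r`_i) dq.
  rewrite coef_deriv coef0 -mulr_natr mulf_eq0 (negPf (natr_lt_p_neq0 _)) ?orbF //.
    by move/eqP.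
  by rewrite /= (leq_trans _ mp).
move: q0; rewrite qC map_polyC hornerC => /eqP; rewrite fmorph_eq0 => /eqP->.
by rewrite polyC0.
Qed.

(** The p-th roots of the coordinates of 1, t, .., t^(p-1) with respect to the powers of u form a p
    x p matrix; independence makes it invertible. *)
Lemma pspan_exchange u t : pspan u -> pindep t -> pspan t.
Proof.
move=> /pspan_small su it z.
have ev_row (v : 'rV[F]_p) x : (rVpoly v)^F.[x] = \sum_i Frob (v 0 i) * x ^+ i.
  rewrite (@horner_coef_wide _ p) ?size_map_poly ?size_poly //.
  by apply: eq_bigr => i _; rewrite coef_map /= coef_rVpoly_ord.
have row_of x : exists v : 'rV_p, x = \sum_i Frob (v 0 i) * u ^+ i.
  have [q sq ->] := su x; exists (poly_rV q); rewrite -ev_row poly_rV_K //.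
have [a aE] := choice (fun i : 'I_p => row_of (t ^+ i)).
pose A := \matrix_i a i.
have combA (v : 'rV_p) : (rVpoly v)^F.[t] = (rVpoly (v *m A))^F.[u].
  rewrite !ev_row; under eq_bigr do rewrite aE mulr_sumr.
  rewrite exchange_big; apply: eq_bigr => j _ /=.
  rewrite mxE rmorph_sum mulr_suml; apply: eq_bigr => i _.
  by rewrite !mxE rmorphM mulrA.
have freeA : row_free A.
  rewrite -kermx_eq0; apply/eqP/row_matrixP => i; rewrite row0.
  have kA : row i (kermx A) *m A = 0 by rewrite -row_mul mulmx_ker row0.
  have : rVpoly (row i (kermx A)) = 0.
    by apply: it; rewrite ?size_poly // combA kA linear0 rmorph0 horner0.
  by move=> v0; rewrite -[LHS]rVpolyK v0 linear0.
have [v ->] := row_of z; exists (rVpoly (v *m invmx A)).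
by rewrite combA mulmxKV -?row_free_unit // ev_row.
Qed.

End PBasis.

Lemma ev_adjoin (K F : fieldType) (iota : {rmorphism K -> F}) t a :
  adjoin iota [set t] (ev iota t a).
Proof.
move=> L [KL LB LV] /(_ t erefl) Lt.
have L1 : L 1 by rewrite -(rmorph1 iota); apply: KL; exists 1.
have L0 : L 0 by rewrite -(subrr 1); apply: LB.
have LD x y : L x -> L y -> L (x + y).
  by move=> Lx Ly; rewrite -[y]opprK -[- y]sub0r; apply/LB/LB.
have LM x y : L x -> L y -> L (x * y).
  by move=> Lx Ly; rewrite -[y]invrK -[y^-1]div1r; apply/LV/LV.
elim/poly_ind: a => [|a c IH]; first by rewrite rmorph0.
rewrite rmorphD rmorphM /= evX evC; apply: LD; first exact: LM.
by apply: KL; exists c.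
Qed.

Lemma diffE (K F : fieldType) (iota : {rmorphism K -> F}) (D : derivation iota) g t :
  (g *: d t : differential iota) D = g * D t.
Proof. by []. Qed.

Lemma deriv_eq0_comp_Xn (R : idomainType) (p : nat) (q : {poly R}) :
    p \in [pchar R] -> q^`() = 0 ->
  q = \poly_(l < ((size q).-1 %/ p).+1) q`_(l * p) \Po 'X^p.
Proof.
move=> charR dq; have p_gt0 := prime_gt0 (pcharf_prime charR).
have q_p i : ~~ (p %| i)%N -> q`_i = 0.
  case: i => [|i] pi; first by rewrite dvdn0 in pi.
  have /eqP := congr1 (fun r : {poly R} => r`_i) dq.
  rewrite coef_deriv coef0 -mulr_natr mulf_eq0 => /orP[/eqP//|].
  by rewrite -(dvdn_pcharf charR) (negPf pi).
apply/polyP=> i; rewrite coef_comp_poly_Xn //.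
case: ifPn => [/dvdnP[l ->]|/q_p//]; rewrite mulnK // coef_poly ltnS.
rewrite leq_divRL //; case: ifPn => //; rewrite -ltnNge => lq.
by rewrite nth_default // (leq_trans _ lq) // leqSpred.
Qed.

(** A polynomial with zero derivative is a polynomial in X^p, and over a perfect field that is a
    p-th power. *)
Lemma irreducible_deriv_neq0 (K : fieldType) (p : nat) (P : {poly K}) :
    p \in [pchar K] -> (forall c : K, exists k, c = k ^+ p) ->
  irreducible_poly P -> P^`() != 0.
Proof.
move=> charK perfK irrP; apply/eqP=> dP; have pr_p := pcharf_prime charK.
have [f fE] := choice perfK; have charP : p \in [pchar {poly K}] by rewrite pchar_poly.
set m := ((size P).-1 %/ p).+1; pose Q := \poly_(l < m) f P`_(l * p).
have PQ : P = Q ^+ p.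
  rewrite {1}(deriv_eq0_comp_Xn charK dP) -/m -[RHS](pFrobenius_autE charP) /Q !poly_def.
  rewrite [LHS]raddf_sum [RHS]rmorph_sum; apply: eq_bigr => i _ /=.
  rewrite pFrobenius_autE comp_polyZ comp_Xn_poly exprZn -fE.
  by rewrite -!exprM mulnC.
have Q0 : Q != 0.
  by apply: contraTneq (irredp_neq0 irrP) => Q0; rewrite PQ Q0 expr0n eqn0Ngt prime_gt0 ?eqxx.
have sP : (1 < size P)%N by case: irrP.
have sPQ := size_exp Q p; rewrite -PQ in sPQ.
have sQ : size Q != 1%N.
  by apply/eqP=> sQ; move: sPQ sP; rewrite sQ; case: (size P) => [|[|k]].
have /eqp_size sQP : Q %= P by apply: irrP => //; rewrite PQ dvdp_exp // prime_gt0.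
by move: sPQ sP (prime_gt1 pr_p); rewrite sQP; case: (size P) => [|[|k]] // + _;
  rewrite -[LHS]muln1 => /eqP; rewrite eqn_pmul2l // => /eqP<-.
Qed.

(** * Separating elements and the kernel of the Cartier operator *)

Section Differentials.
Variables (K F : fieldType) (iota : {rmorphism K -> F}) (p : nat).
Hypothesis charF : p \in [pchar F].
Hypothesis perfK : forall c : K, exists k, c = k ^+ p.

Let pr_p : prime p := pcharf_prime charF.
Let p_gt0 : (0 < p)%N := prime_gt0 pr_p.

Local Notation Frob := (pFrobenius_aut charF).
Local Notation "q ^F" := (map_poly Frob q) (at level 2, format "q ^F").

Let charK : p \in [pchar K].
Proof. by rewrite -(fmorph_pchar iota). Qed.

Lemma exists_pdecomp (a : {poly K}) :
  exists b : 'I_p -> {poly K}, a = \sum_k b k ^+ p * 'X^k.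
Proof.
rewrite -[a]coefK poly_def.
apply: (big_ind (fun a : {poly K} => exists b : 'I_p -> {poly K}, a = \sum_k b k ^+ p * 'X^k))
    => [|x y [b ->] [c ->]|m _].
- by exists (fun=> 0); rewrite big1 // => k _; rewrite expr0n eqn0Ngt p_gt0 mul0r.
- exists (fun k => b k + c k); rewrite -big_split; apply: eq_bigr => k _ /=.
  have charP : p \in [pchar {poly K}] by rewrite pchar_poly.
  by rewrite -!(pFrobenius_autE charP) rmorphD mulrDl.
have [c ->] := perfK a`_m; pose k0 := Ordinal (ltn_pmod m p_gt0).
exists (fun k => if k == k0 then c *: 'X^(m %/ p) else 0).
rewrite (bigD1 k0) //= eqxx big1 ?addr0 => [|k /negPf->].
  by rewrite exprZn -scalerAl -exprM -exprD -divn_eq.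
by rewrite expr0n eqn0Ngt p_gt0 mul0r.
Qed.

Variable u : F.
Hypotheses (span_u : pspan charF u) (indep_u : pindep charF u).
Hypothesis trans_u : forall a, ev iota u a = 0 -> a = 0.
Hypothesis alg_u : forall z, exists2 q : {poly {poly K}},
  q != 0 & root (map_poly (ev iota u) q) z.

Let ev_eq0 a : (ev iota u a == 0) = (a == 0).
Proof. by apply/eqP/eqP => [/trans_u//|->]; rewrite rmorph0. Qed.

Let inj_ev : injective (ev iota u).
Proof. by move=> a b /eqP; rewrite -subr_eq0 -rmorphB ev_eq0 subr_eq0 => /eqP. Qed.

(** Writing each coefficient of r as a sum of b_k^p X^k gives r(z^p) = sum_k s_k(z)^p u^k.
    Independence of the powers of u over p-th powers makes every s_k(z) vanish, and some s_k is
    nonzero. *)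
Lemma root_pexp_descent (r : {poly {poly K}}) z :
    r != 0 -> root (map_poly (ev iota u) r) (z ^+ p) ->
  exists s : {poly {poly K}}, [/\ s != 0, (size s <= size r)%N
    & root (map_poly (ev iota u) s) z].
Proof.
move=> r0 rz; have [b bE] := choice exists_pdecomp.
pose s k := \poly_(l < size r) b r`_l k.
have [k sk0] : exists k, s k != 0.
  apply: contrapT => ns; move/eqP: r0; apply; apply/polyP=> l; rewrite coef0.
  have [lr | /(nth_default 0)//] := ltnP l (size r).
  rewrite (bE r`_l) big1 // => k _; have sk0 : s k = 0.
    by apply/eqP/negPn/negP=> sk; apply: ns; exists k.
  have := congr1 (fun q : {poly {poly K}} => q`_l) sk0.
  by rewrite coef_poly lr coef0 => ->; rewrite expr0n eqn0Ngt p_gt0 mul0r.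
exists (s k); split=> //; first exact: size_poly.
pose w := \poly_(k < p) (if insub k is Some k then (map_poly (ev iota u) (s k)).[z] else 0).
have w0 : w = 0.
  apply: indep_u; rewrite ?size_poly //.
  rewrite (@horner_coef_wide _ p) ?size_map_poly ?size_poly //.
  move: rz; rewrite rootE => /eqP {3}<-.
  rewrite (@horner_coef_wide _ (size r)) ?size_map_inj_poly ?rmorph0 //.
  under eq_bigr do rewrite coef_map coef_poly ltn_ord /= valK /=
    (@horner_coef_wide _ (size r)) ?size_map_inj_poly ?size_poly ?rmorph0 //
    rmorph_sum mulr_suml.
  rewrite exchange_big; apply: eq_bigr => l _ /=.
  rewrite coef_map [X in _ = ev _ _ X * _](bE r`_l) rmorph_sum mulr_suml; apply: eq_bigr => j _.
  rewrite coef_map coef_poly ltn_ord /= pFrobenius_autE exprMn.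
  by rewrite rmorphM !rmorphXn /= evX -!exprM mulrAC [(l * p)%N]mulnC.
have := congr1 (fun q : {poly F} => q`_k) w0.
by rewrite coef_poly ltn_ord coef0 valK => /rootP.
Qed.

(* If the minimal polynomial of z were a polynomial in X^p, z^p would satisfy a
   relation of lower degree, and so would z by taking p-th roots. *)
Theorem separating_gen : separating iota u.
Proof.
move=> z; pose P m := exists q : {poly {poly K}},
  [/\ q != 0, size q = m & root (map_poly (ev iota u) q) z].
have exP : exists m, `[< P m >].
  by have [q q0 qz] := alg_u z; exists (size q); apply/asboolP; exists q.
case: (ex_minnP exP) => m /asboolP[q [q0 sq qz]] min_m.
have {}min_m (r : {poly {poly K}}) : r != 0 -> (size r < size q)%N ->
    (map_poly (ev iota u) r).[z] != 0.
  move=> r0; rewrite ltnNge; apply: contraNneq => rz.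
  by rewrite sq; apply: min_m; apply/asboolP; exists r; split=> //; apply/rootP.
exists (map_poly (ev iota u) q); split=> // [i|]; first by rewrite coef_map; exact: ev_adjoin.
have sq1 : (1 < size q)%N.
  rewrite ltnNge; apply/negP => /size1_polyC qC; move: qz q0; rewrite qC map_polyC.
  by rewrite rootE hornerC /= ev_eq0 => /eqP->; rewrite polyC0 eqxx.
have dq0 : q^`() != 0.
  apply/negP => /eqP dq.
  pose r := \poly_(l < ((size q).-1 %/ p).+1) q`_(l * p).
  have qr : q = r \Po 'X^p by apply: deriv_eq0_comp_Xn dq; rewrite pchar_poly.
  have r0 : r != 0 by apply: contraNneq q0 => r0; rewrite qr r0 comp_poly0.
  have rz : root (map_poly (ev iota u) r) (z ^+ p).
    move: qz; rewrite qr map_comp_poly map_polyXn !rootE horner_comp.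
    by rewrite hornerXn.
  have [s [s0 ss sz]] := root_pexp_descent r0 rz.
  have := min_m s s0; rewrite (rootP sz) eqxx; case/(_ _)/negP => //.
  apply: leq_ltn_trans ss _; apply: leq_ltn_trans (size_poly _ _) _.
  rewrite -(ltn_predK sq1) ltnS ltn_Pdiv ?prime_gt1 //.
  by rewrite -ltnS (ltn_predK sq1).
(* Otherwise a q = b q' with b nonzero and shorter than q; evaluated at z this contradicts the
   minimality of q, as q' and b are nonzero at z. *)
have cop : coprimep q q^`().
  apply: contraT => /(Pdiv.Idomain.Bezout_coprimepPn q0 dq0)[[a b] /= /andP[/andP[a0 sa]
      /andP[b0 sb]] ab].
  have := congr1 (fun r => (map_poly (ev iota u) r).[z]) ab.
  rewrite !rmorphM !hornerM /= (rootP qz) mulr0 => /esym/eqP.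
  rewrite mulf_eq0 (negPf (min_m _ dq0 (lt_size_deriv q0))) orbF.
  by rewrite (negPf (min_m _ _ sb)) // -size_poly_gt0.
rewrite unlock deriv_map.
have /Pdiv.Idomain.Bezout_coprimepP[[a b]] := cop.
case/Pdiv.Idomain.eqpP => [[c1 c2] /= /andP[c10 c20] ab].
apply/Pdiv.Idomain.Bezout_coprimepP; exists (map_poly (ev iota u) a, map_poly (ev iota u) b) => /=.
apply/Pdiv.Idomain.eqpP; exists (ev iota u c1, ev iota u c2); rewrite /= ?ev_eq0 ?c10 //.
by rewrite -!rmorphM -rmorphD /= -!map_polyZ ab map_polyZ rmorph1.
Qed.

Variable Du : derivation iota.
Hypothesis Du1 : Du u = 1.

(** Derivations kill p-th powers, so D is determined by its value at u. *)
Lemma der_gen (D : derivation iota) z : D z = Du z * D u.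
Proof. by have [q ->] := span_u z; rewrite !der_Frob Du1 mulr1. Qed.

Lemma diff_eqP g h t : g *: d u = h *: d t :> differential iota <-> g = h * Du t.
Proof.
split=> [e|->].
  by move/(congr1 (fun w : differential iota => w Du)): e; rewrite /= !diffE Du1 mulr1.
by apply/funext => D; rewrite !diffE [D t]der_gen mulrA.
Qed.

(** If [Du] killed t it would kill K(t); applied to a separable equation f(u) = 0 over K(t) it would
    then give f'(u) = 0. *)
Lemma separating_der_neq0 t : separating iota t -> Du t != 0.
Proof.
move=> st; apply/eqP=> Dt; have [f [fa sf fu]] := st u.
have Df : Du f.[u] = f^`().[u] * Du u.
  by apply: der_horner => i; apply: der_adjoin Dt (fa i).
move: Df; rewrite (rootP fu) der0 Du1 mulr1 => /esym /rootP dfu.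
move: sf; rewrite unlock => /coprimep_root/(_ fu).
by rewrite (rootP dfu) eqxx.
Qed.

(** Since [Du] is d/du, this says that g du = dz for some z. *)
Definition exact_coef g := exists z, g = Du z.

(** Among 1, t, .., t^(p-1) only t^(p-1) has no antiderivative, as the exponent p would be
    differentiated to zero; the other powers integrate because 1, .., p - 1 are invertible. *)
Lemma exact_coefP t (x : nat -> F) : Du t != 0 ->
  exact_coef ((\sum_(i < p) x i ^+ p * t ^+ i) * Du t) <-> x p.-1 = 0.
Proof.
move=> Dt; have it := der_pindep (charF := charF) Dt; have st := pspan_exchange span_u it.
have xE : \sum_(i < p) x i ^+ p * t ^+ i = (\poly_(i < p) x i)^F.[t].
  rewrite (@horner_coef_wide _ p) ?size_map_poly ?size_poly //.
  by apply: eq_bigr => i _; rewrite coef_map coef_poly ltn_ord /= pFrobenius_autE.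
rewrite xE; split=> [[z]|x0].
  have [q sq ->] := pspan_small st z; rewrite der_Frob => /(mulIf Dt)/eqP.
  rewrite -subr_eq0 -hornerN -hornerD -rmorphB /= => /eqP /it q0.
  have /eqP : \poly_(i < p) x i - q^`() = 0.
    apply: q0; apply: leq_trans (size_polyD _ _) _.
    rewrite size_polyN geq_max size_poly /=.
    have [-> | qn0] := eqVneq q 0; first by rewrite deriv0 size_poly0.
    exact: leq_trans (ltnW (lt_size_deriv qn0)) sq.
  rewrite subr_eq0 => /eqP/(congr1 (fun r : {poly F} => r`_p.-1)).
  by rewrite coef_poly ltn_predL p_gt0 coef_deriv -mulr_natr prednK // (pcharf0 charF) mulr0.
pose q := \poly_(j < p) (x j.-1 / j%:R).
exists (q^F.[t]); rewrite der_Frob; congr (_^F.[t] * _).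
apply/polyP=> i; rewrite coef_deriv !coef_poly.
have [ip | pi] := ltnP i.+1 p.
  by rewrite (ltnW ip) -[RHS]mulr_natr divfK // (natr_lt_p_neq0 charF).
rewrite mul0rn; case: ifPn => // ip.
by have -> : i = p.-1 by move: ip pi p_gt0; clear; lia.
Qed.

(* The kernel of the Cartier operator consists of the exact differentials; this
   makes it independent of the separating element used to compute it. *)
Theorem cartier_eq0 g : cartier p (g *: d u : differential iota) = 0 <-> exact_coef g.
Proof.
rewrite /cartier; set w := g *: _.
have graphP w' : cartier_graph p w w' -> exists t (x : nat -> F),
    [/\ Du t != 0, g = (\sum_(i < p) x i ^+ p * t ^+ i) * Du t
      & w' = x p.-1 *: d t].
  move=> [t [x [st /diff_eqP e ->]]]; exists t, x; split=> //.
  exact: separating_der_neq0.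
(* With t = u the graph is inhabited, so [cartier] does not fall back on the default value of
   [xget]. *)
have [w' gw'] : exists w', cartier_graph p w w'.
  have [q sq gE] := pspan_small span_u g.
  exists (q`_p.-1 *: d u), u, (fun i => q`_i); split=> //; first exact: separating_gen.
  rewrite /w gE (@horner_coef_wide _ p) ?size_map_poly //; congr (_ *: _).
  by apply: eq_bigr => i _; rewrite coef_map /= pFrobenius_autE.
split=> [|eg].
  move: (xgetPex 0 (ex_intro _ w' gw')); set w0 := xget _ _ => /graphP[t [x [Dt -> ->]]].
  move/(congr1 (fun w : differential iota => w Du)); rewrite /= diffE => /eqP.
  by rewrite mulf_eq0 (negPf Dt) orbF => /eqP x0; apply/exact_coefP.
case: xgetP => // w0 _ /graphP[t [x [Dt gE ->]]].
by move: eg; rewrite gE => /(exact_coefP _ Dt)->; rewrite scale0r.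
Qed.

End Differentials.

(** * The Hurwitz function field *)

Definition hurwitz_degree (n : nat) := (n ^ 2 - n + 1)%N.

Lemma hurwitz_degreeE n : hurwitz_degree n = (n * n.-1).+1.
Proof. by rewrite /hurwitz_degree; case: n => // n; rewrite /= expnS expn1; nia. Qed.

Lemma coprime_hurwitz_degree n : coprime n (hurwitz_degree n).
Proof. by rewrite hurwitz_degreeE -addn1 mulnC /coprime gcdnMDl gcdn1. Qed.

Lemma coprime_pred_hurwitz_degree n : coprime n.-1 (hurwitz_degree n).
Proof. by rewrite hurwitz_degreeE -addn1 /coprime gcdnMDl gcdn1. Qed.

(* Transcendence is required of S^(n-1) T rather than of S, as this form is
   stable under the cyclic symmetry of the curve. *)
Record hurwitz_gen (n : nat) (K F : fieldType) (iota : {rmorphism K -> F})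
    (S T : F) : Prop := HurwitzGen {
  hurwitz_eqn : S ^+ n * T + T ^+ n + S = 0;
  hurwitz_neq0 : S != 0;
  hurwitz_trans : ~ algebraicOver iota (S ^+ n.-1 * T);
  hurwitz_adjoin : adjoin iota [set S; T] = [set: F] }.

Section HurwitzField.
Variables (n : nat) (K F : fieldType) (iota : {rmorphism K -> F}) (S T : F).
Hypotheses (n_gt0 : (0 < n)%N) (hST : hurwitz_gen n iota S T).

Local Notation N := (hurwitz_degree n).
Definition hurwitz_u := S ^+ n.-1 * T.
Local Notation u := hurwitz_u.
Local Notation ev := (ev iota u).

Let S0 : S != 0 := hurwitz_neq0 hST.

Lemma ev_inj0 a : ev a = 0 -> a = 0.
Proof.
move=> ea; apply/eqP/negPn/negP => a0; case: (hurwitz_trans hST).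
by exists a => //; apply/rootP.
Qed.

Lemma ev_eq0 a : (ev a == 0) = (a == 0).
Proof. by apply/eqP/eqP => [/ev_inj0//|->]; rewrite rmorph0. Qed.

Lemma hurwitz_u_neq0 : u != 0.
Proof. by rewrite -[u](evX iota) ev_eq0 polyX_eq0. Qed.

Lemma evXD1 : ev ('X + 1) = 1 + u.
Proof. by rewrite rmorphD rmorph1 /= evX addrC. Qed.

Lemma hurwitz_1u_neq0 : 1 + u != 0.
Proof. by rewrite -evXD1 ev_eq0 -(size_poly_eq0) -[1]polyC1 size_XaddC. Qed.

Lemma hurwitz_T_neq0 : T != 0.
Proof. by apply: contraNneq hurwitz_u_neq0 => T0; rewrite /u T0 mulr0. Qed.

Lemma hurwitz_Sn : S ^+ n * T = S * u.
Proof. by rewrite mulrA -exprS prednK. Qed.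

Lemma hurwitz_Tn : T ^+ n = - ((1 + u) * S).
Proof.
have := hurwitz_eqn hST; rewrite hurwitz_Sn => e.
by apply/eqP; rewrite -addr_eq0 -[X in _ == X]e; apply/eqP; ring.
Qed.

(** Take the n-th power of u = S^(n-1) T and substitute T^n = - (1 + u) S. *)
Lemma hurwitz_SN : S ^+ N = - (u ^+ n / (1 + u)).
Proof.
apply: (mulIf hurwitz_1u_neq0); rewrite mulNr divfK ?hurwitz_1u_neq0 //.
rewrite /u exprMn -/u hurwitz_Tn mulrN opprK -exprM [(1 + u) * S]mulrC mulrA -exprSr.
by rewrite mulnC hurwitz_degreeE.
Qed.

Lemma hurwitz_TN : T ^+ N = u * (- (1 + u)) ^+ n.-1.
Proof.
rewrite /u -mulrA [T * _]mulrC mulrA -exprMn mulrN [S * _]mulrC -hurwitz_Tn.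
by rewrite -exprM -exprSr hurwitz_degreeE.
Qed.

(** D S is eliminated between the derivatives of T^n = - (1 + u) S ([e1]) and of u = S^(n-1) T
    ([e2]). *)
Lemma hurwitz_der (D : derivation iota) :
  T * (1 + n%:R * u) * D u = N%:R * u * (1 + u) * D T.
Proof.
have T0 := hurwitz_T_neq0; have u1 := hurwitz_1u_neq0.
have e1 : n%:R * (1 + u) * S * D T = T * S * D u + T * (1 + u) * D S.
  have e : T ^+ n.-1 * D T * n%:R = - (S * D u + (1 + u) * D S).
    by rewrite mulr_natr -derX hurwitz_Tn derN derM derD der1; ring.
  have Tn : T * T ^+ n.-1 = - ((1 + u) * S) by rewrite -exprS prednK ?hurwitz_Tn.
  transitivity (- (- ((1 + u) * S)) * D T * n%:R); first by ring.
  by rewrite -Tn; transitivity (- T * (T ^+ n.-1 * D T * n%:R)); [ring | rewrite e; ring].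
have e2 : S * D u = n.-1%:R * u * D S + S ^+ n * D T.
  have -> : S ^+ n = S * S ^+ n.-1 by rewrite -exprS prednK.
  rewrite [in LHS]/u derM derX -mulr_natr /u.
  by case: (n.-1) => [|m] /=; rewrite ?exprS; ring.
apply: (mulfI (mulf_neq0 S0 u1)).
have NE : N%:R = 1 + n%:R * n.-1%:R :> F by rewrite hurwitz_degreeE -natrM -natr1 addrC.
have nE : n%:R = 1 + n.-1%:R :> F by rewrite addrC natr1 prednK.
have e3 : T * (1 + u) * (S * D u) = n.-1%:R * u * (n%:R * (1 + u) * S * D T - T * S * D u) + S
    * u * (1 + u) * D T.
  by rewrite e1 e2 -hurwitz_Sn; ring.
have e4 : T * (1 + u) * (S * D u) + n.-1%:R * u * (T * S * D u) = n.-1%:R * u * (n%:R * (1 + u)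
    * S * D T) + S * u * (1 + u) * D T.
  by rewrite e3; ring.
transitivity ((1 + u) * (T * (1 + u) * (S * D u) + n.-1%:R * u * (T * S * D u))).
  by rewrite nE; ring.
by rewrite e4 NE; ring.
Qed.

End HurwitzField.

(** * Localizations of K[u] and the rings spanned over them by powers of S *)

Section HurwitzRing.
Variables (n : nat) (K F : fieldType) (iota : {rmorphism K -> F}) (S T : F).
Hypotheses (n_gt0 : (0 < n)%N) (hST : hurwitz_gen n iota S T).

Local Notation N := (hurwitz_degree n).
Local Notation u := (hurwitz_u n S T).
Local Notation ev := (ev iota u).

Let N_gt0 : (0 < N)%N. Proof. by rewrite hurwitz_degreeE. Qed.

Section Localization.
Variable W : {poly K} -> Prop.
Hypotheses (W1 : W 1) (WM : forall a b, W a -> W b -> W (a * b)).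
Hypotheses (W0 : forall a, W a -> a != 0) (WX1 : W ('X + 1)).

(** Used for two sets W: the nonzero polynomials, which give K(u), and the complement of an
    irreducible P, which gives the local ring of K[u] at P. Requiring X + 1 in W puts S^N into this
    ring. *)
Definition frac z := exists a c, W c /\ z = ev a / ev c.

Let evW0 c : W c -> ev c != 0.
Proof. by move=> Wc; rewrite (ev_eq0 hST) W0. Qed.

Fact frac1 : frac 1.
Proof. by exists 1, 1; rewrite rmorph1 divr1. Qed.

Fact fracB x y : frac x -> frac y -> frac (x - y).
Proof.
move=> [a [c [Wc ->]]] [b [d [Wd ->]]]; exists (a * d - b * c), (c * d).
split; [exact: WM|rewrite rmorphB !rmorphM].
by field; rewrite !evW0.
Qed.

Fact fracM x y : frac x -> frac y -> frac (x * y).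
Proof.
move=> [a [c [Wc ->]]] [b [d [Wd ->]]]; exists (a * b), (c * d).
by split; [exact: WM|rewrite !rmorphM mulf_div].
Qed.

Definition frac_ring := SubringSet frac1 fracB fracM.

Lemma frac_ev a : frac (ev a).
Proof. by exists a, 1; rewrite rmorph1 divr1. Qed.

Lemma frac_evV a c : W c -> frac (ev a / ev c).
Proof. by move=> Wc; exists a, c. Qed.

Lemma frac_SN : frac (S ^+ N).
Proof.
rewrite (hurwitz_SN n_gt0 hST) -(evXD1 n iota S T) -mulNr -{1}(evX iota u) -rmorphXn -rmorphN.
exact: frac_evV.
Qed.

Definition span z := exists c : 'I_N -> F,
  (forall j, frac (c j)) /\ z = \sum_j c j * S ^+ j.

Lemma spanD x y : span x -> span y -> span (x + y).
Proof.
move=> [c [Ec ->]] [d [Ed ->]]; exists (fun j => c j + d j); split=> [j|].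
  exact: (@subring_setD _ frac_ring _ _ (Ec j) (Ed j)).
by rewrite -big_split; apply: eq_bigr => j _; rewrite mulrDl.
Qed.

Lemma span_mono c m : frac c -> span (c * S ^+ m).
Proof.
move=> Ec; pose j0 : 'I_N := Ordinal (ltn_pmod m N_gt0).
exists (fun j => if j == j0 then c * (S ^+ N) ^+ (m %/ N) else 0); split=> [j|].
  case: ifP => _; last exact: (subring_set0 frac_ring).
  by apply: fracM => //; exact: (@subring_setX _ frac_ring _ _ frac_SN).
rewrite (bigD1 j0) //= eqxx big1 ?addr0 => [|j /negPf->]; last by rewrite mul0r.
by rewrite -mulrA -exprM -exprD mulnC -divn_eq.
Qed.

Lemma span0 : span 0.
Proof. by rewrite -(mul0r (S ^+ 0)); apply: span_mono; exact: (subring_set0 frac_ring). Qed.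

Lemma span_sum I (r : seq I) (P : pred I) (f : I -> F) :
  (forall i, P i -> span (f i)) -> span (\sum_(i <- r | P i) f i).
Proof. by move=> Bf; apply: (big_ind span) => //; [exact: span0 | exact: spanD]. Qed.

Fact spanM x y : span x -> span y -> span (x * y).
Proof.
move=> [c [Ec ->]] [d [Ed ->]]; rewrite mulr_suml; apply: span_sum => i _.
rewrite mulr_sumr; apply: span_sum => j _; rewrite mulrACA -exprD.
exact/span_mono/fracM.
Qed.

Lemma frac_span z : frac z -> span z.
Proof. by move=> Ez; rewrite -[z]mulr1 -(expr0 S); exact: span_mono. Qed.

Fact span1 : span 1. Proof. exact/frac_span/frac1. Qed.

Fact spanB x y : span x -> span y -> span (x - y).
Proof.
move=> Ex Ey; rewrite -mulN1r; apply: spanD => //; apply: spanM => //.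
by apply: frac_span; exact: (subring_setN (subring_set1 frac_ring)).
Qed.

Definition span_ring := SubringSet span1 spanB spanM.

Lemma span_S : span S.
Proof. by rewrite -[S]mul1r -[S in _ * S]expr1; apply/span_mono/frac1. Qed.

(** Denominators clear the coefficients, and 1 + u clears S: the N-th power of (1 + u) S is the
    polynomial - u^n (1 + u)^(N-1). *)
Lemma span_frac_integral z : span z -> exists c, W c /\ integralOver ev (ev c * z).
Proof.
pose Q z := exists c, W c /\ integralOver ev (ev c * z).
have QM x y : Q x -> Q y -> Q (x * y).
  move=> [c [Wc ic]] [d [Wd id]]; exists (c * d); split; first exact: WM.
  by rewrite rmorphM mulrACA; exact: integral_mul.
have QD x y : Q x -> Q y -> Q (x + y).
  move=> [c [Wc ic]] [d [Wd id]]; exists (c * d); split; first exact: WM.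
  rewrite rmorphM mulrDr; apply: integral_add.
    by rewrite mulrAC mulrC; apply: integral_mul => //; exact: integral_id.
  by rewrite -mulrA; apply: integral_mul => //; exact: integral_id.
have Qfrac x : frac x -> Q x.
  move=> [a [c [Wc ->]]]; exists c; split=> //.
  by rewrite mulrC divfK ?evW0 //; exact: integral_id.
have QS : Q S.
  exists ('X + 1); split=> //; pose h : {poly K} := - ('X^n * ('X + 1) ^+ N.-1).
  exists ('X^N - h%:P); first exact: monicXnsubC.
  have e : ((1 + u) * S) ^+ N = - (u ^+ n * (1 + u) ^+ N.-1).
    rewrite exprMn (hurwitz_SN n_gt0 hST) -{1}(prednK N_gt0) exprS.
    by field; exact: (hurwitz_1u_neq0 hST).
  have eh : ev h = - (u ^+ n * (1 + u) ^+ N.-1).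
    by rewrite rmorphN rmorphM !rmorphXn /= evX evXD1.
  rewrite rmorphB /= map_polyXn map_polyC rootE /= eh !hornerE evXD1 e.
  by rewrite opprK addNr.
have QX j : Q (S ^+ j).
  elim: j => [|j IH]; first exact/Qfrac/frac1.
  by rewrite exprS; exact: QM.
move=> [c [Ec ->]]; apply: (big_ind Q) => //; first exact/Qfrac/(subring_set0 frac_ring).
by move=> j _; apply: QM => //; exact: Qfrac.
Qed.

End Localization.

Definition nonzero (a : {poly K}) : Prop := a != 0.

Let nz1 : nonzero 1. Proof. exact: oner_neq0. Qed.
Let nzM a b : nonzero a -> nonzero b -> nonzero (a * b).
Proof. exact: mulf_neq0. Qed.
Let nz0 a : nonzero a -> a != 0. Proof. by []. Qed.
Let nzX1 : nonzero ('X + 1).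
Proof. by rewrite /nonzero -(ev_eq0 hST) evXD1 (hurwitz_1u_neq0 hST). Qed.

(* Inverses come from the equation of integral dependence. *)
Lemma span_setT z : span nonzero z.
Proof.
pose R := span_ring nz1 nzM nz0 nzX1.
have RV w : span nonzero w -> span nonzero w^-1.
  move=> Rw; have [-> | w0] := eqVneq w 0; first by rewrite invr0; exact: (subring_set0 R).
  have [c [Wc [q mq qw]]] := span_frac_integral nz1 nzM nz0 nzX1 Rw.
  have Rev a : span nonzero (ev a) by apply/frac_span/frac_ev.
  set y := ev c * w in qw; have Ry : R y by apply: spanM.
  have y0 : y != 0 by rewrite mulf_neq0 // (ev_eq0 hST).
  have [b Rb yb] : exists2 b, span nonzero b & y * b = 1.
    have qn0 := monic_neq0 mq; elim/poly_ind: q qn0 qw {mq} => [|q a IH]; first by rewrite eqxx.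
    rewrite rmorphD rmorphM /= map_polyX map_polyC /= rootE hornerD hornerM hornerX hornerC.
    have [-> q0 | a0 _] := eqVneq a 0.
      rewrite raddf0 addr0 mulf_eq0 (negPf y0) orbF => /IH; apply.
      by apply: contraNneq q0 => ->; rewrite mul0r add0r.
    rewrite addr_eq0 => /eqP qy; exists (- ((map_poly ev q).[y] / ev a)).
      apply: (subring_setN (B := R)); apply: spanM => //; last first.
        by apply: frac_span => //; exists 1, a; rewrite rmorph1 div1r.
      rewrite horner_coef; apply: span_sum => // i _; apply: spanM => //.
        by rewrite coef_map; exact: Rev.
      exact: (@subring_setX _ R).
    by rewrite mulrN mulrA [y * _]mulrC qy mulNr opprK divff // (ev_eq0 hST).
  rewrite (_ : w^-1 = ev c * b); first exact: spanM.
  apply: (mulfI w0); rewrite mulfV // -yb /y; ring.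
have : adjoin iota [set S; T] z by rewrite (hurwitz_adjoin hST).
apply; last first.
  move=> _ [->|->]; first exact: span_S.
  rewrite (_ : T = u * (S ^+ n.-1)^-1); last first.
    by rewrite /hurwitz_u mulrC mulKf ?expf_neq0 ?(hurwitz_neq0 hST).
  rewrite -{1}(evX iota u); apply: spanM => //; first exact/frac_span/frac_ev.
  by apply/RV/(@subring_setX _ R)/span_S.
split=> [_ [c _ <-]|x y|x y Rx Ry]; last by apply: spanM => //; exact: RV.
- by rewrite -(evC iota u c); apply/frac_span/frac_ev.
- exact: spanB.
Qed.

Lemma hurwitz_alg z : exists2 q : {poly {poly K}}, q != 0 & root (map_poly ev q) z.
Proof.
have [c [Wc [q mq qz]]] := span_frac_integral nz1 nzM nz0 nzX1 (span_setT z).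
exists (\poly_(i < size q) (q`_i * c ^+ i)).
  rewrite -size_poly_eq0 size_poly_eq ?size_poly_eq0; first exact: monic_neq0.
  by rewrite -lead_coefE (monicP mq) mul1r expf_neq0.
move: qz; rewrite !rootE => /eqP <-; apply/eqP.
have ev0 : ev 0 = 0 by rewrite rmorph0.
rewrite (@horner_coef_wide _ (size q)); last first.
  by apply: leq_trans (size_poly _ _) _; exact: size_poly.
rewrite (@horner_coef_wide _ (size q)); last exact: size_poly.
apply: eq_bigr => i _; rewrite !coef_map coef_poly ltn_ord /=.
by rewrite rmorphM rmorphXn exprMn mulrA.
Qed.

End HurwitzRing.

(** The valuations of the terms are already distinct modulo N. Here N stands for any modulus: the
    degree of F over K(u) for powers of S, or p for expansions with p-th powers as coefficients. *)
Lemma val_sum_mod (F : fieldType) (O : subring_set F) (x : F) (N : nat)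
    (c : 'I_N -> F) (r : 'I_N -> int) :
    (forall z, O z \/ O z^-1) -> x != 0 -> val_ideal O x ->
    (forall j, c j != 0 -> exists k, val_eq O x (c j) (N%:Z * k + r j)) ->
    (forall i j, (r i = r j %[mod N])%Z -> i = j) ->
  [/\ O (\sum_j c j) -> forall j, O (c j), \sum_j c j = 0 -> forall j, c j = 0
    & forall i, c i != 0 -> exists k, val_eq O x (\sum_j c j) k].
Proof.
move=> tO x0 mx vc rI.
have /choice[k kE] j : exists k, c j != 0 -> val_eq O x (c j) (N%:Z * k + r j).
  have [_|/vc[k vk]] := eqVneq (c j) 0; first by exists 0.
  by exists k.
have inj i j : c i != 0 -> c j != 0 ->
    N%:Z * k i + r i = N%:Z * k j + r j -> i = j.
  move=> _ _ /(congr1 (fun z => (z %% N)%Z)); rewrite ![N%:Z * _]mulrC !modzMDl.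
  exact: rI.
split; first exact: (val_sum_O tO x0 mx kE inj).
  exact: (val_sum0 tO x0 mx kE inj).
by move=> i ci; have [j [_ _ vj]] := val_eq_sum tO x0 mx kE inj ci; exists (N%:Z * k j + r j).
Qed.

Lemma coprime_mod_inj (N : nat) (m : int) (i j : 'I_N) : coprime N `|m|%N ->
  (m * i%:Z = m * j%:Z %[mod N])%Z -> i = j.
Proof.
move=> cNm; wlog ij : i j / (i <= j)%N.
  by move=> H e; case: (leqP i j) => [/H|/ltnW/H]; [apply|move=> /(_ (esym e))].
move/eqP; rewrite eqz_mod_dvd -mulrBr dvdzE abszM Gauss_dvdr //=.
rewrite distnEr // => Nij; apply/val_inj/eqP; rewrite eqn_leq ij -subn_eq0 /=.
by move: Nij; apply: contraLR => ji; rewrite gtnNdvd ?lt0n // (leq_ltn_trans (leq_subr _ _)).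
Qed.

(** * The totally ramified place over u = 0, with local parameter T *)

Section RamifiedPlace.
Variables (n : nat) (K F : fieldType) (iota : {rmorphism K -> F}) (S T : F).
Hypotheses (n_gt0 : (0 < n)%N) (hST : hurwitz_gen n iota S T).

Local Notation N := (hurwitz_degree n).
Local Notation u := (hurwitz_u n S T).
Local Notation ev := (ev iota u).

Let u0 : u != 0 := hurwitz_u_neq0 hST.
Let T0 : T != 0 := hurwitz_T_neq0 hST.

Section Place.
Variable O : subring_set F.
Hypotheses (tO : forall z, O z \/ O z^-1) (KO : forall c, O (iota c)).
Hypothesis mu : val_ideal O u.

Lemma ram_1u_unit : val_unit O (1 + u).
Proof. by apply: val_unitDideal => //; exact: val_unit1. Qed.

Let unit_1uX m : val_unit O ((- (1 + u)) ^+ m).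
Proof. exact/val_unitX/val_unitN/ram_1u_unit. Qed.

Lemma ram_T_ideal : val_ideal O T.
Proof.
have mTN : val_ideal O (T ^+ N).
  rewrite (hurwitz_TN n_gt0 hST) mulrC; apply: val_idealM => //.
  by case: (unit_1uX n.-1).
have [uT | nT] := pselect (val_unit O T).
  by case: (val_unit_not_ideal _ mTN); exact: val_unitX.
have [OT | nOT] := pselect (O T); first by have [/nT|] := val_unit_or_ideal OT.
have OV : O (T^-1 ^+ N) by apply: subring_setX; case: (val_idealVN tO nOT).
by case: mTN => _ /(_ (expf_neq0 _ T0)); rewrite -exprVn.
Qed.

Let mT := ram_T_ideal.

Lemma ram_S : val_eq O T S n%:Z.
Proof.
rewrite /val_eq -exprnP (hurwitz_Tn n_gt0 hST) -mulNr [_ * S]mulrC invfM mulrA.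
rewrite mulfV ?(hurwitz_neq0 hST) // mul1r.
exact/val_unitV/val_unitN/ram_1u_unit.
Qed.

Lemma ram_u : val_eq O T u N%:Z.
Proof.
rewrite /val_eq -exprnP (hurwitz_TN n_gt0 hST) invfM mulrA mulfV // mul1r.
exact/val_unitV/unit_1uX.
Qed.

(** k is the order of vanishing of a at 0. *)
Lemma ram_ev a : a != 0 -> exists k : nat, val_eq O T (ev a) (N%:Z * k%:Z).
Proof.
have Oev b : O (ev b).
  elim/poly_ind: b => [|b c IH]; first by rewrite rmorph0; exact: subring_set0.
  rewrite rmorphD rmorphM /= evX evC; apply: subring_setD => //.
  by apply: subring_setM => //; case: mu.
elim/poly_ind: a => [|a c IH]; first by rewrite eqxx.
have [-> | c0 _] := eqVneq c 0.
  rewrite addr0 mulf_eq0 polyX_eq0 orbF => /IH[k vk]; exists k.+1.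
  rewrite rmorphM /= evX intS mulrDr mulr1 addrC; exact: val_eqM ram_u.
exists 0%N; rewrite mulr0 rmorphD rmorphM /= evX evC addrC; apply: val_eq_unit.
apply: (val_unitDideal tO); last exact: val_idealM.
by split; rewrite ?fmorph_eq0 // -fmorphV.
Qed.

Lemma ram_frac z : frac n iota S T (@nonzero K) z -> z != 0 ->
  exists k : int, val_eq O T z (N%:Z * k).
Proof.
move=> [a [c [c0 ->]]]; rewrite mulf_eq0 invr_eq0 negb_or => /andP[a0 _].
have [k vk] : exists k : nat, val_eq O T (ev a) (N%:Z * k%:Z).
  by apply: ram_ev; apply: contraNneq a0 => ->; rewrite rmorph0.
have [l vl] := ram_ev c0; exists (k%:Z - l%:Z); rewrite mulrBr.
exact/val_eqM/val_eqV.
Qed.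

Lemma ram_sum (c : 'I_N -> F) : (forall j, frac n iota S T (@nonzero K) (c j)) ->
  [/\ \sum_j c j * S ^+ j = 0 -> forall j, c j = 0
    & forall i, c i != 0 -> exists k, val_eq O T (\sum_j c j * S ^+ j) k].
Proof.
move=> Ec; have SX0 j : S ^+ j != 0 by rewrite expf_neq0 // (hurwitz_neq0 hST).
have [|i j|_ s0 sv] := @val_sum_mod F O T N (fun j => c j * S ^+ j) (fun j => n%:Z * j%:Z) tO T0 mT.
- move=> j; rewrite mulf_eq0 negb_or => /andP[cj _].
  have [k vk] := ram_frac (Ec j) cj; exists k; apply: val_eqM => //.
  exact/val_eqX/ram_S.
- by apply: coprime_mod_inj; rewrite coprime_sym coprime_hurwitz_degree.
split=> [/s0 c0 j|i ci]; last by apply: (sv i); rewrite mulf_neq0.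
by have /eqP := c0 j; rewrite mulf_eq0 (negPf (SX0 _)) orbF => /eqP.
Qed.

(** Each element is a combination of the S^j over K(u). Coefficients have valuations divisible by N
    and S has valuation n, prime to N, so [ram_sum] finds the value of the sum. *)
Lemma ram_param : val_param O T.
Proof.
move=> z; have [c [Ec ->]] := span_setT n_gt0 hST z => z0.
have [i ci] : exists i, c i != 0.
  apply: contrapT => nc; move/eqP: z0; apply; rewrite big1 // => i _.
  have -> : c i = 0 by apply/eqP/negPn/negP => ci; apply: nc; exists i.
  by rewrite mul0r.
by have [_ /(_ i ci)] := ram_sum Ec.
Qed.

End Place.

(** As u is transcendental over K, u^-1 is not in K[u], and [chevalley] applies to K[u]. *)
Lemma exists_ram_place : exists O : subring_set F,
  [/\ forall z, O z \/ O z^-1, forall c, O (iota c) & val_ideal O u].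
Proof.
pose A := [set z | exists a, z = ev a].
have A1 : A 1 by exists 1; rewrite rmorph1.
have AB x y : A x -> A y -> A (x - y).
  by move=> [a ->] [b ->]; exists (a - b); rewrite rmorphB.
have AM x y : A x -> A y -> A (x * y).
  by move=> [a ->] [b ->]; exists (a * b); rewrite rmorphM.
have [||O [AO nO tO]] := @chevalley F (SubringSet A1 AB AM) u.
- by exists 'X; rewrite evX.
- move=> [a e]; have : ev ('X * a - 1) = 0.
    by rewrite rmorphB rmorphM rmorph1 /= evX -e mulfV // subrr.
  move/(ev_inj0 hST)/(congr1 (fun q : {poly K} => q`_0))/eqP.
  by rewrite coefB coefXM coef1 coef0 sub0r oppr_eq0 oner_eq0.
exists O; split=> // [c|]; first by apply: AO; exists c%:P; rewrite evC.
by split=> [|_ //]; apply: AO; exists 'X; rewrite evX.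
Qed.

Lemma hurwitz_indep (c : 'I_N -> F) :
    (forall j, frac n iota S T (@nonzero K) (c j)) ->
  \sum_j c j * S ^+ j = 0 -> forall j, c j = 0.
Proof.
by have [O [tO KO mu]] := exists_ram_place => /(ram_sum tO KO mu)[].
Qed.

Section Characteristic.
Variable p : nat.
Hypotheses (charF : p \in [pchar F]) (pN : ~~ (p %| N)%N).
Hypothesis perfK : forall c : K, exists k, c = k ^+ p.

Let pr_p : prime p := pcharf_prime charF.
Local Notation Frob := (pFrobenius_aut charF).
Local Notation "q ^F" := (map_poly Frob q) (at level 2, format "q ^F").

Lemma hurwitz_coprime_p : coprime p N.
Proof. by rewrite prime_coprime. Qed.

(** At a place over u = 0 the i-th term has valuation N i modulo p, and p does not divide N. *)
Lemma hurwitz_pindep : pindep charF u.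
Proof.
move=> q sq; have [O [tO KO mu]] := exists_ram_place.
rewrite (@horner_coef_wide _ p) ?size_map_poly // => q0.
have mT := ram_T_ideal tO mu; have pT := ram_param tO KO mu.
have /choice[k kE] (i : 'I_p) : exists k, q`_i != 0 -> val_eq O T (q`_i) k.
  have [_|/pT[k vk]] := eqVneq q`_i 0; first by exists 0.
  by exists k.
have [|i j|_ s0 _] := @val_sum_mod F O T p (fun i => (q^F)`_i * u ^+ i) (fun i => N%:Z * i%:Z)
    tO T0 mT.
- move=> i; rewrite coef_map mulf_eq0 negb_or fmorph_eq0 => /andP[qi _].
  exists (k i); rewrite /= pFrobenius_autE; apply: val_eqM => //.
    by rewrite [p%:Z * _]mulrC; exact/val_eqX/kE.
  exact/val_eqX/ram_u.
- by apply: coprime_mod_inj; exact: hurwitz_coprime_p.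
apply/polyP=> i; rewrite coef0; have [ip | pi] := ltnP i p; last first.
  by rewrite nth_default // (leq_trans sq).
have /eqP := s0 q0 (Ordinal ip); rewrite coef_map mulf_eq0 fmorph_eq0 /=.
by rewrite (negPf (expf_neq0 _ u0)) orbF => /eqP.
Qed.

(** From p a = b N + 1 one gets S^j = (S^(j a))^p (S^N)^(- j b), and S^N is in K(u); fractions are
    handled by 1 / c = c^(p-1) (1 / c)^p. *)
Lemma hurwitz_pspan : pspan charF u.
Proof.
pose Sp z := exists q : {poly F}, z = q^F.[u].
have SpM x y : Sp x -> Sp y -> Sp (x * y).
  by move=> [q ->] [r ->]; exists (q * r); rewrite rmorphM hornerM.
have SpD x y : Sp x -> Sp y -> Sp (x + y).
  by move=> [q ->] [r ->]; exists (q + r); rewrite rmorphD hornerD.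
have Spp x : Sp (x ^+ p) by exists x%:P; rewrite map_polyC hornerC.
have Spu : Sp u by exists 'X; rewrite map_polyX hornerX.
have Sp0 : Sp 0 by exists 0; rewrite rmorph0 horner0.
have Spev a : Sp (ev a).
  elim/poly_ind: a => [|a c IH]; first by rewrite rmorph0.
  rewrite rmorphD rmorphM /= evX evC; apply: SpD; first exact: SpM.
  by have [k ->] := perfK c; rewrite rmorphXn.
have Spfrac z : frac n iota S T (@nonzero K) z -> Sp z.
  move=> [a [c [c0 ->]]]; rewrite (_ : _ / _ = ev (a * c ^+ p.-1) * (ev c)^-1 ^+ p).
    exact: SpM.
  rewrite rmorphM rmorphXn -mulrA; congr (_ * _).
  rewrite -[in RHS](prednK (prime_gt0 pr_p)) exprVn [in X in _ = _ / X]exprS invfM mulrCA.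
  by rewrite mulfV ?mulr1 // expf_neq0 // (ev_eq0 hST).
have SpS j : Sp (S ^+ j).
  have [a b ab _] := egcdnP N (prime_gt0 pr_p).
  have -> : S ^+ j = (S ^+ (j * a)) ^+ p * ((S ^+ N)^-1) ^+ (j * b).
    rewrite -exprM -mulnA ab (eqP hurwitz_coprime_p) mulnDr muln1 exprD mulnA.
    rewrite [(j * b * N)%N]mulnC exprM exprVn mulrAC mulfV ?mul1r //.
    by rewrite !expf_neq0 // (hurwitz_neq0 hST).
  apply: (SpM) => //; elim: (j * b)%N => [|m IH]; last first.
    rewrite exprS; apply: SpM => //; apply: Spfrac.
    rewrite (hurwitz_SN n_gt0 hST) invrN invfM invrK mulrC -(evXD1 n iota S T).
    exists (- ('X + 1)), 'X^n; split; first by rewrite /nonzero expf_neq0 ?polyX_eq0.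
    by rewrite rmorphN rmorphXn mulNr /= evX.
  by rewrite expr0 -(expr1n _ p).
move=> z; have [c [Ec ->]] := span_setT n_gt0 hST z.
by apply: (big_ind Sp) => // j _; apply: SpM => //; exact: Spfrac.
Qed.

End Characteristic.
End RamifiedPlace.

(** * Places at which u, 1 + u and their inverses are regular *)

Lemma irreducible_dvdp_mul (K : fieldType) (P a b : {poly K}) :
  irreducible_poly P -> (P %| a * b) = (P %| a) || (P %| b).
Proof.
move=> irrP; apply/idP/orP => [Pab|[Pa|Pb]]; [|exact: dvdp_mulr|exact: dvdp_mull].
have [Pa|nPa] := boolP (P %| a); [by left | right].
by move: Pab; rewrite Gauss_dvdpr // irreducible_poly_coprime.
Qed.

Definition away (K : fieldType) (P c : {poly K}) : Prop := ~~ (P %| c).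

Section Away.
Variables (K : fieldType) (P : {poly K}).
Hypothesis irrP : irreducible_poly P.

Lemma away1 : away P 1.
Proof. by rewrite /away dvdp1; case: irrP => sP _; rewrite neq_ltn sP orbT. Qed.

Lemma awayM a b : away P a -> away P b -> away P (a * b).
Proof. by rewrite /away irreducible_dvdp_mul // negb_or => -> ->. Qed.

Lemma away_neq0 a : away P a -> a != 0.
Proof. by apply: contraNneq => ->; rewrite dvdp0. Qed.

End Away.

Section UnramifiedPlace.
Variables (n : nat) (K F : fieldType) (iota : {rmorphism K -> F}) (S T : F).
Hypotheses (n_gt0 : (0 < n)%N) (hST : hurwitz_gen n iota S T).
Variable p : nat.
Hypotheses (charF : p \in [pchar F]) (pN : ~~ (p %| hurwitz_degree n)%N).

Local Notation N := (hurwitz_degree n).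
Local Notation u := (hurwitz_u n S T).
Local Notation ev := (ev iota u).

Let N_gt0 : (0 < N)%N. Proof. by rewrite hurwitz_degreeE. Qed.
Let pr_p : prime p := pcharf_prime charF.

Variable P : {poly K}.
Hypotheses (irrP : irreducible_poly P) (PX : ~~ (P %| 'X)) (PX1 : ~~ (P %| 'X + 1)).

Local Notation away := (away P).

Let prime_P a b : (P %| a * b) = (P %| a) || (P %| b).
Proof. exact: irreducible_dvdp_mul. Qed.

Let P0 : P != 0. Proof. exact: irredp_neq0. Qed.
Let W1 : away 1 := away1 irrP.
Let WM a b : away a -> away b -> away (a * b) := @awayM _ _ irrP a b.
Let W0 a : away a -> a != 0 := @away_neq0 _ _ a.

Local Notation Efrac := (frac n iota S T away).
Local Notation Rspan := (span n iota S T away).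
Let E := frac_ring hST W1 WM W0.
Let R := span_ring n_gt0 hST W1 WM W0 PX1.
Local Notation pi := (ev P).
Let pi0 : pi != 0. Proof. by rewrite (ev_eq0 hST). Qed.

Lemma frac_nonzero W z : (forall a, W a -> a != 0) -> frac n iota S T W z ->
  frac n iota S T (@nonzero K) z.
Proof. by move=> W0' [a [c [Wc ->]]]; exists a, c; split=> //; exact: W0'. Qed.

Let divE z := exists2 y, Efrac y & z = pi * y.
Let divR z := exists2 y, Rspan y & z = pi * y.

Let divE_prime y z : Efrac y -> Efrac z -> divE (y * z) -> divE y \/ divE z.
Proof.
move=> [a [c [Wc ->]]] [b [d [Wd ->]]] [_ [e [f [Wf ->]]]] e1.
have [c0 d0 f0] : [/\ ev c != 0, ev d != 0 & ev f != 0] by rewrite !(ev_eq0 hST) !W0.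
have divP x w : P %| x -> away w -> divE (ev x / ev w).
  move=> /dvdpP[q ->] Ww; exists (ev q / ev w); first by exists q, w.
  by rewrite rmorphM mulrA [pi * _]mulrC.
have : ev (a * b * f) = ev (P * e * (c * d)).
  rewrite !rmorphM; apply: (mulIf (mulf_neq0 (mulf_neq0 (invr_neq0 c0) (invr_neq0 d0))
      (invr_neq0 f0))).
  transitivity (ev a / ev c * (ev b / ev d) * (ev f / ev f)); first by ring.
  by rewrite e1 !mulfV // mulr1; field; rewrite c0 d0 f0.
move=> /eqP; rewrite -subr_eq0 -rmorphB (ev_eq0 hST) subr_eq0 => /eqP abf.
have : P %| a * b * f by rewrite abf -mulrA dvdp_mulr.
rewrite !prime_P (negPf Wf) orbF => /orP[] Pd; [left|right]; exact: divP.
Qed.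

Let divE_pow m z : Efrac z -> divE (z ^+ m) -> divE z.
Proof.
move=> Ez; elim: m => [|m IH].
  move=> [y Ey e]; exists (y * z); first exact: (@subring_setM _ E).
  by rewrite mulrA -e mul1r.
rewrite exprS => /divE_prime-/(_ Ez); case=> //.
by exact: (@subring_setX _ E).
Qed.

Let not_divE_SN : ~ divE (S ^+ N).
Proof.
rewrite (hurwitz_SN n_gt0 hST) -(evXD1 n iota S T) => -[_ [a [c [Wc ->]]] e].
have c0 : ev c != 0 by rewrite (ev_eq0 hST) W0.
have x0 : ev ('X + 1) != 0 by rewrite (ev_eq0 hST) W0.
have : ev (- ('X^n * c)) = ev (P * a * ('X + 1)).
  rewrite rmorphN !rmorphM rmorphXn /=; apply: (mulIf (mulf_neq0 (invr_neq0 c0) (invr_neq0 x0))).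
  transitivity (- (ev 'X ^+ n / ev ('X + 1)) * (ev c / ev c)); first by ring.
  by rewrite evX e mulfV // mulr1; move: (ev ('X + 1)) x0 => x x0; field; rewrite c0 x0.
move=> /eqP; rewrite -subr_eq0 -rmorphB (ev_eq0 hST) subr_eq0 => /eqP Xc.
have : P %| 'X^n * c by rewrite -dvdpNr Xc -mulrA dvdp_mulr.
rewrite prime_P (negPf Wc) orbF; elim: (n) => [|m IH].
  by rewrite expr0 (negPf W1).
by rewrite exprS prime_P (negPf PX).
Qed.

Let sigma (j : 'I_N) : 'I_N := Ordinal (ltn_pmod (p * j) N_gt0).

Let sigma_inj : injective sigma.
Proof.
move=> i j /(congr1 val) /= e; apply: (@coprime_mod_inj N p).
  by rewrite coprime_sym (hurwitz_coprime_p charF pN).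
by rewrite -!PoszM !modz_nat e.
Qed.

Lemma hurwitz_indep_perm (s : 'I_N -> 'I_N) (c : 'I_N -> F) : injective s ->
    (forall j, frac n iota S T (@nonzero K) (c j)) ->
  \sum_j c j * S ^+ s j = 0 -> forall j, c j = 0.
Proof.
move=> s_inj Ec s0 j.
rewrite -(invF_f s_inj j); move: (s j).
apply: (hurwitz_indep n_gt0 hST (c := fun j => c (invF s_inj j))) => //.
by rewrite (reindex_inj s_inj) -[RHS]s0; apply: eq_bigr => i _; rewrite invF_f.
Qed.

(** The p-th power of sum_j c_j S^j is sum_j c_j^p (S^N)^(p j / N) S^(sigma j), with the quotient
    rounded down. As p is prime to N, [sigma] is injective and coefficients can be compared; since
    [pi] is prime and does not divide S^N, it divides each c_j. *)
Let divR_Frob r : Rspan r -> divR (r ^+ p) -> divR r.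
Proof.
move=> [c [Ec rE]] [_ [d [Ed ->]] e].
have ESN m : Efrac ((S ^+ N) ^+ m).
  by apply: (@subring_setX _ E); exact: (frac_SN n_gt0 hST PX1).
have Epi : Efrac pi by exact: frac_ev.
have rpE : r ^+ p = \sum_j c j ^+ p * (S ^+ N) ^+ (p * j %/ N) * S ^+ sigma j.
  rewrite rE -(pFrobenius_autE charF) rmorph_sum; apply: eq_bigr => j _ /=.
  rewrite pFrobenius_autE exprMn -mulrA; congr (_ * _).
  by rewrite -exprM -exprM -exprD [(N * _)%N]mulnC -divn_eq mulnC.
have s0 : \sum_j (c j ^+ p * (S ^+ N) ^+ (p * j %/ N) - pi * d (sigma j)) * S ^+ sigma j = 0.
  under eq_bigr do rewrite mulrBl; rewrite sumrB -rpE e mulr_sumr.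
  rewrite [X in X - _](reindex_inj sigma_inj); apply/eqP; rewrite subr_eq0.
  by apply/eqP/eq_bigr => j _; rewrite mulrA.
have cd := hurwitz_indep_perm sigma_inj _ s0.
have {}cd j : divE (c j).
  have Ecp i : Efrac (c i ^+ p) by exact: (@subring_setX _ E _ _ (Ec i)).
  have : divE (c j ^+ p * (S ^+ N) ^+ (p * j %/ N)).
    exists (d (sigma j)) => //; apply/eqP; rewrite -subr_eq0; apply/eqP/cd => i.
    apply: (@frac_nonzero away) => //; apply: (@subring_setB _ E).
      exact: (@subring_setM _ E _ _ (Ecp i) (ESN _)).
    exact: (@subring_setM _ E _ _ Epi (Ed _)).
  move=> /(divE_prime (Ecp j) (ESN _))[]; first exact: divE_pow.
  move=> /divE_pow h; case: not_divE_SN; apply: h.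
  by rewrite -[S ^+ N]expr1; exact: ESN.
have /choice[y yE] j : exists y, Efrac y /\ c j = pi * y.
  by have [y Ey cy] := cd j; exists y.
exists (\sum_j y j * S ^+ j); first by exists y; split=> // j; case: (yE j).
rewrite rE mulr_sumr; apply: eq_bigr => j _; rewrite mulrA.
by case: (yE j) => _ <-.
Qed.

Let R0 : Rspan 0 := subring_set0 R.
Let R1 : Rspan 1 := subring_set1 R.
Let RN x : Rspan x -> Rspan (- x) := @subring_setN _ R x.
Let RD x y : Rspan x -> Rspan y -> Rspan (x + y) := @subring_setD _ R x y.
Let RB x y : Rspan x -> Rspan y -> Rspan (x - y) := @subring_setB _ R x y.
Let RM x y : Rspan x -> Rspan y -> Rspan (x * y) := @subring_setM _ R x y.
Let RX x m : Rspan x -> Rspan (x ^+ m) := @subring_setX _ R x m.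
Let Rsum I (r : seq I) (Q : pred I) (f : I -> F) :
  (forall i, Q i -> Rspan (f i)) -> Rspan (\sum_(i <- r | Q i) f i) :=
  @subring_set_sum _ R I r Q f.

Let span_evV c : away c -> Rspan (ev c)^-1.
Proof.
move=> Wc; apply: (frac_span n_gt0 hST W1 WM W0 PX1).
by exists 1, c; rewrite rmorph1 div1r.
Qed.

Let span_ev c : Rspan (ev c).
Proof. exact/(frac_span n_gt0 hST W1 WM W0 PX1)/frac_ev. Qed.

Let divR_mul x y : Rspan x -> divR y -> divR (x * y).
Proof.
move=> Rx [z Rz ->]; exists (x * z); first exact: RM.
by rewrite mulrCA.
Qed.

(** As m < p^m, the exponent can be raised to p^m and then lowered by [divR_Frob]. *)
Let divR_pow r m : Rspan r -> divR (r ^+ m) -> divR r.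
Proof.
move=> Rr rm.
have : divR (r ^+ (p ^ m)).
  rewrite -(subnK (ltnW (ltn_expl m (prime_gt1 pr_p)))) exprD; apply: divR_mul => //.
  exact: RX.
elim: (m) => [|k IH]; first by rewrite expn0 expr1.
rewrite expnSr exprM => /divR_Frob h; apply/IH/h.
exact: RX.
Qed.

Let divRD x y : divR x -> divR y -> divR (x + y).
Proof.
move=> [a Ra ->] [b Rb ->]; exists (a + b); rewrite ?mulrDr //.
exact: RD.
Qed.

(* The quotient of [span away] by [ev P] is reduced and integral over a field,
   hence von Neumann regular. *)
Lemma span_regular r : Rspan r ->
  exists e y, [/\ Rspan e, Rspan y & r * (1 - r * e) = pi * y].
Proof.
move=> Rr.
have [c [Wc [q mq /rootP qw]]] := span_frac_integral n_gt0 hST W1 WM W0 PX1 Rr.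
set w := ev c * r in qw; have Rw : Rspan w by apply: RM.
have RwX m : Rspan (w ^+ m) by exact: RX.
have Rhorner (q' : {poly {poly K}}) : Rspan (map_poly ev q').[w].
  rewrite horner_coef; apply: Rsum => i _; apply: RM => //.
  by rewrite coef_map; exact: span_ev.
(* The power w^i is reduced to w by [divR_pow], applied to w (1 - w e). *)
suff [i [e [Re we]]] : exists i e, Rspan e /\ divR (w ^+ i * (1 - w * e)).
  have R1we : Rspan (1 - w * e).
    by apply: RB => //; exact: RM.
  have [y Ry wy] : divR (w * (1 - w * e)).
    apply: (@divR_pow _ i.+1); first exact: RM.
    rewrite (_ : _ ^+ _ = w * (1 - w * e) ^+ i * (w ^+ i * (1 - w * e))).
      by apply: divR_mul => //; apply: RM => //; exact: RX.
    by rewrite exprMn !exprS; ring.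
  exists (ev c * e), (y / ev c); split.
  - exact: RM.
  - by apply: RM => //; exact: span_evV.
  have c0 : ev c != 0 by rewrite (ev_eq0 hST) W0.
  by apply: (mulIf c0); rewrite -[RHS]mulrA divfK // -wy /w; ring.
(* Constant coefficients of q are peeled off: one divisible by P is dropped at the cost of a further
   factor w, and the first one prime to P is invertible and yields e. Such a coefficient exists
   because q is monic. *)
have : divR (w ^+ 0 * (map_poly ev q).[w]).
  by rewrite qw mulr0; exists 0; rewrite ?mulr0 //; exact: R0.
have : exists i, away q`_i.
  by exists (size q).-1; rewrite -lead_coefE (monicP mq).
move: 0%N; elim/poly_ind: q {mq qw} => [|q a IH] i [j].
  by rewrite coef0 /away dvdp0.
rewrite rmorphD rmorphM /= map_polyX map_polyC /= hornerD hornerM hornerX hornerC.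
move=> Wj d; have [Pa|nPa] := boolP (P %| a).
  apply: (IH i.+1).
    case: j Wj => [|j]; rewrite coefD coefMX coefC /= ?add0r ?addr0; first by rewrite /away Pa.
    by exists j.
  rewrite exprSr -mulrA [w * _]mulrC -[_ * (_ * w)]addr0 -[X in _ + X](subrr (w ^+ i * ev a)).
  rewrite addrA -mulrDr; apply: divRD => //; rewrite -mulrN -rmorphN.
  apply: divR_mul => //; have /dvdpP[b ->] := Pa.
  exists (ev (- b)); first exact: span_ev.
  by rewrite -mulNr rmorphM mulrC.
exists i, (- ((map_poly ev q).[w] / ev a)); split.
  by apply: RN; apply: RM => //; exact: span_evV.
rewrite mulrN opprK; have a0 : ev a != 0 by rewrite (ev_eq0 hST) W0.
rewrite (_ : _ * _ = (ev a)^-1 * (w ^+ i * ((map_poly ev q).[w] * w + ev a))).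
  by apply: divR_mul => //; exact: span_evV.
by field.
Qed.

Let span_denom z : exists2 c, c != 0 & Rspan (ev c * z).
Proof.
pose Q z := exists2 c, c != 0 & Rspan (ev c * z).
have [c [Ec ->]] := span_setT n_gt0 hST z; apply: (big_ind Q).
- by exists 1; rewrite ?oner_neq0 // mulr0; exact: R0.
- move=> x y [a a0 Ra] [b b0 Rb]; exists (a * b); first by rewrite mulf_neq0.
  rewrite mulrDr rmorphM; apply: RD.
    by rewrite mulrAC mulrC; apply: RM => //; exact: span_ev.
  by rewrite -mulrA; apply: RM => //; exact: span_ev.
move=> j _; have [a [b [b0 ->]]] := Ec j; exists b => //.
rewrite mulrA [ev b * _]mulrC divfK ?(ev_eq0 hST) //; apply: RM => //.
exact/RX/(span_S n_gt0 hST W1 WM W0 PX1).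
Qed.

Section Place.
Variable O : subring_set F.
Hypotheses (tO : forall z, O z \/ O z^-1) (RO : forall z, Rspan z -> O z).
Hypothesis mpi : val_ideal O pi.

Let unit_away c : away c -> val_unit O (ev c).
Proof.
move=> Wc; split; first by rewrite (ev_eq0 hST) W0.
  exact/RO/span_ev.
exact/RO/span_evV.
Qed.

Let val_ev c : c != 0 -> exists k : nat, val_eq O pi (ev c) k%:Z.
Proof.
elim: {c}(size c) {-2}c (leqnn (size c)) => [|m IH] c sc c0.
  by move: sc c0; rewrite leqn0 size_poly_eq0 => ->.
have [/dvdpP[b cE]|Wc] := boolP (P %| c); last first.
  by exists 0%N; exact/val_eq_unit/unit_away.
move: sc c0; rewrite cE mulf_eq0 negb_or => sc /andP[b0 _].
have [|k vk] := IH b _ b0.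
  move: sc; rewrite size_mul //; case: irrP => sP _.
  by move: (size b) (size P) sP => x y; lia.
by exists k.+1; rewrite rmorphM intS addrC; apply: val_eqM => //; exact: val_eqx.
Qed.

Let loc z := exists a b, [/\ Rspan a, Rspan b, val_unit O b & z = a / b].

(** [loc] is R localized at the centre of O. If its numerator a lies in the ideal, 1 - a e is a unit
    of O, so a (1 - a e) = pi y of [span_regular] shows that pi divides a there. *)
Let loc_div z : loc z -> val_ideal O z -> exists2 y, loc y & z = pi * y.
Proof.
move=> [a [b [Ra Rb ub ->]]] mz.
have ma : val_ideal O a.
  have [b0 Ob _] := ub; rewrite -(divfK b0 a) mulrC; exact: val_idealM.
have [e [y [Re Ry ae]]] := span_regular Ra.
have u1 : val_unit O (1 - a * e).
  apply: val_unitDideal => //; first exact: val_unit1.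
  by apply: val_idealN => //; rewrite mulrC; apply: val_idealM => //; exact: RO.
exists (y / ((1 - a * e) * b)).
  exists y, ((1 - a * e) * b); split=> //; last exact: val_unitM.
  apply: RM => //; apply: RB; first exact: R1.
  exact: RM.
have [b0 _ _] := ub; have [n0 _ _] := u1.
by rewrite mulrA -ae invfM mulrA mulfK.
Qed.

(** Up to a factor from K[u], z is in R, and z divides some pi^k in O because z^-1 also has a
    denominator in K[u]. Division by pi as in [loc_div] thus stops after at most k steps. *)
Lemma unramified_param : val_param O pi.
Proof.
have loc_val k z : loc z -> z != 0 -> O (pi ^+ k / z) -> exists l, val_eq O pi z l.
  elim: k z => [|k IH] z lz z0 Oz.
    exists 0; apply: val_eq_unit; split=> //; last by rewrite -[z^-1]mul1r.
    by have [a [b [Ra Rb [_ _ Ob] ->]]] := lz; apply: subring_setM => //; exact: RO.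
  have Oz' : O z by have [a [b [Ra Rb [_ _ Ob] ->]]] := lz; apply: subring_setM => //; exact: RO.
  have [uz | mz] := val_unit_or_ideal Oz'; first by exists 0; exact: val_eq_unit.
  have [y ly zE] := loc_div lz mz.
  have y0 : y != 0 by apply: contraNneq z0 => y0; rewrite zE y0 mulr0.
  have [|l vl] := IH y ly y0; last by exists (1 + l); rewrite zE; apply: val_eqM => //;
    exact: val_eqx.
  by move: Oz; rewrite zE exprS invfM mulrACA mulfV // mul1r.
move=> z z0; have [c c0 Rz] := span_denom z.
have ec0 : ev c != 0 by rewrite (ev_eq0 hST).
have r0 : ev c * z != 0 by rewrite mulf_neq0.
have [d d0 Rd] := span_denom (ev c * z)^-1.
have [k vk] := val_ev d0; have [m vm] := val_ev c0.
have [|||l vl] := loc_val k (ev c * z) => //.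
- exists (ev c * z), 1; split; rewrite ?divr1 //; exact: val_unit1.
- have [_ _ Ov] := vk; rewrite invfM invrK in Ov.
  rewrite (_ : _ / _ = (ev d)^-1 * pi ^+ k * (ev d / (ev c * z))).
    by apply: subring_setM => //; exact: RO.
  by field; rewrite ec0 z0 (ev_eq0 hST).
exists (l - m%:Z); rewrite -(mulKf ec0 z) mulrC.
by apply: val_eqM => //; exact: val_eqV.
Qed.

End Place.

(* A valuation ring of F containing R[1/g] but not g exists unless g is integral
   over R, and then a power of [ev P * g] vanishes modulo [ev P]. *)
Lemma span_integrally_closed g : Rspan (pi * g) ->
    (forall O : subring_set F, (forall z, O z \/ O z^-1) ->
       (forall z, Rspan z -> O z) -> val_ideal O pi -> O g) ->
  Rspan g.
Proof.
move=> Rg Og; have [-> | g0] := eqVneq g 0; first exact: R0.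
have [B [RsubB [Bg BP]]] := subring_polyext R g^-1.
suff [y Ry e] : divR (pi * g) by rewrite (mulfI pi0 e).
have [/BP[q Bq gE] | nBg] := pselect (B g); last first.
  have [||O [BO nO tO]] := @chevalley F B g^-1 => //; first by rewrite invrK.
  case: (nO); rewrite invrK; apply: Og => // [z Rz|]; first exact/BO/RsubB.
  split; first exact/BO/RsubB/span_ev.
  move=> _ Opi; apply: nO; rewrite invrK -(mulKf pi0 g); apply: subring_setM => //.
  exact/BO/RsubB.
set s := size q; apply: (@divR_pow _ s.+1) => //.
have -> : (pi * g) ^+ s.+1 = pi * \sum_(i < s) q`_i * (pi * g) ^+ (s - i) * pi ^+ i.
  rewrite exprS -mulrA; congr (_ * _).
  rewrite {1}gE horner_coef mulr_suml; apply: eq_bigr => i _.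
  rewrite -!mulrA; congr (_ * _).
  have -> : (pi * g) ^+ s = (pi * g) ^+ (s - i) * (pi * g) ^+ i.
    by rewrite -exprD subnK // ltnW.
  rewrite mulrCA.
  by congr (_ * _); rewrite [in LHS]exprMn mulrCA -exprMn mulVf // expr1n mulr1.
exists (\sum_(i < s) q`_i * (pi * g) ^+ (s - i) * pi ^+ i) => //.
apply: Rsum => i _; apply: RM.
  apply: RM; last exact: RX.
  by have /asboolP := polyOverP Bq i.
exact/RX/span_ev.
Qed.

End UnramifiedPlace.

(** * Places and holomorphic differentials *)

(* The symmetry X -> Y -> Z -> X of X^n Y + Y^n Z + Z^n X = 0 permutes the three
   places over u = 0, -1, oo cyclically. *)
Section Cyclic.
Variables (n : nat) (K F : fieldType) (iota : {rmorphism K -> F}) (S T : F).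
Hypotheses (n_gt0 : (0 < n)%N) (hST : hurwitz_gen n iota S T).

Local Notation u := (hurwitz_u n S T).
Let S0 : S != 0 := hurwitz_neq0 hST.
Let T0 : T != 0 := hurwitz_T_neq0 hST.
Let u0 : u != 0 := hurwitz_u_neq0 hST.

(** With S = X / Z and T = Y / Z the symmetry sends (S, T) to (T / S, 1 / S). On u it is the Moebius
    map taking -1 to 0, 0 to oo and oo to -1. *)
Lemma hurwitz_u_cyc : hurwitz_u n (T / S) S^-1 = - (1 + u) / u.
Proof.
apply: (mulIf u0); rewrite divfK //; apply: (mulIf S0).
have Tn : T ^+ n = T ^+ n.-1 * T by rewrite -exprSr prednK.
rewrite mulNr -(hurwitz_Tn n_gt0 hST) Tn /hurwitz_u exprMn exprVn.
by field; rewrite S0 expf_neq0.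
Qed.

Lemma hurwitz_gen_cyc : hurwitz_gen n iota (T / S) S^-1.
Proof.
split.
- have := hurwitz_Tn n_gt0 hST => e; have eS := hurwitz_Sn S T n_gt0.
  rewrite exprMn !exprVn e; have {}eS : u = S ^+ n * T / S by rewrite eS mulrC mulKf.
  by rewrite eS; field; rewrite S0 expf_neq0.
- by rewrite mulf_neq0 ?invr_eq0.
- rewrite -/(hurwitz_u n (T / S) S^-1) hurwitz_u_cyc => alg; apply: (hurwitz_trans hST).
  rewrite -/u (_ : u = - (1 + - (1 + u) / u)^-1).
    apply/algebraic_opp/algebraic_inv/algebraic_add => //; exact: algebraic1.
  have -> : 1 + - (1 + u) / u = - u^-1 by field.
  by rewrite invrN invrK opprK.
apply/seteqP; split=> // z _ L hL sub; have [KL LB LV] := hL.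
have L1 : L 1 by rewrite -(rmorph1 iota); apply: KL; exists 1.
have LS' : L S^-1 by apply: sub; right.
have : adjoin iota [set S; T] z by rewrite (hurwitz_adjoin hST).
apply=> // _ [->|->].
  by rewrite -[S]invrK -div1r; exact: LV.
rewrite -(divfK S0 T) -[S in _ * S]invrK; apply: LV => //.
by apply: sub; left.
Qed.

Lemma frac_cyc z : frac n iota S T (@nonzero K) z ->
  frac n iota (T / S) S^-1 (@nonzero K) z.
Proof.
set v := hurwitz_u n (T / S) S^-1; have hv := hurwitz_gen_cyc.
have nz1 : @nonzero K 1 by exact: oner_neq0.
have nzM a b : @nonzero K a -> nonzero b -> nonzero (a * b) by exact: mulf_neq0.
pose E := frac_ring hv nz1 nzM (fun a (h : nonzero a) => h).
have EV x : E x -> E x^-1.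
  move=> [a [c [c0 ->]]]; have [-> | a0] := eqVneq a 0.
    by rewrite rmorph0 mul0r invr0; exact: (subring_set0 E).
  by exists c, a; rewrite invfM invrK mulrC.
have Eu : E u.
  have -> : u = - (1 + v)^-1.
    have -> : 1 + v = - u^-1 by rewrite /v hurwitz_u_cyc; field.
    by rewrite invrN invrK opprK.
  apply/(@subring_setN _ E)/EV; apply: (@subring_setD _ E); first exact: (subring_set1 E).
  by exists 'X, 1; rewrite evX rmorph1 divr1.
have Eev a : E (ev iota u a).
  elim/poly_ind: a => [|a c IH]; first by rewrite rmorph0; exact: (subring_set0 E).
  rewrite rmorphD rmorphM /= evX evC; apply: (@subring_setD _ E);
    first exact: (@subring_setM _ E _ _ IH Eu).
  by exists c%:P, 1; rewrite evC rmorph1 divr1.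
by move=> [a [c [_ ->]]]; apply: (@subring_setM _ E) => //; exact: EV.
Qed.

End Cyclic.

Section RamifiedParameter.
Variables (n : nat) (K F : fieldType) (iota : {rmorphism K -> F}) (S T : F).
Hypotheses (n_gt0 : (0 < n)%N) (hST : hurwitz_gen n iota S T).
Variable p : nat.
Hypotheses (charF : p \in [pchar F]) (pN : ~~ (p %| hurwitz_degree n)%N).

Local Notation N := (hurwitz_degree n).
Local Notation u := (hurwitz_u n S T).

Let N0 : N%:R != 0 :> F. Proof. exact: natr_p_neq0 pN. Qed.
Let T0 : T != 0 := hurwitz_T_neq0 hST.

(** The quotient du / dT, from [hurwitz_der]. *)
Definition hurwitz_theta := N%:R * u * (1 + u) / (T * (1 + n%:R * u)).

Variable O : subring_set F.
Hypotheses (tO : forall z, O z \/ O z^-1) (KO : forall c, O (iota c)).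
Hypothesis mu : val_ideal O u.

Let unit_1nu : val_unit O (1 + n%:R * u).
Proof.
apply: val_unitDideal => //; first exact: val_unit1.
by apply: val_idealM => //; exact: subring_set_nat.
Qed.

Lemma ram_der (D : derivation iota) : D u = hurwitz_theta * D T.
Proof.
have d0 : T * (1 + n%:R * u) != 0 by case: unit_1nu => d0 _ _; rewrite mulf_neq0.
by apply: (mulfI d0); rewrite (hurwitz_der n_gt0 hST) [RHS]mulrA [_ * hurwitz_theta]mulrC divfK.
Qed.

(** Tame ramification: N is a unit because p does not divide it, so only u / T contributes. *)
Lemma ram_theta : val_eq O T hurwitz_theta (N%:Z - 1).
Proof.
have uN : val_unit O N%:R.
  split=> //; first exact: subring_set_nat.
  by rewrite -(rmorph_nat iota) -fmorphV.
have -> : N%:Z - 1 = 0 + N%:Z + 0 + - (1 + 0) by ring.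
apply: val_eqM => //.
  apply: val_eqM => //; last exact/val_eq_unit/(ram_1u_unit tO mu).
  by apply: val_eqM => //; [exact: val_eq_unit | exact: (ram_u n_gt0 hST tO mu)].
by apply/val_eqV/val_eqM => //; [exact: val_eqx | exact: val_eq_unit].
Qed.

End RamifiedParameter.

(* The data at the three totally ramified places: the valuations [s], [r] and
   [m] of [S], of [u] and of [du / dx] for the local parameter [x]. *)
Record ramified_place (n : nat) (K F : fieldType) (iota : {rmorphism K -> F})
    (S T : F) (O : subring_set F) (s r m : int) (x theta : F) : Prop := RamifiedPlace {
  place_total : forall z, O z \/ O z^-1;
  place_const : forall c, O (iota c);
  place_neq0 : x != 0;
  place_ideal : val_ideal O x;
  place_param : val_param O x;
  place_der : forall D : derivation iota, D (hurwitz_u n S T) = theta * D x;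
  place_frac : forall z, frac n iota S T (@nonzero K) z -> z != 0 ->
    exists k : int, val_eq O x z ((hurwitz_degree n)%:Z * k);
  place_S : val_eq O x S s;
  place_u : val_eq O x (hurwitz_u n S T) r;
  place_theta : val_eq O x theta m }.

(** * The places over u = 0, -1, oo *)

Section ThreePlaces.
Variables (n : nat) (K F : fieldType) (iota : {rmorphism K -> F}) (S T : F).
Hypotheses (n_gt0 : (0 < n)%N) (hST : hurwitz_gen n iota S T).
Variable p : nat.
Hypotheses (charF : p \in [pchar F]) (pN : ~~ (p %| hurwitz_degree n)%N).

Local Notation N := (hurwitz_degree n).
Local Notation u := (hurwitz_u n S T).
Let S0 : S != 0 := hurwitz_neq0 hST.
Let T0 : T != 0 := hurwitz_T_neq0 hST.
Let u0 : u != 0 := hurwitz_u_neq0 hST.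
Let u1 : 1 + u != 0 := hurwitz_1u_neq0 hST.

Variable O : subring_set F.
Hypotheses (tO : forall z, O z \/ O z^-1) (KO : forall c, O (iota c)).

Lemma place0 : val_ideal O u ->
  exists x theta, ramified_place n iota S T O n%:Z N%:Z (N%:Z - 1) x theta.
Proof.
move=> mu; exists T, (hurwitz_theta n S T); split=> //.
- exact: (ram_T_ideal n_gt0 hST).
- exact: (ram_param n_gt0 hST).
- by move=> D; exact: (ram_der n_gt0 hST).
- by move=> z; exact: (ram_frac n_gt0 hST).
- exact: (ram_S n_gt0 hST).
- exact: (ram_u n_gt0 hST).
- exact: (ram_theta n_gt0 hST charF).
Qed.

Let h1 := hurwitz_gen_cyc n_gt0 hST.
Let v := hurwitz_u n (T / S) S^-1.
Let vE : v = - (1 + u) / u := hurwitz_u_cyc n_gt0 hST.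

Lemma place1 : val_ideal O (1 + u) ->
  exists x theta, ramified_place n iota S T O (- 1) 0 (N%:Z - 1) x theta /\
    val_eq O x (1 + u) N%:Z.
Proof.
move=> mu1.
have uu : val_unit O u.
  rewrite -[u](addKr 1); apply: val_unitDideal => //.
  exact/val_unitN/val_unit1.
have mv : val_ideal O v.
  rewrite vE mulrC; apply: val_idealM; last exact: val_idealN.
  by case: uu.
have S0' : S^-1 != 0 by rewrite invr_eq0.
(* The factor u^2 is du / dv, since v = - 1 - 1 / u. *)
exists S^-1, (u ^+ 2 * hurwitz_theta n (T / S) S^-1); split; last first.
  have -> : 1 + u = - v * u by rewrite mulNr vE divfK // opprK.
  rewrite -[N%:Z]addr0; apply: val_eqM => //; last exact: val_eq_unit.
  exact/val_eqN/(ram_u n_gt0 h1).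
split=> //.
- exact: (ram_T_ideal n_gt0 h1).
- exact: (ram_param n_gt0 h1).
- move=> D; rewrite -mulrA -(ram_der n_gt0 h1 tO mv) -/v vE mulNr derN (derM D (1 + u)) derV
    derD der1.
  by field.
- by move=> z Ez; apply: (ram_frac n_gt0 h1) => //; exact: frac_cyc.
- by rewrite -[S in val_eq _ _ S]invrK; apply: val_eqV; exact: val_eqx.
- exact: val_eq_unit.
- rewrite -[N%:Z - 1]add0r; apply: val_eqM => //; last exact: (ram_theta n_gt0 h1 charF pN).
  exact/val_eq_unit/val_unitX.
Qed.

Let h2 := hurwitz_gen_cyc n_gt0 h1.
Let w := hurwitz_u n (S^-1 / (T / S)) (T / S)^-1.
Let wE : w = - (1 + v) / v := hurwitz_u_cyc n_gt0 h1.

Lemma place2 : val_ideal O u^-1 ->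
  exists x theta, ramified_place n iota S T O (1 - n%:Z) (- N%:Z) (- N%:Z - 1) x theta.
Proof.
move=> mu'.
have uE : u = - (1 + w) / w by rewrite wE vE; field;
  rewrite u0 oppr_eq0 u1 (_ : u - _ = - 1) ?opprK ?oner_eq0 //; ring.
have u1' : val_unit O (1 + u^-1) by apply: val_unitDideal => //; exact: val_unit1.
have wE' : w = - (1 + u^-1)^-1 * u^-1.
  have u1n : 1 + u^-1 != 0 by case: u1'.
  by rewrite wE vE; field; rewrite u0 oppr_eq0 addrC u1.
have mw : val_ideal O w.
  by rewrite wE'; apply: val_idealM => //; rewrite -invrN; case: (val_unitN u1').
have w0 : w != 0 by rewrite wE' mulf_neq0 ?oppr_eq0 ?invr_eq0 //; case: u1'.
set x := (T / S)^-1; have x0 : x != 0 by rewrite invr_eq0 mulf_neq0 ?invr_eq0.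
have xw : val_eq O x w N%:Z by exact: (ram_u n_gt0 h2).
have xS : val_eq O x (S^-1 / (T / S)) n%:Z by exact: (ram_S n_gt0 h2).
have xx : val_eq O x x 1 by exact: val_eqx.
(* The factor w^(-2) is du / dw, since u = - 1 - 1 / w; it accounts for the change of valuation by -
   2 N. *)
exists x, (w^-1 ^+ 2 * hurwitz_theta n (S^-1 / (T / S)) x); split=> //.
- exact: (ram_T_ideal n_gt0 h2).
- exact: (ram_param n_gt0 h2).
- move=> D; rewrite -mulrA -(ram_der n_gt0 h2 tO mw) -/w [in D u]uE mulNr derN (derM D (1 + w))
    derV derD der1.
  by field.
- move=> z Ez; apply: (ram_frac n_gt0 h2) => //.
  by apply: frac_cyc => //; exact: frac_cyc.
- rewrite (_ : S = x / (S^-1 / (T / S))).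
    by apply: val_eqM => //; exact: val_eqV.
  by rewrite /x; field; rewrite S0 T0 oner_eq0.
- rewrite uE mulNr; apply: val_eqN; rewrite -[- _]add0r; apply: val_eqM => //.
    exact/val_eq_unit/(ram_1u_unit tO mw).
  exact: val_eqV.
- have -> : - N%:Z - 1 = - N%:Z * 2%:Z + (N%:Z - 1) by ring.
  apply: val_eqM => //; last exact: (ram_theta n_gt0 h2 charF pN).
  exact/val_eqX/val_eqV.
Qed.

Lemma val_ideal_cyc1 : val_ideal O v -> val_ideal O (1 + u).
Proof.
move=> mv; have : val_unit O (1 + v) by apply: val_unitDideal => //; exact: val_unit1.
have -> : 1 + v = - u^-1 by rewrite vE; field.
move=> /val_unitN; rewrite opprK => /val_unitV; rewrite invrK => -[_ Ou _].
have -> : 1 + u = - u * v by rewrite mulNr vE mulrC divfK // opprK.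
by apply: val_idealM => //; exact: subring_setN.
Qed.

Lemma val_ideal_cyc2 : val_ideal O w -> val_ideal O u^-1.
Proof.
move=> mw; have uE : u = - (1 + w) / w.
  by rewrite wE vE; field; rewrite u0 oppr_eq0 u1 (_ : u - _ = - 1) ?opprK ?oner_eq0 //; ring.
have [_ _ Ow] : val_unit O (1 + w) by apply: val_unitDideal => //; exact: val_unit1.
rewrite uE invfM invrK invrN; apply: val_idealM => //.
exact: subring_setN.
Qed.

End ThreePlaces.

Section PlacesExist.
Variables (n : nat) (K F : fieldType) (iota : {rmorphism K -> F}) (S T : F).
Hypotheses (n_gt0 : (0 < n)%N) (hST : hurwitz_gen n iota S T).

Local Notation u := (hurwitz_u n S T).

Lemma exists_place1 : exists O : subring_set F,
  [/\ forall z, O z \/ O z^-1, forall c, O (iota c) & val_ideal O (1 + u)].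
Proof.
have [O [tO KO mu]] := exists_ram_place (hurwitz_gen_cyc n_gt0 hST).
by exists O; split=> //; exact: (val_ideal_cyc1 n_gt0 hST).
Qed.

Lemma exists_place2 : exists O : subring_set F,
  [/\ forall z, O z \/ O z^-1, forall c, O (iota c) & val_ideal O u^-1].
Proof.
have [O [tO KO mu]] := exists_ram_place (hurwitz_gen_cyc n_gt0 (hurwitz_gen_cyc n_gt0 hST)).
by exists O; split=> //; exact: (val_ideal_cyc2 n_gt0 hST).
Qed.

End PlacesExist.

Lemma exists_irreducible_factor (K : fieldType) (c : {poly K}) : (1 < size c)%N ->
  exists2 P, irreducible_poly P & P %| c.
Proof.
elim: {c}(size c) {-2}c (leqnn (size c)) => [|m IH] c sc c1.
  by move: c1; rewrite ltnNge (leq_trans sc).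
have [irr|] := pselect (irreducible_poly c); first by exists c; rewrite ?dvdpp.
move=> nirr; have [q [sq qc nqc]] : exists q : {poly K}, [/\ size q != 1%N, q %| c & ~~ (q %= c)].
  apply: contrapT => nq; apply: nirr; split=> // q sq qc; apply/negPn/negP => nqc.
  by apply: nq; exists q.
have c0 : c != 0 by rewrite -size_poly_gt0 ltnW.
have q0 : q != 0 by apply: contraTneq qc => ->; rewrite dvd0p.
have sqc : (size q < size c)%N.
  by rewrite ltn_neqAle dvdp_leq // andbT (dvdp_size_eqp qc).
have [|P irrP Pq] := IH q (leq_trans sqc sc).
  by rewrite ltn_neqAle eq_sym sq size_poly_gt0.
by exists P => //; exact: dvdp_trans qc.
Qed.

(** * Classification of the valuation rings *)

Section ValuationRings.
Variables (n : nat) (K F : fieldType) (iota : {rmorphism K -> F}) (S T : F).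
Hypotheses (n_gt0 : (0 < n)%N) (hST : hurwitz_gen n iota S T).

Local Notation N := (hurwitz_degree n).
Local Notation u := (hurwitz_u n S T).
Local Notation ev := (ev iota u).

Lemma valuation_ring_subring (A : set F) : valuation_ring iota A ->
  exists O : subring_set F, [/\ A = O, forall z, O z \/ O z^-1,
    forall c, O (iota c) & exists y, ~ O y].
Proof.
move=> [[KA _] [_ AT] Aring Atot].
have A1 : A 1 by rewrite -(rmorph1 iota); apply: KA; exists 1.
exists (SubringSet A1 (fun x y Ax Ay => (Aring x y Ax Ay).1) (fun x y Ax Ay => (Aring x y Ax
    Ay).2)).
split=> // [c|]; first by apply: KA; exists c.
by apply: contrapT => nA; apply: AT => y _; apply: contrapT => Ay; apply: nA; exists y.
Qed.

Lemma subring_valuation_ring (O : subring_set F) y : (forall z, O z \/ O z^-1) ->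
  (forall c, O (iota c)) -> ~ O y -> valuation_ring iota O.
Proof.
move=> tO KO Oy; split=> //.
- split=> [_ [c _ <-]|OK]; first exact: KO.
  have nK z : ~ algebraicOver iota z -> ~ O z.
    by move=> nz /OK[c _ cz]; apply: nz; rewrite -cz; exact: algebraic_id.
  have [] := tO u; first exact/nK/(hurwitz_trans hST).
  by apply: nK => /algebraic_inv; rewrite invrK; exact: (hurwitz_trans hST).
- by split=> [|OT]; [exact: subsetT | apply/Oy/OT].
- by move=> a b Oa Ob; split; [exact: subring_setB | exact: subring_setM].
Qed.

Section Cases.
Variable O : subring_set F.
Hypotheses (tO : forall z, O z \/ O z^-1) (KO : forall c, O (iota c)).

Lemma ev_val_ring a : O u -> O (ev a).
Proof.
move=> Ou; elim/poly_ind: a => [|a c IH]; first by rewrite rmorph0; exact: subring_set0.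
rewrite rmorphD rmorphM /= evX evC; apply: subring_setD => //; exact: subring_setM.
Qed.

Lemma span_val_ring (W : {poly K} -> Prop) : val_unit O u -> val_unit O (1 + u) ->
  (forall c, W c -> val_unit O (ev c)) -> forall z, span n iota S T W z -> O z.
Proof.
move=> uu uu1 uW z [c [Ec ->]].
have uSN : val_unit O (S ^+ N).
  by rewrite (hurwitz_SN n_gt0 hST); apply/val_unitN/val_unitM/val_unitV => //; exact: val_unitX.
have OS : O S.
  apply: contrapT => nOS; have mS := val_idealVN tO nOS.
  case: (val_unit_not_ideal (val_unitV uSN)).
  rewrite hurwitz_degreeE -exprVn exprSr; apply: val_idealM => //.
  by apply: subring_setX; case: mS.
apply: subring_set_sum => j _; apply: subring_setM; last exact: subring_setX.
have [a [b [Wb ->]]] := Ec j; apply: subring_setM; last by case: (uW _ Wb).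
by apply: ev_val_ring; case: uu.
Qed.

Lemma val_unit_away P c : O u -> irreducible_poly P -> val_ideal O (ev P) ->
  away P c -> val_unit O (ev c).
Proof.
move=> Ou irrP mP Pc; have Oev a := ev_val_ring a Ou.
have c0 : c != 0 by apply: contraNneq Pc => ->; rewrite /away dvdp0.
have /Bezout_eq1_coprimepP[[a b] /= ab] : coprimep P c by rewrite irreducible_poly_coprime.
have : val_unit O (ev b * ev c).
  rewrite -rmorphM -(addKr (a * P) (b * c)) ab addrC rmorphB rmorph1 rmorphM /=.
  apply: val_unitDideal => //; first exact: val_unit1.
  exact/val_idealN/val_idealM.
move=> [bc0 _ Obc]; split=> //; first by rewrite (ev_eq0 hST).
move: bc0; rewrite mulf_eq0 negb_or => /andP[b0 _].
by rewrite -(mulVKf b0 (ev c)^-1) -invfM; exact: subring_setM.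
Qed.

(** If u and 1 + u are units, some nonzero polynomial in u lies in the ideal: otherwise O would
    contain K(u), hence S, hence all of F. One of least size is irreducible. *)
Lemma valuation_cases y : ~ O y ->
  [\/ val_ideal O u, val_ideal O (1 + u), val_ideal O u^-1
  | O u /\ exists P, [/\ irreducible_poly P, ~~ (P %| 'X), ~~ (P %| 'X + 1),
      forall z, span n iota S T (away P) z -> O z & val_ideal O (ev P)]].
Proof.
move=> Oy; have [Ou | /(val_idealVN tO) mu'] := pselect (O u); last by constructor 3.
have [uu | mu] := val_unit_or_ideal Ou; last by constructor 1.
have [uu1 | mu1] := val_unit_or_ideal (subring_setD (subring_set1 O) Ou); last by constructor 2.
constructor 4; have Oev a := ev_val_ring a Ou.
pose Q m := exists2 c, c != 0 /\ val_ideal O (ev c) & size c = m.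
have exQ : exists m, `[< Q m >].
  apply: contrapT => nQ; apply: Oy.
  apply: (@span_val_ring (@nonzero K)) => // [c c0|]; last exact: (span_setT n_gt0 hST).
  have [//|mc] := val_unit_or_ideal (Oev c).
  by case: nQ; exists (size c); apply/asboolP; exists c.
case: (ex_minnP exQ) => m /asboolP[P [P0 mP] sP] min_m.
have {}min_m c : c != 0 -> val_ideal O (ev c) -> (size P <= size c)%N.
  by move=> c0 mc; rewrite sP; apply: min_m; apply/asboolP; exists c.
have idealM a b : val_ideal O (ev (a * b)) -> val_ideal O (ev a) \/ val_ideal O (ev b).
  rewrite rmorphM => mab; have [ua|] := val_unit_or_ideal (Oev a); last by left.
  have [ub|] := val_unit_or_ideal (Oev b); last by right.
  by case: (val_unit_not_ideal (val_unitM ua ub)).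
have irrP : irreducible_poly P.
  split=> [|q sq /dvdpP[r PE]].
    rewrite ltnNge; apply/negP => /size1_polyC PC.
    have c0 : P`_0 != 0 by apply: contraNneq P0 => c0; rewrite PC c0.
    case: mP => _; rewrite PC evC fmorph_eq0 => /(_ c0); apply.
    by rewrite -fmorphV.
  have /andP[r0 q0] : (r != 0) && (q != 0) by rewrite -negb_or -mulf_eq0 -PE.
  have qP : q %| P by rewrite PE dvdp_mull.
  rewrite -(dvdp_size_eqp qP) eqn_leq dvdp_leq //=.
  have [mr|mq] : val_ideal O (ev r) \/ val_ideal O (ev q) by apply: idealM; rewrite -PE.
    have := min_m r r0 mr; rewrite {1}PE size_mul //.
    by move: sq r0 q0; rewrite -!size_poly_gt0; move: (size q) (size r) => a b; lia.
  exact: min_m.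
have uaway c : away P c -> val_unit O (ev c) by exact: val_unit_away.
split=> //; exists P; split=> //.
- by apply/negP => /dvdpP[q /(congr1 ev)]; rewrite evX rmorphM /= => uE;
  case: (val_unit_not_ideal uu); rewrite uE; exact: val_idealM.
- apply/negP => /dvdpP[q /(congr1 ev)]; rewrite evXD1 rmorphM /= => uE.
  by case: (val_unit_not_ideal uu1); rewrite uE; exact: val_idealM.
- exact: span_val_ring.
Qed.

End Cases.
End ValuationRings.

(** * Holomorphy at a single place *)

Section LocalHolomorphy.
Variables (K F : fieldType) (iota : {rmorphism K -> F}) (u : F).

Definition holomorphic_at (O : set F) g := exists x h,
  [/\ uniformizer O x, O h & g *: d u = h *: d x :> differential iota].

Lemma holomorphicE g : separating iota u ->
  holomorphic (g *: d u : differential iota) <->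
  forall O, valuation_ring iota O -> holomorphic_at O g.
Proof. by move=> su; split=> [[]//|hg]; split=> //; exists g, u. Qed.

Lemma holomorphic_atM (O : subring_set F) f g :
  O f -> holomorphic_at O g -> holomorphic_at O (f * g).
Proof.
move=> Of [x [h [ux Oh e]]]; exists x, (f * h); split=> //; first exact: subring_setM.
by rewrite -!scalerA e.
Qed.

Variable p : nat.
Hypotheses (charF : p \in [pchar F]) (span_u : pspan charF u).
Variable Du : derivation iota.
Hypothesis Du1 : Du u = 1.

Let p_gt0 : (0 < p)%N := prime_gt0 (pcharf_prime charF).

(* In y = sum_i y_i^p x^i the terms have distinct valuations, so that y in O
   forces y_i in O, and the derivation d/dx maps O to itself. *)
Lemma holomorphic_at_param (O : subring_set F) x theta g :
    (forall z, O z \/ O z^-1) -> x != 0 -> val_ideal O x -> val_param O x ->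
    (forall D : derivation iota, D u = theta * D x) ->
  holomorphic_at O g <-> O (g * theta).
Proof.
move=> tO x0 mx px thetaE; split; last first.
  move=> Ogt; exists x, (g * theta); split=> //; first exact: val_param_uniformizer.
  by apply/funext => D; rewrite !diffE thetaE mulrA.
move=> [y [h [uy Oh e]]].
have Oy : O y.
  have : [set y * z | z in O] y by exists 1; [exact: subring_set1 | rewrite mulr1].
  by rewrite -uy => -[].
have thetaDx : theta * Du x = 1 by rewrite -thetaE.
have Dx : Du x != 0 by apply: contra_eq_neq thetaDx => ->; rewrite mulr0 eq_sym oner_neq0.
have ix := der_pindep (charF := charF) Dx; have sx := pspan_exchange span_u ix.
have [q sq yE] := pspan_small sx y.
have Oq i : O q`_i.
  have [ip | pi] := ltnP i p; last first.
    by rewrite nth_default ?(leq_trans sq) //; exact: subring_set0.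
  have /choice[k kE] (j : 'I_p) : exists k, q`_j != 0 -> val_eq O x q`_j k.
    by have [_|/px[k vk]] := eqVneq q`_j 0; [exists 0 | exists k].
  pose c (j : 'I_p) := (map_poly (pFrobenius_aut charF) q)`_j * x ^+ j.
  have cE (j : 'I_p) : q`_j != 0 -> val_eq O x (c j) (p%:Z * k j + j%:Z).
    move=> qj; rewrite /c coef_map /= pFrobenius_autE; apply: val_eqM => //.
      by rewrite [p%:Z * _]mulrC; exact/val_eqX/kE.
    by rewrite -[j%:Z]mul1r; exact/val_eqX/val_eqx.
  have [||Oc _ _] := @val_sum_mod F O x p c (fun j => j%:Z) tO x0 mx.
  - move=> j cj; exists (k j); apply: cE; move: cj.
    by rewrite /c coef_map mulf_eq0 negb_or fmorph_eq0 => /andP[].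
  - by move=> i' j ij; apply: (@coprime_mod_inj p 1) => //; [exact: coprimen1 | rewrite !mul1r].
  have Osum : O (\sum_j c j).
    by move: Oy; rewrite yE (@horner_coef_wide _ p) ?size_map_poly.
  have := Oc Osum (Ordinal ip).
  have [-> _|qi Oci] := eqVneq q`_i 0; first exact: subring_set0.
  apply/(val_eqO x0 mx (kE (Ordinal ip) qi)).
  move/(val_eqO x0 mx (cE (Ordinal ip) qi)): Oci => /=.
  by move: (k (Ordinal ip)) => k' hk; move: ip p_gt0 hk; clear; nia.
pose eta := (map_poly (pFrobenius_aut charF) q^`()).[x].
have Oeta : O eta.
  rewrite /eta horner_coef; apply: subring_set_sum => i _; apply: subring_setM.
    rewrite coef_map /= pFrobenius_autE; apply: subring_setX; rewrite coef_deriv -mulr_natr.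
    by apply: subring_setM => //; exact: subring_set_nat.
  by apply: subring_setX; case: mx.
have Dy : Du y = eta * Du x by rewrite [in LHS]yE der_Frob.
have gE : g = h * Du y.
  by have := congr1 (fun w : differential iota => w Du) e; rewrite /= !diffE Du1 mulr1.
rewrite gE Dy -!mulrA [Du x * _]mulrC thetaDx mulr1; exact: subring_setM.
Qed.

End LocalHolomorphy.

(* The integral ceiling of n j / N, that is, the largest e such that S^j u^(-e) du
   has no pole over u = 0. *)
Definition hurwitz_exp (n j : nat) := ((n * j + (hurwitz_degree n).-1) %/ hurwitz_degree n)%N.

(* S^j u^(-e) du has no pole over u = oo. *)
Definition admissible (n j : nat) :=
  (n.-1 * j + hurwitz_degree n < hurwitz_degree n * hurwitz_exp n j)%N.

Lemma hurwitz_exp_bounds n j :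
  (n * j <= hurwitz_degree n * hurwitz_exp n j <= n * j + (hurwitz_degree n).-1)%N.
Proof.
rewrite /hurwitz_exp; set N := hurwitz_degree n; set k := (_ + _)%N.
have N_gt0 : (0 < N)%N by rewrite /N hurwitz_degreeE.
have := divn_eq k N; have := ltn_pmod k N_gt0.
by rewrite [(N * _)%N]mulnC /k; move: (_ %/ _)%N (_ %% _)%N => a b; lia.
Qed.

(** * Monomial differentials and their orders at all places *)

Section HolomorphicDifferentials.
Variables (n : nat) (K F : fieldType) (iota : {rmorphism K -> F}) (S T : F).
Hypotheses (n_gt0 : (0 < n)%N) (hST : hurwitz_gen n iota S T).
Variable p : nat.
Hypotheses (charF : p \in [pchar F]) (pN : ~~ (p %| hurwitz_degree n)%N).
Hypothesis perfK : forall c : K, exists k, c = k ^+ p.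

Local Notation N := (hurwitz_degree n).
Local Notation u := (hurwitz_u n S T).
Local Notation ev := (ev iota u).
Local Notation e := (hurwitz_exp n).
Let S0 : S != 0 := hurwitz_neq0 hST.
Let u0 : u != 0 := hurwitz_u_neq0 hST.
Let span_u : pspan charF u := hurwitz_pspan n_gt0 hST charF pN perfK.
Let indep_u : pindep charF u := hurwitz_pindep n_gt0 hST pN.

Variable Du : derivation iota.
Hypothesis Du1 : Du u = 1.

Definition hurwitz_mono (j : nat) := S ^+ j * (u ^+ e j)^-1.
Local Notation M := hurwitz_mono.

Lemma hurwitz_mono_neq0 j : M j != 0.
Proof. by rewrite mulf_neq0 ?invr_eq0 ?expf_neq0. Qed.

Lemma frac_monoP c j : frac n iota S T (@nonzero K) c ->
  exists d, frac n iota S T (@nonzero K) d /\ c * M j = d * S ^+ j.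
Proof.
move=> [a [b [b0 ->]]]; exists (ev a / ev (b * 'X ^+ e j)); split.
  exists a, (b * 'X^(e j)); split=> //.
  by rewrite /nonzero mulf_neq0 // expf_neq0 // polyX_eq0.
rewrite /M rmorphM rmorphXn /= evX; field.
by rewrite expf_neq0 // (ev_eq0 hST).
Qed.

Lemma hurwitz_mono_indep (c : 'I_N -> F) :
    (forall j, frac n iota S T (@nonzero K) (c j)) ->
  \sum_j c j * M j = 0 -> forall j, c j = 0.
Proof.
move=> Ec s0 j; have /choice[d dE] (i : 'I_N) := frac_monoP i (Ec i).
have d0 i : d i = 0.
  move: i; apply: (hurwitz_indep n_gt0 hST) => [i|]; first by case: (dE i).
  by rewrite -[RHS]s0; apply: eq_bigr => i _; case: (dE i).
have [_ /eqP] := dE j; rewrite d0 mul0r mulf_eq0 (negPf (hurwitz_mono_neq0 _)) orbF.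
by move/eqP.
Qed.

Lemma hurwitz_separating : separating iota u.
Proof.
by apply: (separating_gen (charF := charF)) => //;
  [exact: (ev_inj0 hST) | exact: (hurwitz_alg n_gt0 hST)].
Qed.

Section Place.
Variables (O : subring_set F) (s m rho : int) (x theta : F).
Hypothesis place : ramified_place n iota S T O s (N%:Z * rho) m x theta.
Hypothesis coprime_s : coprime N `|s|%N.

Lemma place_holomorphic g : holomorphic_at iota u O g <-> O (g * theta).
Proof.
apply: (holomorphic_at_param span_u Du1).
- exact: (place_total place).
- exact: (place_neq0 place).
- exact: (place_ideal place).
- exact: (place_param place).
- exact: (place_der place).
Qed.

Lemma place_mono c k j : val_eq O x c (N%:Z * k) ->
  val_eq O x (c * M j * theta) (N%:Z * k + (s * j%:Z - N%:Z * rho * (e j)%:Z) + m).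
Proof.
have x0 := place_neq0 place; move=> vc.
apply: val_eqM => //; last exact: (place_theta place).
apply: val_eqM => //; apply: val_eqM => //; first exact/val_eqX/(place_S place).
by apply: val_eqV; exact/val_eqX/(place_u place).
Qed.

(** The order of the j-th term is s j + m modulo N with s prime to N, so there is no cancellation
    and each term is holomorphic at this place. *)
Lemma place_terms (c : 'I_N -> F) : (forall j, frac n iota S T (@nonzero K) (c j)) ->
    holomorphic_at iota u O (\sum_j c j * M j) ->
  forall j k, val_eq O x (c j) (N%:Z * k) ->
    0 <= N%:Z * k + (s * j%:Z - N%:Z * rho * (e j)%:Z) + m.
Proof.
move=> Ec /place_holomorphic; rewrite mulr_suml => Os j k vk.
apply/(val_eqO (place_neq0 place) (place_ideal place) (place_mono j vk)).
have [||Oc _ _] := @val_sum_mod F O x N (fun j => c j * M j * theta) (fun j => s * j%:Z + m)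
  (place_total place) (place_neq0 place) (place_ideal place).
- move=> i ci; have ci0 : c i != 0 by apply: contraNneq ci => ->; rewrite !mul0r.
  have [l vl] := place_frac place (Ec i) ci0.
  exists (l - rho * (e i)%:Z).
  have := place_mono i vl; congr (val_eq _ _ _ _); ring.
- move=> i1 i2 /eqP; rewrite eqz_modDr => /eqP; exact: coprime_mod_inj.
exact: (Oc Os).
Qed.

End Place.

Lemma holomorphic_at_place (O : subring_set F) s m rho x theta j :
    ramified_place n iota S T O s (N%:Z * rho) m x theta ->
    0 <= s * j%:Z - N%:Z * rho * (e j)%:Z + m ->
  holomorphic_at iota u O (M j).
Proof.
move=> pl h; apply/(place_holomorphic pl); rewrite -[M j]mul1r.
have v1 : val_eq O x 1 (N%:Z * 0) by rewrite mulr0; exact/val_eq_unit/val_unit1.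
apply/(val_eqO (place_neq0 pl) (place_ideal pl) (place_mono pl j v1)).
by rewrite mulr0 add0r.
Qed.

Let charK : p \in [pchar K].
Proof. by rewrite -(fmorph_pchar iota). Qed.

(** The local parameter is P(u), and d P(u) = P'(u) du, where P'(u) is a unit of O because P' is
    nonzero of smaller degree than P. *)
Lemma unramified_holomorphic (O : subring_set F) P g :
    (forall z, O z \/ O z^-1) -> (forall c, O (iota c)) -> O u ->
    irreducible_poly P -> ~~ (P %| 'X) -> ~~ (P %| 'X + 1) ->
    (forall z, span n iota S T (away P) z -> O z) -> val_ideal O (ev P) ->
  holomorphic_at iota u O g <-> O g.
Proof.
move=> tO KO Ou irrP PX PX1 RO mP.
have P0 := irredp_neq0 irrP; have eP0 : ev P != 0 by rewrite (ev_eq0 hST).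
have dP0 : P^`() != 0 := irreducible_deriv_neq0 charK perfK irrP.
have [d0 Od Od'] : val_unit O (ev P^`()).
  apply: (val_unit_away hST tO KO Ou irrP mP).
  apply/negP => /(dvdp_leq dP0); rewrite leqNgt lt_size_deriv //.
rewrite (@holomorphic_at_param _ _ _ _ _ charF span_u _ Du1 O (ev P) (ev P^`())^-1) //.
- split=> [Og|Og]; last exact: subring_setM.
  by rewrite -(divfK d0 g); exact: subring_setM.
- exact: (unramified_param n_gt0 hST charF pN).
- by move=> D; rewrite der_ev mulKf.
Qed.

(** The orders over u = 0, -1, oo are n j - N e + N - 1, N - 1 - j and (1 - n) j + N e - N - 1:
    nonnegative by the choice of the ceiling e, by j < N and by admissibility. Elsewhere S and u^-1
    are regular. *)
Lemma hurwitz_mono_holomorphic (j : 'I_N) : admissible n j ->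
  holomorphic (M j *: d u : differential iota).
Proof.
move=> adm; apply/holomorphicE; first exact: hurwitz_separating.
move=> A /valuation_ring_subring[O [-> tO KO [y Oy]]].
have eb := hurwitz_exp_bounds n j; have jN := ltn_ord j.
have NE := hurwitz_degreeE n.
have [mu|mu|mu|[Ou [P [irrP PX PX1 RO mP]]]] := valuation_cases n_gt0 hST tO KO Oy.
- have [x [theta pl]] := place0 n_gt0 hST charF pN tO KO mu.
  rewrite -[X in ramified_place _ _ _ _ _ _ X _ _ _]mulr1 in pl.
  apply: (holomorphic_at_place pl).
  by move: eb jN; rewrite mulr1; clear; lia.
- have [x [theta [pl _]]] := place1 n_gt0 hST charF pN tO KO mu.
  rewrite -[X in ramified_place _ _ _ _ _ _ X _ _ _](mulr0 N%:Z) in pl.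
  apply: (holomorphic_at_place pl).
  by move: jN; rewrite mulr0 mul0r; clear; lia.
- have [x [theta pl]] := place2 n_gt0 hST charF pN tO KO mu.
  rewrite -[X in ramified_place _ _ _ _ _ _ X _ _ _]mulrN1 in pl.
  apply: (holomorphic_at_place pl).
  move: adm; rewrite /admissible mulrN1.
  move: (e j) (nat_of_ord j) => k l; move: (N) n_gt0 => N'; clear.
  by case: (n) => // m _ /=; nia.
apply/(unramified_holomorphic _ tO KO Ou irrP PX PX1 RO mP).
have [[W1 WM] W0] := (away1 irrP, awayM irrP, @away_neq0 _ P).
apply: subring_setM; first exact/subring_setX/RO/(span_S n_gt0 hST W1 WM W0 PX1).
rewrite -exprVn; apply/subring_setX/RO/(frac_span n_gt0 hST W1 WM W0 PX1).
by exists 1, 'X; rewrite evX rmorph1 div1r.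
Qed.

End HolomorphicDifferentials.

(** * Every holomorphic differential is a combination of admissible monomials *)

Section Spanning.
Variables (n : nat) (K F : fieldType) (iota : {rmorphism K -> F}) (S T : F).
Hypotheses (n_gt0 : (0 < n)%N) (hST : hurwitz_gen n iota S T).
Variable p : nat.
Hypotheses (charF : p \in [pchar F]) (pN : ~~ (p %| hurwitz_degree n)%N).
Hypothesis perfK : forall c : K, exists k, c = k ^+ p.

Local Notation N := (hurwitz_degree n).
Local Notation u := (hurwitz_u n S T).
Local Notation ev := (ev iota u).
Local Notation e := (hurwitz_exp n).
Local Notation M := (hurwitz_mono n S T).
Let N_gt0 : (0 < N)%N. Proof. by rewrite hurwitz_degreeE. Qed.
Let u0 : u != 0 := hurwitz_u_neq0 hST.

Variable Du : derivation iota.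
Hypothesis Du1 : Du u = 1.

(** Places over u = oo are left out so that the property survives multiplication by polynomials in
    u, by which denominators are cleared. *)
Definition holomorphic_affine g := forall O : subring_set F,
  (forall z, O z \/ O z^-1) -> (forall c, O (iota c)) -> (exists y, ~ O y) ->
  O u -> holomorphic_at iota u O g.

Let ideal_proper (O : subring_set F) z : z != 0 -> val_ideal O z -> exists y, ~ O y.
Proof. by move=> z0 [_ /(_ z0)]; exists z^-1. Qed.

Let frac_ev_div a P : P != 0 -> frac n iota S T (@nonzero K) (ev a / ev P).
Proof. by move=> P0; exists a, P. Qed.

(** Monomials have order below N at this place, and a factor P in the denominator lowers the order
    by N. A term in which P does not cancel would thus have a pole. *)
Let pole_removal_place (O : subring_set F) s m rho x theta P (b : 'I_N -> {poly K}) :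
    ramified_place n iota S T O s (N%:Z * rho) m x theta -> coprime N `|s|%N ->
    O u -> irreducible_poly P -> val_eq O x (ev P) N%:Z ->
    (forall j : 'I_N, s * j%:Z - N%:Z * rho * (e j)%:Z + m < N%:Z) ->
    holomorphic_at iota u O (\sum_j ev (b j) / ev P * M j) ->
  forall j, P %| b j.
Proof.
move=> pl cs Ou irrP vP bnd hol j; apply: contraT => Pb.
have P0 := irredp_neq0 irrP; have tO := place_total pl.
have mP : val_ideal O (ev P).
  by apply: (val_eq_ideal (place_neq0 pl) (place_ideal pl) vP).
have ub := val_unit_away hST tO (place_const pl) Ou irrP mP Pb.
have Ec i := frac_ev_div (b i) P0.
have vj : val_eq O x (ev (b j) / ev P) (N%:Z * (- 1)).
  rewrite mulrN1 -[- _]add0r; apply: val_eqM; first exact: (place_neq0 pl).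
    exact: val_eq_unit.
  exact: val_eqV.
have := place_terms n_gt0 hST charF pN perfK Du1 pl cs Ec hol vj.
by move: (bnd j); rewrite mulrN1; move: (s * _) (N%:Z * rho * _) => A B; clear; lia.
Qed.

(** For P other than X and X + 1 no term-by-term valuation argument is available. Instead g is
    regular wherever P(u) vanishes, so it lies in the ring at P by [span_integrally_closed], and its
    coefficients are compared. *)
Lemma pole_removal P (b : 'I_N -> {poly K}) : irreducible_poly P ->
    [\/ P = 'X, P = 'X + 1 | ~~ (P %| 'X) /\ ~~ (P %| 'X + 1)] ->
    holomorphic_affine (\sum_j ev (b j) / ev P * M j) ->
  forall j, P %| b j.
Proof.
move=> irrP; have P0 := irredp_neq0 irrP; have eP0 : ev P != 0 by rewrite (ev_eq0 hST).
case=> [PE|PE|[PX PX1]] hol.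
- have [O [tO KO mu]] := exists_ram_place hST; have [Ou _] := mu.
  have [x [theta pl]] := place0 n_gt0 hST charF pN tO KO mu.
  have vu := place_u pl; rewrite -[X in ramified_place _ _ _ _ _ _ X _ _ _]mulr1 in pl.
  apply: (pole_removal_place pl _ Ou irrP).
  + by rewrite coprime_sym; exact: coprime_hurwitz_degree.
  + by rewrite PE evX.
  + move=> j; have := hurwitz_exp_bounds n j; rewrite mulr1.
    by move: (e j) (nat_of_ord j) N_gt0 => k l; move: (N) => N'; clear; lia.
  + exact: hol (ideal_proper u0 mu) Ou.
- have [O [tO KO mu]] := exists_place1 n_gt0 hST.
  have Ou : O u.
    by rewrite -[u](addKr 1); apply: subring_setD; [exact/subring_setN/subring_set1 | case: mu].
  have [x [theta [pl v1]]] := place1 n_gt0 hST charF pN tO KO mu.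
  rewrite -[X in ramified_place _ _ _ _ _ _ X _ _ _](mulr0 N%:Z) in pl.
  apply: (pole_removal_place pl _ Ou irrP).
  + exact: coprimen1.
  + by rewrite PE evXD1.
  + move=> j; rewrite mulr0 mul0r.
    by move: (nat_of_ord j) N_gt0 => l; move: (N) => N'; clear; lia.
  + exact: hol (ideal_proper (hurwitz_1u_neq0 hST) mu) Ou.
have [[W1 WM] W0] := (away1 irrP, awayM irrP, @away_neq0 _ P).
pose R := span_ring n_gt0 hST W1 WM W0 PX1.
set g := \sum_j _ in hol *.
have Ru' : R u^-1.
  apply: (frac_span n_gt0 hST W1 WM W0 PX1).
  by exists 1, 'X; rewrite evX rmorph1 div1r.
have Rg : span n iota S T (away P) (ev P * g).
  rewrite mulr_sumr; apply: (subring_set_sum (B := R)) => j _.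
  rewrite mulrA [ev P * _]mulrC divfK //; apply: (@subring_setM _ R).
    exact/(frac_span n_gt0 hST W1 WM W0 PX1)/frac_ev.
  apply: (@subring_setM _ R); last by rewrite -exprVn; exact: (@subring_setX _ R).
  exact/(@subring_setX _ R)/(span_S n_gt0 hST W1 WM W0 PX1).
have [d [Ed gE]] : span n iota S T (away P) g.
  apply: (span_integrally_closed n_gt0 hST charF pN irrP PX PX1 Rg) => O tO RO mP.
  have KO c : O (iota c).
    by rewrite -(evC iota u); apply/RO/(frac_span n_gt0 hST W1 WM W0 PX1)/frac_ev.
  have Ou : O u.
    by rewrite -(evX iota u); apply/RO/(frac_span n_gt0 hST W1 WM W0 PX1)/frac_ev.
  apply/(unramified_holomorphic n_gt0 hST charF pN perfK Du1 g tO KO Ou irrP PX PX1 RO mP).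
  exact: hol (ideal_proper eP0 mP) Ou.
have E0 j : ev (b j) / ev P * (u ^+ e j)^-1 - d j = 0.
  move: j; apply: (hurwitz_indep n_gt0 hST) => [j|].
    have nz1 : @nonzero K 1 by exact: oner_neq0.
    have nzM a c : @nonzero K a -> nonzero c -> nonzero (a * c) by exact: mulf_neq0.
    pose E := frac_ring hST nz1 nzM (fun a (h : nonzero a) => h).
    apply: (@subring_setB _ E); last exact: frac_nonzero (Ed j).
    apply: (@subring_setM _ E); first exact: frac_ev_div.
    exists 1, ('X ^+ e j); rewrite rmorphXn /= evX rmorph1 div1r; split=> //.
    by rewrite /nonzero expf_neq0 // polyX_eq0.
  rewrite -[RHS](subrr g) {2}gE /g -sumrB; apply: eq_bigr => i _.
  by rewrite mulrBl mulrAC -mulrA.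
move=> j; have [a [c [Wc dE]]] := Ed j.
have c0 : ev c != 0 by rewrite (ev_eq0 hST) W0.
have : ev (b j * c - P * a * 'X ^+ e j) = 0.
  have /eqP := E0 j; rewrite subr_eq0 => /eqP bE.
  have ue : u ^+ e j != 0 by rewrite expf_neq0.
  rewrite rmorphB !rmorphM rmorphXn /= evX.
  have -> : ev a = ev (b j) / ev P / u ^+ e j * ev c by rewrite bE dE divfK.
  by field; rewrite ue eP0.
move/(ev_inj0 hST)/eqP; rewrite subr_eq0 => /eqP bc.
have : P %| b j * c by rewrite bc -mulrA dvdp_mulr.
by rewrite irreducible_dvdp_mul // (negPf Wc) orbF.
Qed.

Let common_denominator (f : 'I_N -> F) : (forall j, frac n iota S T (@nonzero K) (f j)) ->
  exists c (b : 'I_N -> {poly K}), c != 0 /\ forall j, f j = ev (b j) / ev c.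
Proof.
move=> Ef; have /choice[a aE] (j : 'I_N) : exists a : {poly K} * {poly K},
    a.2 != 0 /\ f j = ev a.1 / ev a.2.
  by have [a [c [c0 ->]]] := Ef j; exists (a, c).
exists (\prod_j (a j).2), (fun j => (a j).1 * \prod_(i | i != j) (a i).2); split.
  by rewrite prodf_seq_neq0; apply/allP => j _; case: (aE j).
move=> j; have [aj0 ->] := aE j; rewrite [X in _ = _ / ev X](bigD1 j) //= !rmorphM /=.
have p0 : ev (\prod_(i | i != j) (a i).2) != 0.
  by rewrite (ev_eq0 hST) prodf_seq_neq0; apply/allP => i _; apply/implyP; case: (aE i).
by field; rewrite p0 (ev_eq0 hST).
Qed.

(** Induction on the size of a common denominator c: an irreducible factor P of c divides every
    numerator, by [pole_removal] applied to (c / P) g. *)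
Lemma holomorphic_affine_span g : holomorphic_affine g ->
  exists b : 'I_N -> {poly K}, g = \sum_j ev (b j) * M j.
Proof.
have [f [Ef ->]] := span_setT n_gt0 hST g.
have /common_denominator[c [b [c0 bE]]] j : frac n iota S T (@nonzero K) (f j * u ^+ e j).
  have [a [c [c0 ->]]] := Ef j; exists (a * 'X^(e j)), c; split=> //.
  by rewrite rmorphM rmorphXn /= evX mulrAC.
have -> : \sum_j f j * S ^+ j = \sum_j ev (b j) / ev c * M j.
  apply: eq_bigr => j _; rewrite -bE /hurwitz_mono -!mulrA; congr (_ * _).
  by rewrite mulrCA mulfV ?mulr1 // expf_neq0.
elim: {c}(size c) {-2}c (leqnn (size c)) c0 b {bE} => [|m IH] c sc c0 b hol.
  by move: sc c0; rewrite leqn0 size_poly_eq0 => ->.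
have [/size1_polyC cC | c1] := leqP (size c) 1.
  exists (fun j => (c`_0)^-1 *: b j); apply: eq_bigr => j _.
  by rewrite -mul_polyC rmorphM /= evC fmorphV {1}cC evC [ev (b j) * _]mulrC.
have [P [irrP Pc Pcase]] : exists P, [/\ irreducible_poly P, P %| c
    & [\/ P = 'X, P = 'X + 1 | ~~ (P %| 'X) /\ ~~ (P %| 'X + 1)]].
  have irrX : irreducible_poly ('X : {poly K}) by rewrite -['X]subr0; exact: irredp_XsubC.
  have irrX1 : irreducible_poly ('X + 1 : {poly K}) by exact: irredp_XaddC.
  have [Xc|nXc] := boolP ('X %| c); first by exists 'X; split=> //; constructor 1.
  have [X1c|nX1c] := boolP ('X + 1 %| c); first by exists ('X + 1); split=> //; constructor 2.
  have [P irrP Pc] := exists_irreducible_factor c1; exists P; split=> //; constructor 3.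
  have sP : size P != 1%N by case: irrP => sP _; rewrite neq_ltn sP orbT.
  split; apply/negP => PX.
    by move/negP: nXc; apply; rewrite -(eqp_dvdl _ (irrX.2 P sP PX)).
  by move/negP: nX1c; apply; rewrite -(eqp_dvdl _ (irrX1.2 P sP PX)).
have /dvdpP[c' cE] := Pc; have P0 := irredp_neq0 irrP.
have c'0 : c' != 0 by apply: contraNneq c0 => c'0; rewrite cE c'0 mul0r.
have eP0 : ev P != 0 by rewrite (ev_eq0 hST).
have ec0 : ev c' != 0 by rewrite (ev_eq0 hST).
have Pb : forall j, P %| b j.
  apply: (pole_removal irrP Pcase) => O tO KO pO Ou.
  have -> : \sum_j ev (b j) / ev P * M j = ev c' * \sum_j ev (b j) / ev c * M j.
    rewrite mulr_sumr; apply: eq_bigr => j _; rewrite cE rmorphM mulrA; congr (_ * _).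
    by field; rewrite eP0 ec0.
  by apply: holomorphic_atM; [exact: ev_val_ring | exact: hol].
have /choice[q qE] j : exists q, b j = q * P by apply/dvdpP.
have gE : \sum_j ev (b j) / ev c * M j = \sum_j ev (q j) / ev c' * M j.
  apply: eq_bigr => j _; rewrite cE qE !rmorphM; congr (_ * _).
  by field; rewrite eP0 ec0.
rewrite gE in hol *; apply: (IH c') => //.
move: sc; rewrite cE size_mul //; case: irrP => sP _.
by move: (size c') (size P) sP; clear; lia.
Qed.

Lemma val_ev_infinity (O : subring_set F) x a :
    (forall z, O z \/ O z^-1) -> (forall c, O (iota c)) ->
    x != 0 -> val_ideal O x -> val_eq O x u (N%:Z * (- 1)) -> a != 0 ->
  val_eq O x (ev a) (N%:Z * - (size a).-1%:Z).
Proof.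
move=> tO KO x0 mx vu; elim/poly_ind: a => [|a c IH]; first by rewrite eqxx.
have [-> | a0 _] := eqVneq a 0.
  rewrite mul0r add0r polyC_eq0 size_polyC => c0; rewrite c0 /= oppr0 mulr0 evC.
  by apply: val_eq_unit; split; rewrite ?fmorph_eq0 // -fmorphV.
rewrite size_MXaddC (negPf a0) /= rmorphD rmorphM /= evX evC.
have vau : val_eq O x (ev a * u) (N%:Z * - (size a)%:Z).
  have -> : N%:Z * - (size a)%:Z = N%:Z * - (size a).-1%:Z + N%:Z * (- 1).
    by rewrite -mulrDr -{1}(prednK (_ : 0 < size a)%N) ?size_poly_gt0 // intS; ring.
  by apply: val_eqM => //; exact: IH.
have au0 := val_eq_neq0 vau.
have -> : ev a * u + iota c = (ev a * u) * (1 + iota c * (ev a * u)^-1).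
  by rewrite mulrDr mulr1; congr (_ + _); rewrite mulrC divfK.
rewrite -[_ * - _]addr0; apply: val_eqM => //; apply/val_eq_unit/val_unitDideal => //.
  exact: val_unit1.
apply: val_idealM => //; apply: (val_eq_ideal x0 mx (val_eqV vau)).
by rewrite mulrN opprK pmulr_rgt0 ?ltz_nat // size_poly_gt0.
Qed.

Theorem holomorphic_span g : holomorphic (g *: d u : differential iota) ->
  exists k : 'I_N -> K, (forall j : 'I_N, ~~ admissible n j -> k j = 0) /\
    g = \sum_j iota (k j) * M j.
Proof.
move=> /holomorphicE hol.
have {}hol O := hol (hurwitz_separating n_gt0 hST charF pN perfK) O.
have [b gE] : exists b : 'I_N -> {poly K}, g = \sum_j ev (b j) * M j.
  apply: holomorphic_affine_span => O tO KO [y Oy] _.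
  exact/hol/(subring_valuation_ring hST tO KO Oy).
have [O [tO KO mu]] := exists_place2 n_gt0 hST.
have u'0 : u^-1 != 0 by rewrite invr_eq0.
have [y Oy] := ideal_proper u'0 mu.
have [x [theta pl]] := place2 n_gt0 hST charF pN tO KO mu.
rewrite -[X in ramified_place _ _ _ _ _ _ X _ _ _]mulrN1 in pl.
have Ec j : frac n iota S T (@nonzero K) (ev (b j)).
  by exists (b j), 1; rewrite rmorph1 divr1; split=> //; exact: oner_neq0.
have hO := hol _ (subring_valuation_ring hST tO KO Oy); rewrite gE in hO.
have cs : coprime N `|(1 - n%:Z : int)|%N.
  rewrite (_ : `|_|%N = n.-1); last by move: n_gt0; clear; lia.
  by rewrite coprime_sym coprime_pred_hurwitz_degree.
(* For b j of degree d the order over u = oo is - N d + (1 - n) j + N e - N - 1. As N e <= n j + N -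
   1, it is at most j - 2 - N d, negative unless d = 0; for d = 0 its nonnegativity is
   admissibility. *)
have key j : b j != 0 -> (size (b j) <= 1)%N /\ admissible n j.
  move=> bj0.
  have vj := val_ev_infinity tO KO (place_neq0 pl) (place_ideal pl) (place_u pl) bj0.
  have := place_terms n_gt0 hST charF pN perfK Du1 pl cs Ec hO vj.
  have := hurwitz_exp_bounds n j; rewrite /admissible.
  move: (ltn_ord j) bj0; rewrite -size_poly_gt0.
  move: (size (b j)) (e j) (nat_of_ord j) => s k l; move: (N) n_gt0 => N'; clear.
  case: n => // m _; case: s => // -[|s] lN _ /andP[_ kl] h; first by move: lN kl h; nia.
  have : N'%:Z <= N'%:Z * s.+1%:Z by nia.
  by move: lN kl h => /=; nia.
exists (fun j => (b j)`_0); split=> [j|].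
  have [-> | /key[_ ->]//] := eqVneq (b j) 0; first by rewrite coef0.
rewrite gE; apply: eq_bigr => j _; congr (_ * _).
have [->|/key[/size1_polyC {1}-> _]] := eqVneq (b j) 0; last by rewrite evC.
by rewrite coef0 !rmorph0.
Qed.

End Spanning.

(** * Exact holomorphic differentials *)

(** Let f = N e - n j and f' = N e' - n j' be the rounding errors, between 0 and N - 1; then j is
    admissible when f + j >= N + 1. With A = p e' - (n q + e) one has N A = p f' - f and N (A + q) =
    p (f' + j') - (f + j). For admissible j, N + 1 <= f + j <= 2 N - 2, so f' + j' <= N gives A + q
    < p - 1 and f' + j' > N gives A + q > p - 2. *)
Lemma frobenius_exponents (n p j j' q : nat) (e := hurwitz_exp n j) (e' := hurwitz_exp n j')
    (N := hurwitz_degree n) : (0 < n)%N -> (0 < p)%N -> (j < N)%N -> (j' < N)%N ->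
    (p * j' = j + N * q)%N ->
  [/\ (n * q + e <= p * e')%N, (p * e' - (n * q + e) < p)%N, (q < p)%N
    & admissible n j -> (p.-1 <= p * e' - (n * q + e) + q)%N = admissible n j'].
Proof.
move=> n_gt0 p_gt0 jN j'N pj'.
have := hurwitz_exp_bounds n j; have := hurwitz_exp_bounds n j'.
rewrite /admissible -/e -/e' -/N; move: e e' => e e'.
have N_gt0 : (0 < N)%N by rewrite /N hurwitz_degreeE.
move: N N_gt0 jN j'N pj' => N N_gt0 jN j'N pj' /andP[lo' hi'] /andP[lo hi].
pose A : int := p%:Z * e'%:Z - (n%:Z * q%:Z + e%:Z).
pose f : int := N%:Z * e%:Z - n%:Z * j%:Z; pose f' : int := N%:Z * e'%:Z - n%:Z * j'%:Z.
have f_bounds : 0 <= f <= N%:Z - 1 by rewrite /f; apply/andP; split; nia.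
have f'_bounds : 0 <= f' <= N%:Z - 1 by rewrite /f'; apply/andP; split; nia.
have pj'Z : p%:Z * j'%:Z = j%:Z + N%:Z * q%:Z by move: pj'; nia.
have NA : N%:Z * A = p%:Z * f' - f.
  have e1 : n%:Z * (p%:Z * j'%:Z) = n%:Z * (j%:Z + N%:Z * q%:Z) by rewrite pj'Z.
  by rewrite /A /f /f'; move: e1; clear; nia.
have NAq : N%:Z * (A + q%:Z) = p%:Z * (f' + j'%:Z) - (f + j%:Z).
  by move: NA pj'Z; clear; nia.
have [/andP[f0 fN] /andP[f'0 f'N]] := (f_bounds, f'_bounds).
have A0 : 0 <= A.
  by rewrite leNgt; apply/negP => A0; move: NA f0 fN f'0 A0 N_gt0; clear; nia.
have Ap : A < p%:Z.
  by rewrite ltNge; apply/negP => A1; move: NA f0 fN f'N A1 N_gt0 p_gt0; clear; nia.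
have qp : (q < p)%N.
  by rewrite ltnNge; apply/negP => q1; move: pj' j'N q1 N_gt0 p_gt0; clear; nia.
have le : (n * q + e <= p * e')%N by move: A0; rewrite /A; clear; nia.
split=> //; first by move: Ap le; rewrite /A; clear; nia.
move=> adm; have AE : ((p * e' - (n * q + e))%N)%:Z = A by rewrite /A; move: le; clear; nia.
have fj : N%:Z + 1 <= f + j%:Z by rewrite /f; move: adm n_gt0; clear; case: n => // n; nia.
have -> : (n.-1 * j' + N < N * e')%N = (N%:Z + 1 <= f' + j'%:Z).
  by rewrite /f'; move: n_gt0; clear; case: n => // n _ /=; apply/idP/idP; nia.
have -> : (p.-1 <= p * e' - (n * q + e) + q)%N = (p%:Z - 1 <= A + q%:Z).
  by rewrite -AE; move: (p * e' - _)%N p_gt0 => a; clear => p0; apply/idP/idP; lia.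
move: (A + q%:Z) NAq => B NB; apply/idP/idP => h.
  rewrite leNgt; apply/negP => h'; move: NB h h' fj N_gt0 p_gt0; clear; nia.
rewrite leNgt; apply/negP => h'; move: NB h h' fN jN N_gt0 p_gt0; clear; nia.
Qed.

(** Only the exponents p - 1, 2 p - 1, .. have no antiderivative, and the size bound excludes all
    but the first. *)
Lemma deriv_decomposition (K : fieldType) (p : nat) (U : {poly K}) :
    p \in [pchar K] -> (size U <= p.*2.-1)%N ->
  exists V, U = V^`() + U`_(p.-1) *: 'X^(p.-1).
Proof.
move=> charK sU; have pr_p := pcharf_prime charK; have p_gt0 := prime_gt0 pr_p.
pose V := \poly_(i < p.*2) (if i == p then 0 else U`_i.-1 / i%:R).
exists V; apply/polyP=> i; rewrite coefD coef_deriv coefZ coefXn coef_poly /=.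
have [ip | ] := ltnP i.+1 p.*2; last first.
  move=> pi; rewrite nth_default; last by apply: leq_trans sU _; lia.
  by rewrite mul0rn add0r (_ : (i == p.-1) = false) ?mulr0 //; apply/eqP; move: pi p_gt0;
    clear; lia.
have [->|] := eqVneq i p.-1; first by rewrite prednK // eqxx mul0rn add0r mulr1.
move=> ne; rewrite (_ : (i.+1 == p) = false); last by apply/eqP; move: ne p_gt0; clear; lia.
rewrite mulr0n mulr0 addr0 -[RHS]mulr_natr divfK // -(dvdn_pcharf charK);
  apply/negP => /dvdnP[m im].
move: ne ip p_gt0; rewrite im; case: m im => [|[|m]] //= im; last by clear; nia.
by move: im; clear; lia.
Qed.

Section Exactness.
Variables (n : nat) (K F : fieldType) (iota : {rmorphism K -> F}) (S T : F).
Hypotheses (n_gt0 : (0 < n)%N) (hST : hurwitz_gen n iota S T).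
Variable p : nat.
Hypotheses (charF : p \in [pchar F]) (pN : ~~ (p %| hurwitz_degree n)%N).
Hypothesis perfK : forall c : K, exists k, c = k ^+ p.

Local Notation N := (hurwitz_degree n).
Local Notation u := (hurwitz_u n S T).
Local Notation ev := (ev iota u).
Local Notation e := (hurwitz_exp n).
Local Notation M := (hurwitz_mono n S T).
Let pr_p : prime p := pcharf_prime charF.
Let p_gt0 : (0 < p)%N := prime_gt0 pr_p.
Let u0 : u != 0 := hurwitz_u_neq0 hST.
Let charK : p \in [pchar K].
Proof. by rewrite -(fmorph_pchar iota). Qed.

Variable Du : derivation iota.
Hypothesis Du1 : Du u = 1.

(** Here S^(p j') = S^j (S^N)^q, and S^N is given by [hurwitz_SN]. *)
Lemma hurwitz_mono_Frobenius j j' q : (p * j' = j + N * q)%N ->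
    (n * q + e j <= p * e j')%N ->
  M j = (-1) ^+ q * (M j' ^+ p * ev ('X ^+ (p * e j' - (n * q + e j)) * ('X + 1) ^+ q)).
Proof.
move=> pj' le; have S0 := hurwitz_neq0 hST; have u1 := hurwitz_1u_neq0 hST.
have SX0 m : S ^+ m != 0 by rewrite expf_neq0.
have uX0 m : u ^+ m != 0 by rewrite expf_neq0.
have Sj : S ^+ (p * j') * (1 + u) ^+ q = (-1) ^+ q * S ^+ j * u ^+ (n * q).
  rewrite pj' exprD exprM (hurwitz_SN n_gt0 hST) [(- (_ / _)) ^+ q]exprNn expr_div_n [u ^+ (n *
      q)]exprM.
  by field; rewrite expf_neq0.
rewrite rmorphM !rmorphXn /= evX evXD1 /hurwitz_mono.
apply: (mulIf (uX0 (p * e j' + e j)%N)).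
have -> : (-1) ^+ q * ((S ^+ j' / u ^+ e j') ^+ p *
    (u ^+ (p * e j' - (n * q + e j)) * (1 + u) ^+ q)) * u ^+ (p * e j' + e j) =
    (-1) ^+ q * (S ^+ (p * j') * (1 + u) ^+ q) * u ^+ (p * e j' - (n * q + e j) + e j).
  rewrite exprMn exprVn -!exprM [(j' * p)%N]mulnC [(e j' * p)%N]mulnC !exprD.
  by field.
have s2 : (-1) ^+ q * (-1) ^+ q = 1 :> F by rewrite -exprMn mulrN1 opprK expr1n.
rewrite Sj; transitivity (S ^+ j * u ^+ (p * e j')); first by rewrite exprD; field.
have -> : u ^+ (p * e j') = u ^+ (n * q) * u ^+ (p * e j' - (n * q + e j) + e j).
  by rewrite -exprD; congr (_ ^+ _); move: le; clear; lia.
by rewrite -[LHS]mul1r -[X in X * _ = _]s2; ring.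
Qed.

Lemma coef_Xn_XD1n a q i : (a <= i)%N ->
  ('X^a * ('X + 1) ^+ q : {poly K})`_i = 'C(q, i - a)%:R.
Proof.
move=> ai; rewrite coefXnM ltnNge ai /= exprD1n coef_sum.
under eq_bigr do rewrite coefMn coefXn.
have [le|lt] := ltnP (i - a) q.+1.
  rewrite (bigD1 (Ordinal le)) //= eqxx big1 ?addr0 // => k.
  by rewrite -val_eqE /= eq_sym => /negPf->; rewrite mul0rn.
rewrite bin_small // big1 // => k _; rewrite (_ : (_ == _) = false) ?mul0rn //.
by apply/eqP => ik; move: (ltn_ord k); rewrite -ik ltnNge lt.
Qed.

Lemma size_Xn_XD1n a q : size ('X^a * ('X + 1) ^+ q : {poly K}) = (a + q).+1.
Proof.
have m : ('X + 1 : {poly K}) \is monic by exact: monicXaddC.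
rewrite size_Mmonic ?monic_exp // -?size_poly_eq0 ?size_polyXn //.
have := size_exp ('X + 1 : {poly K}) q.
have := monic_neq0 (monic_exp q m); rewrite -size_poly_gt0 size_XaddC /=.
by move: (size _) => s; clear; lia.
Qed.

Lemma natr_bin_neq0 q k : (k <= q)%N -> (q < p)%N -> 'C(q, k)%:R != 0 :> K.
Proof.
move=> kq qp; rewrite -(dvdn_pcharf charK); apply/negP => pC.
have : (p %| q`!)%N by rewrite -(bin_fact kq) dvdn_mulr.
apply/negP; elim: q qp {kq pC} => [|q IH] qp; first by rewrite dvdn1 gtn_eqF // prime_gt1.
by rewrite factS Euclid_dvdM // negb_or gtnNdvd // IH // ltnW.
Qed.

(** The sum is [Du Z + y ^+ p * u ^+ p.-1], hence exact if and only if y = 0. Here y combines the M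
    (tau j), independent as [tau] is injective, with coefficients the p-th roots of k_j beta_j up to
    sign; for admissible j, beta_j is nonzero exactly when tau j is admissible. *)
Theorem exact_hurwitz_mono (tau : 'I_N -> 'I_N) (k : 'I_N -> K) :
    (forall j : 'I_N, (p * tau j) %% N = j)%N ->
    (forall j : 'I_N, ~~ admissible n j -> k j = 0) ->
  exact_coef Du (\sum_j iota (k j) * M j) <->
  (forall j : 'I_N, admissible n j -> admissible n (tau j) -> k j = 0).
Proof.
move=> tauP kadm.
pose q (j : 'I_N) := (p * tau j %/ N)%N.
have pj (j : 'I_N) : (p * tau j = j + N * q j)%N.
  by rewrite {1}(divn_eq (p * tau j) N) tauP addnC mulnC.
pose a (j : 'I_N) := (p * e (tau j) - (n * q j + e j))%N.
have ex (j : 'I_N) := frobenius_exponents n_gt0 p_gt0 (ltn_ord j) (ltn_ord (tau j)) (pj j).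
pose U (j : 'I_N) : {poly K} := 'X^(a j) * ('X + 1) ^+ q j.
have sU j : (size (U j) <= p.*2.-1)%N.
  rewrite size_Xn_XD1n; have [_ ap qp _] := ex j; rewrite -/(a j) in ap.
  by move: (a j) (q j) ap qp => x y; clear; lia.
have /choice[V VE] j := deriv_decomposition charK (sU j).
pose beta j := (U j)`_(p.-1).
have beta_adm (j : 'I_N) : admissible n j -> (beta j != 0) = admissible n (tau j).
  move=> adm; have [_ ap qp /(_ adm) <-] := ex j; rewrite -/(a j) in ap *.
  rewrite /beta; case: leqP => h.
    rewrite coef_Xn_XD1n; last by move: ap; clear; lia.
    by rewrite natr_bin_neq0 //; move: h ap p_gt0; clear; lia.
  by rewrite nth_default ?eqxx // size_Xn_XD1n.
have /choice[kappa kE] j : exists c, k j * (-1) ^+ q j * beta j = c ^+ p by exact: perfK.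
pose y := \sum_j iota (kappa j) * M (tau j).
pose Z := \sum_j iota (k j * (-1) ^+ q j) * (M (tau j) ^+ p * ev (V j)).
have gE : \sum_j iota (k j) * M j = Du Z + y ^+ p * u ^+ p.-1.
  have -> : y ^+ p = \sum_j iota (k j * (-1) ^+ q j * beta j) * M (tau j) ^+ p.
    rewrite -(pFrobenius_autE charF) rmorph_sum; apply: eq_bigr => j _ /=.
    by rewrite pFrobenius_autE exprMn -rmorphXn -kE.
  rewrite mulr_suml der_sum -big_split; apply: eq_bigr => j _ /=.
  have [le _ _ _] := ex j.
  rewrite (hurwitz_mono_Frobenius (pj j) le) -/(a j) -/(U j) {1}(VE j).
  rewrite (derM Du (iota _)) derK mulr0 addr0 (derM Du (_ ^+ p)) (der_pexp charF) mulr0 addr0.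
  rewrite der_ev Du1 mulr1 rmorphD -mul_polyC rmorphM rmorphXn /= evC evX -/(beta j).
  by rewrite !rmorphM !rmorphXn !rmorphN1; ring.
have -> : exact_coef Du (\sum_j iota (k j) * M j) <-> y = 0.
  have Du0 : Du u != 0 by rewrite Du1 oner_neq0.
  pose x i := if i == p.-1 then y else 0.
  have xE : y ^+ p * u ^+ p.-1 = (\sum_(i < p) x i ^+ p * u ^+ i) * Du u.
    have pp : (p.-1 < p)%N by rewrite prednK.
    rewrite Du1 mulr1 (bigD1 (Ordinal pp)) //= /x eqxx big1 ?addr0 // => i.
    by rewrite -val_eqE /= => /negPf->; rewrite expr0n eqn0Ngt p_gt0 mul0r.
  have := exact_coefP (hurwitz_pspan n_gt0 hST charF pN perfK) x Du0.
  rewrite /x eqxx -/x => <-; rewrite -xE gE; split=> -[z zE].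
    by exists (z - Z); rewrite derD derN -zE addrC addKr.
  by exists (Z + z); rewrite derD zE.
have tau_inj : injective tau.
  by move=> i j ij; apply/val_inj; rewrite /= -(tauP i) -(tauP j) ij.
have Mtau (c : 'I_N -> K) : \sum_j iota (c j) * M (tau j) = 0 -> forall j, c j = 0.
  move=> c0 j; apply/eqP; rewrite -(fmorph_eq0 iota); apply/eqP.
  rewrite -(invF_f tau_inj j); move: (tau j) => i.
  apply: (hurwitz_mono_indep n_gt0 hST (c := fun i => iota (c (invF tau_inj i)))) => [l|].
    exists (c (invF tau_inj l))%:P, 1; rewrite evC rmorph1 divr1; split=> //.
    exact: oner_neq0.
  by rewrite (reindex_inj tau_inj) -[RHS]c0; apply: eq_bigr => l _; rewrite invF_f.
have kbeta j : (kappa j == 0) = (k j * beta j == 0).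
  have -> : (kappa j == 0) = (kappa j ^+ p == 0) by rewrite expf_eq0 p_gt0.
  by rewrite -kE mulrAC mulf_eq0 signr_eq0 orbF.
split=> [/Mtau kappa0 j adm adm'|k0].
  have /eqP := kappa0 j; rewrite kbeta mulf_eq0 => /orP[/eqP//|].
  by move: adm'; rewrite -beta_adm // => /negPf->.
rewrite /y big1 // => j _; have /eqP -> : kappa j == 0; last by rewrite rmorph0 mul0r.
rewrite kbeta mulf_eq0; have [adm|/kadm->] := boolP (admissible n j); last by rewrite eqxx.
have [adm'|] := boolP (admissible n (tau j)); first by rewrite k0 ?eqxx.
by rewrite -beta_adm // negbK => ->; rewrite orbT.
Qed.

End Exactness.

(** * The genus and the a-number *)

Section Dimension.
Variables (K F : fieldType) (iota : {rmorphism K -> F}) (V : lmodType F).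
Implicit Type A : set V.

Lemma quotient_basis_leq A d1 d2 (e1 : 'I_d1 -> V) (e2 : 'I_d2 -> V) :
  quotient_basis iota A [set 0] e1 -> quotient_basis iota A [set 0] e2 -> (d1 <= d2)%N.
Proof.
move=> [A1 _ ind1] [_ span2 _].
have /choice[c cE] i : exists c : 'I_d2 -> K, e1 i = \sum_j iota (c j) *: e2 j.
  have [c /= e0] := span2 _ (A1 i); exists c; apply/eqP; rewrite -subr_eq0.
  exact/eqP.
pose C := \matrix_(i, j) c i j.
have freeC : row_free C.
  rewrite -kermx_eq0; apply/eqP/row_matrixP => i; rewrite row0.
  have kC : row i (kermx C) *m C = 0 by rewrite -row_mul mulmx_ker row0.
  move: (row i _) kC => v vC; apply/rowP => l; rewrite mxE.
  apply: (ind1 (fun l => v 0 l)) => /=.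
  under eq_bigr do rewrite cE scaler_sumr.
  rewrite exchange_big big1 // => j _ /=.
  under eq_bigr do rewrite scalerA -rmorphM.
  rewrite -scaler_suml -rmorph_sum (_ : \sum_i0 _ = 0) ?rmorph0 ?scale0r //.
  have := congr1 (fun w : 'rV_d2 => w 0 j) vC; rewrite !mxE => vC0.
  by rewrite -[RHS]vC0; apply: eq_bigr => i0 _; rewrite mxE.
by move: (rank_leq_col C); rewrite (eqP freeC).
Qed.

Lemma dim_eq A d (e : 'I_d -> V) : quotient_basis iota A [set 0] e -> Defs.dim iota A = d.
Proof.
move=> be; rewrite /Defs.dim /quotient_dim.
have [e' be'] := xgetPex 0%N (ex_intro (fun d => exists e : 'I_d -> V, quotient_basis iota A
    [set 0] e) d (ex_intro _ e be)).
by apply/eqP; rewrite eqn_leq (quotient_basis_leq be' be) (quotient_basis_leq be be').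
Qed.

Lemma dim_family A (I : finType) (P : pred I) (m : I -> V) :
    (forall i, P i -> A (m i)) ->
    (forall v, A v -> exists k : I -> K, (forall i, ~~ P i -> k i = 0) /\
      v = \sum_i iota (k i) *: m i) ->
    (forall k : I -> K, \sum_i iota (k i) *: m i = 0 -> forall i, k i = 0) ->
  Defs.dim iota A = #|P|.
Proof.
move=> Am spanA ind; apply: (@dim_eq _ _ (fun i : 'I_#|P| => m (enum_val i))); split.
- by move=> i; apply: Am; exact: (enum_valP i).
- move=> v /spanA[k [k0 ->]]; exists (fun i => k (enum_val i)) => /=.
  apply/eqP; rewrite subr_eq0 -(big_enum_val (A := P) (fun i => iota (k i) *: m i)) /=.
  rewrite [X in X == _](bigID P) /= [X in _ + X]big1 ?addr0 // => i /k0->.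
  by rewrite rmorph0 scale0r.
move=> c /= c0 l; pose k i := \sum_(l | enum_val l == i) c l.
have <- : k (enum_val l) = c l.
  rewrite /k (big_pred1 l) // => i; exact: (inj_eq enum_val_inj).
move: (enum_val l); apply: ind; rewrite -[RHS]c0.
transitivity (\sum_i \sum_l if enum_val l == i then iota (c l) *: m i else 0).
  by apply: eq_bigr => i _; rewrite -big_mkcond -scaler_suml -rmorph_sum.
rewrite exchange_big; apply: eq_bigr => i _ /=.
by rewrite -big_mkcond (big_pred1 (enum_val i)) // => j; rewrite eq_sym.
Qed.

End Dimension.

Lemma base_field_perfect p (K : fieldType) : base_field p K ->
  forall c : K, exists k, c = k ^+ p.
Proof.
move=> [charK [closedK|[m _ cardK]]] c; have p_gt0 := prime_gt0 (pcharf_prime charK).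
  have [k kE] := closedK p (fun i => if i == 0%N then c else 0) p_gt0.
  exists k; rewrite kE; case: (p) p_gt0 => // p' _.
  by rewrite big_ord_recl /= expr0 mulr1 big1 ?addr0 // => i _; rewrite mul0r.
move: cardK; rewrite /has_card; set q := ((p ^ m) ^ 2)%N.
move=> /card_set_bijP[f [fq f_inj f_surj]].
have /choice[g gE] (i : 'I_q) : exists x : K, f x = i.
  by have [x _ fx] := f_surj i (ltn_ord i); exists x.
pose h (i : 'I_q) : 'I_q := Ordinal (fq (g i ^+ p) I).
have f_inj' x y : f x = f y -> x = y by apply: f_inj; rewrite in_setT.
have h_inj : injective h.
  move=> i j /(congr1 val) /= /f_inj'; rewrite -!(pFrobenius_autE charK) => /fmorph_inj gij.
  by apply/val_inj; rewrite /= -!gE gij.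
pose i0 : 'I_q := Ordinal (fq c I).
exists (g (invF h_inj i0)); apply: f_inj'.
by have /(congr1 val) := f_invF h_inj i0.
Qed.

(** If u were algebraic over K, so would be S^N = - u^n / (1 + u), and hence S. *)
Lemma exists_hurwitz_gen n (K F : fieldType) (iota : {rmorphism K -> F}) :
  (0 < n)%N -> hurwitz_function_field n iota -> exists S T, hurwitz_gen n iota S T.
Proof.
move=> n_gt0 [S [T [eqn tr gen]]]; exists S, T; split=> //.
  by apply/eqP=> S0; apply: tr; rewrite S0; exact: algebraic0.
rewrite -/(hurwitz_u n S T); set u := hurwitz_u n S T => alg; apply: tr.
have eS : S * (1 + u) = - T ^+ n.
  apply/eqP; rewrite -addr_eq0 mulrDr mulr1 -(hurwitz_Sn S T n_gt0).
  by rewrite -[X in _ == X]eqn; apply/eqP; ring.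
have [S0 | S0] := eqVneq S 0; first by rewrite S0; exact: algebraic0.
have u1 : 1 + u != 0.
  apply: contraNneq S0 => u1; move/eqP: eS; rewrite u1 mulr0 eq_sym oppr_eq0 expf_eq0 n_gt0 /=.
  by move=> /eqP T0; move: eqn; rewrite T0 mulr0 expr0n eqn0Ngt n_gt0 !add0r => /eqP.
have SN : S ^+ hurwitz_degree n = - u ^+ n / (1 + u).
  apply: (mulIf u1); rewrite divfK // hurwitz_degreeE exprSr -mulrA eS mulrN.
  by rewrite /u /hurwitz_u exprMn -exprM mulnC.
have algX k : algebraicOver iota (u ^+ k).
  by elim: k => [|k IH]; rewrite ?exprS; [exact: algebraic1 | exact: algebraic_mul].
have algSN : algebraicOver iota (S ^+ hurwitz_degree n).
  rewrite SN; apply: algebraic_div; first exact: algebraic_opp.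
  exact: algebraic_add (algebraic1 _) alg.
have mN : (0 < hurwitz_degree n)%N by rewrite hurwitz_degreeE.
apply/integral_algebraic; apply: (@integral_root_monic _ _ iota S ('X^(hurwitz_degree n) - (S
    ^+ hurwitz_degree n)%:P)).
- exact: monicXnsubC.
- by rewrite rootE !hornerE subrr.
apply/integral_poly => i; rewrite coefB coefXn coefC; apply: integral_sub;
  first exact: integral_nat.
by case: ifP => _; [exact/integral_algebraic | exact: integral0].
Qed.

(** As n is prime to N, n i / N is not an integer, so the two ceilings add up to n + 1 and the two
    inequalities become opposite. Equality N e = (n - 1) i + N is excluded as n - 1 is prime to
    N. *)
Lemma admissible_opp n i : (0 < n)%N -> (0 < i < hurwitz_degree n)%N ->
  admissible n (hurwitz_degree n - i) = ~~ admissible n i.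
Proof.
move=> n_gt0 /andP[i0 iN]; rewrite /admissible.
have := hurwitz_exp_bounds n i; have := hurwitz_exp_bounds n (hurwitz_degree n - i).
have cop m : coprime m (hurwitz_degree n) -> (m * i)%N <> 0 %[mod hurwitz_degree n].
  move=> cm /eqP; rewrite mod0n => /dvdnP[k mi].
  have : (hurwitz_degree n %| m * i)%N by apply/dvdnP; exists k.
  by rewrite Gauss_dvdr 1?coprime_sym // gtnNdvd.
have := cop _ (coprime_hurwitz_degree n); have := cop _ (coprime_pred_hurwitz_degree n).
move: (hurwitz_exp n i) (hurwitz_exp n _) => e e'.
move: (hurwitz_degree n) iN => N iN c1 c2 /andP[lo' hi'] /andP[lo hi].
have ni : (n * i != N * e)%N by apply/eqP => ne; apply: c2; rewrite ne modnMr mod0n.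
have ee : (e + e' = n.+1)%N.
  have lt : (n * i < N * e)%N by rewrite ltn_neqAle ni.
  have h1 : (N * n < N * (e + e'))%N.
    by move: lt lo' iN; rewrite mulnDr mulnBr; clear; nia.
  have h2 : (N * (e + e') < N * n.+2)%N.
    by move: hi hi' iN; rewrite mulnDr mulnBr; clear; nia.
  have N_gt0 : (0 < N)%N by apply: leq_trans iN.
  by move: h1 h2; rewrite !ltn_pmul2l //; clear; lia.
have nne : (N * e != n.-1 * i + N)%N.
  apply/eqP => ne; apply: c1; rewrite mod0n -(modnDr (n.-1 * i)) -ne; exact: modnMr.
rewrite -leqNgt [RHS]leq_eqVlt (negPf nne) /=.
move: ee n_gt0 iN; clear; case: n => // n ee _ iN.
have -> : e' = (n.+2 - e)%N by move: ee; clear; lia.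
move: ee; clear -iN; rewrite /= => ee; have le : (e <= n.+2)%N by move: ee; clear; lia.
rewrite mulnBr; apply/idP/idP; nia.
Qed.

Section HurwitzInvariants.
Variables (n p : nat) (K F : fieldType) (iota : {rmorphism K -> F}).
Hypotheses (n_gt0 : (0 < n)%N) (pN : ~~ (p %| hurwitz_degree n)%N).
Hypotheses (bK : base_field p K) (hF : hurwitz_function_field n iota).

Local Notation N := (hurwitz_degree n).
Local Notation adm := (admissible n).

Lemma hurwitz_setting : exists S T (charF : p \in [pchar F]) (Du : derivation iota),
  [/\ hurwitz_gen n iota S T, Du (hurwitz_u n S T) = 1
    & forall c : K, exists k, c = k ^+ p].
Proof.
have [S [T hST]] := exists_hurwitz_gen n_gt0 hF.
have charF : p \in [pchar F] by rewrite (fmorph_pchar iota); case: bK.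
have perfK := base_field_perfect bK.
have [D D1] := exists_der iota perfK (hurwitz_pspan n_gt0 hST charF pN perfK) (hurwitz_pindep
    n_gt0 hST (charF := charF) pN).
by exists S, T, charF, D.
Qed.

Let sum_mono S T (Du : derivation iota) (k : 'I_N -> K) :
  \sum_i iota (k i) *: (hurwitz_mono n S T i *: d (hurwitz_u n S T) : differential iota) =
  (\sum_i iota (k i) * hurwitz_mono n S T i) *: d (hurwitz_u n S T).
Proof. by rewrite scaler_suml; apply: eq_bigr => i _; rewrite scalerA. Qed.

Let dim_monos S T (Du : derivation iota) (A : set (differential iota)) (P : pred 'I_N) :
    hurwitz_gen n iota S T -> Du (hurwitz_u n S T) = 1 ->
    (forall i, P i -> A (hurwitz_mono n S T i *: d (hurwitz_u n S T))) ->
    (forall v, A v -> exists2 g, v = g *: d (hurwitz_u n S T) & exists k : 'I_N -> K,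
      (forall i, ~~ P i -> k i = 0) /\ g = \sum_i iota (k i) * hurwitz_mono n S T i) ->
  Defs.dim iota A = #|P|.
Proof.
move=> hST Du1 AP spanA.
apply: (@dim_family _ _ iota _ A _ P (fun i => hurwitz_mono n S T i *: d (hurwitz_u n S T))) => //.
  move=> v /spanA[g -> [k [k0 gE]]]; exists k; split=> //.
  by rewrite sum_mono // gE.
move=> k; rewrite sum_mono // => /(congr1 (fun w : differential iota => w Du)).
rewrite diffE Du1 mulr1 => k0 i; apply/eqP; rewrite -(fmorph_eq0 iota); apply/eqP.
move: i; apply: (hurwitz_mono_indep n_gt0 hST) => // j.
by exists (k j)%:P, 1; rewrite evC rmorph1 divr1; split=> //; exact: oner_neq0.
Qed.

Let holomorphic_coef S T v : holomorphic (v : differential iota) ->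
    (forall t, exists g, d t = g *: d (hurwitz_u n S T) :> differential iota) ->
  exists g, v = g *: d (hurwitz_u n S T).
Proof.
move=> [[f [t [_ ->]]] _] /(_ t)[g ->]; exists (f * g).
by rewrite scalerA.
Qed.

Theorem genus_hurwitz : genus iota = #|[pred j : 'I_N | adm j]|.
Proof.
have [S [T [charF [Du [hST Du1 perfK]]]]] := hurwitz_setting.
have span_u := hurwitz_pspan n_gt0 hST charF pN perfK.
apply: (dim_monos hST Du1) => [i adm_i|v hv].
  exact: (hurwitz_mono_holomorphic n_gt0 hST charF pN perfK Du1).
have [|g vE] := holomorphic_coef hv (S := S) (T := T).
  by move=> t; exists (Du t); apply/funext => D; rewrite [RHS]diffE; exact: (der_gen span_u Du1).
exists g => //; rewrite vE in hv.
exact: (holomorphic_span n_gt0 hST charF pN perfK Du1).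
Qed.

Theorem a_number_hurwitz (tau : 'I_N -> 'I_N) :
    (forall j : 'I_N, (p * tau j) %% N = j)%N ->
  a_number iota p = #|[pred j : 'I_N | adm j && ~~ adm (tau j)]|.
Proof.
move=> tauP; have [S [T [charF [Du [hST Du1 perfK]]]]] := hurwitz_setting.
have span_u := hurwitz_pspan n_gt0 hST charF pN perfK.
have indep_u := hurwitz_pindep n_gt0 hST (charF := charF) pN.
have cart g := cartier_eq0 perfK span_u indep_u (ev_inj0 hST) (hurwitz_alg n_gt0 hST) Du1 g.
have exact := exact_hurwitz_mono n_gt0 hST charF pN perfK Du1.
apply: (dim_monos hST Du1) => [i /andP[adm_i nadm]|v [hv cv]].
  split; first exact: (hurwitz_mono_holomorphic n_gt0 hST charF pN perfK Du1).
  apply/cart; pose k (j : 'I_N) : K := if j == i then 1 else 0.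
  have -> : hurwitz_mono n S T i = \sum_j iota (k j) * hurwitz_mono n S T j.
    rewrite (bigD1 i) //= /k eqxx rmorph1 mul1r big1 ?addr0 // => j /negPf->.
    by rewrite rmorph0 mul0r.
  have k0 (j : 'I_N) : ~~ adm j -> k j = 0.
    by rewrite /k; case: eqP => // ->; rewrite adm_i.
  apply/(exact tau k tauP k0) => j _; rewrite /k; case: eqP => // ->.
  by rewrite (negPf nadm).
have [|g vE] := holomorphic_coef hv (S := S) (T := T).
  by move=> t; exists (Du t); apply/funext => D; rewrite [RHS]diffE; exact: (der_gen span_u Du1).
exists g => //; rewrite vE in hv cv.
have [k [k0 gE]] := holomorphic_span n_gt0 hST charF pN perfK Du1 hv.
exists k; split=> // j; rewrite inE negb_and negbK => /orP[/k0//|adm'].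
have [adm_j|/k0//] := boolP (adm j).
by move/cart: cv; rewrite gE => /(exact tau k tauP k0); apply.
Qed.

End HurwitzInvariants.

Lemma exists_frobenius_index (N p : nat) : (0 < N)%N -> (0 < p)%N -> coprime p N ->
  exists tau : 'I_N -> 'I_N, forall j : 'I_N, (p * tau j %% N = j)%N.
Proof.
move=> N_gt0 p_gt0 cop; have [a b ab _] := egcdnP N p_gt0.
exists (fun j => Ordinal (ltn_pmod (a * j) N_gt0)) => j /=.
rewrite modnMmr mulnA [(p * a)%N]mulnC ab (eqP cop) mulnDl mul1n mulnAC modnMDl.
by rewrite modn_small.
Qed.

Theorem corollary5p1 (n p1 p2 : nat) (K1 F1 K2 F2 : fieldType)
    (iota1 : {rmorphism K1 -> F1}) (iota2 : {rmorphism K2 -> F2}) :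
  let N := (n ^ 2 - n + 1)%N in
  let m1 := (p1 %% N)%N in
  let m2 := (N - m1)%N in
  (0 < n)%N ->
  prime p1 -> ~~ (p1 %| N)%N -> hurwitz_maximal n p1 ->
  prime p2 -> ~~ (p2 %| N)%N -> hurwitz_maximal n p2 ->
  p2 = m2 %[mod N] ->
  base_field p1 K1 -> hurwitz_function_field n iota1 ->
  base_field p2 K2 -> hurwitz_function_field n iota2 ->
  (a_number iota1 p1 + a_number iota2 p2)%N = genus iota1.
Proof.
rewrite -/(hurwitz_degree n) => N m1 m2 n_gt0 pr1 p1N _ pr2 p2N _ p2E bK1 hF1 bK2 hF2.
have N_gt0 : (0 < N)%N by rewrite /N hurwitz_degreeE.
have [tau tauP] := exists_frobenius_index N_gt0 (prime_gt0 pr1) (etrans (prime_coprime _ pr1) p1N).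
(* The reduction modulo N matters only for tau j = 0. *)
pose tau' (j : 'I_N) : 'I_N := Ordinal (ltn_pmod (N - tau j) N_gt0).
have p12 : (p1 + p2 = 0 %[mod N])%N.
  rewrite -modnDmr p2E modnDmr /m2 -modnDml -/m1 subnKC ?modnn ?mod0n //.
  by rewrite ltnW // ltn_pmod.
have tauP' (j : 'I_N) : (p2 * tau' j %% N = j)%N.
  rewrite /= modnMmr -[RHS](tauP j) -[RHS](modnMDl p2).
  have <- : (p2 * (N - tau j) + (p1 + p2) * tau j = p2 * N + p1 * tau j)%N.
    by have := ltn_ord (tau j); move: (tau j : nat) => t; rewrite mulnBr; clear; nia.
  have z : ((p1 + p2) * tau j %% N = 0)%N by rewrite -modnMml p12 mod0n mul0n mod0n.
  by rewrite -[RHS]modnDmr z addn0.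
rewrite (a_number_hurwitz n_gt0 p1N bK1 hF1 tauP) (a_number_hurwitz n_gt0 p2N bK2 hF2 tauP').
(* The admissible j are split according to whether tau j is admissible: those with tau j admissible
   are counted by p2, the others by p1. *)
rewrite (genus_hurwitz n_gt0 p1N bK1 hF1) addnC -[RHS](cardID [pred j : 'I_N | admissible n
    (tau j)]).
congr (_ + _)%N; apply: eq_card => j; rewrite !inE /=; last by rewrite andbC.
have [adm_j|] := boolP (admissible n j); last by rewrite /= ?andbF.
(* The index 0 is not admissible, so [admissible_opp] applies to tau j. *)
have tau_gt0 : (0 < tau j)%N.
  rewrite lt0n; apply: contraL adm_j => /eqP tau0; rewrite -(tauP j) tau0 muln0 mod0n.
  by rewrite /admissible /hurwitz_exp !muln0 !add0n divn_small ?muln0 // hurwitz_degreeE.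
rewrite /= modn_small ?ltn_subrL ?tau_gt0 // admissible_opp ?negbK ?andbT //.
by rewrite tau_gt0 ltn_ord.
Qed.
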